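(* Let $\mathbb T=\mathbb R/\mathbb Z$ and $F(s)=\frac12s^2$. Let $\eta\in L^1(\mathbb R)$ be an odd function with $\int_{\mathbb R}\eta(z)\,dz=0$, $\int_{\mathbb R}z\,\eta(z)\,dz=-1$ and $C_\eta:=\frac12\int_{\mathbb R}|z|^2|\eta(z)|\,dz<\infty$, and for $\varepsilon>0$ let $\eta_\varepsilon$ be the periodization on $\mathbb T$ of $z\mapsto\varepsilon^{-2}\eta(z/\varepsilon)$. Define $$(\mathbf A_\varepsilon(u))(x)=\int_{\mathbb T}\eta_\varepsilon(x-y)\big(F(u(x))-F(u(y))\big)\,dy .$$ Fix $R>0$. There exists $C_R>0$, independent of $\varepsilon$, such that the following hold. (i) For every $u\in H^2(\mathbb T)\cap L^\infty(\mathbb T)$ with $\|u\|_{H^2(\mathbb T)}+\|u\|_{L^\infty(\mathbb T)}\le R$, $$\|\mathbf A_\varepsilon(u)+\partial_xF(u)\|_{L^2(\mathbb T)}\le C_R\,\varepsilon .$$ (ii) If $u_\varepsilon$ and $v_\varepsilon$ solve $\partial_tu=\mathbf A_\varepsilon(u)$ on $[0,\mathsf T]$ and remain bounded by $R$ in $H^2(\mathbb T)$ on this interval, then $$\|u_\varepsilon(t)-v_\varepsilon(t)\|_{L^2(\mathbb T)}\le e^{C_Rt}\,\|u_\varepsilon(0)-v_\varepsilon(0)\|_{L^2(\mathbb T)},\qquad t\in[0,\mathsf T].$$ Consequently, in any regime where the solution of the Burgers equation $\partial_tu+\partial_xF(u)=0$ and the solutions of $\partial_tu_\varepsilon=\mathbf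 A_\varepsilon(u_\varepsilon)$ remain bounded in $H^2(\mathbb T)\cap L^\infty(\mathbb T)$ on $[0,\mathsf T]$ uniformly in $\varepsilon$, the nonlocal flows are Lipschitz stable in $L^2(\mathbb T)$ on $[0,\mathsf T]$ uniformly in $\varepsilon$, and they are consistent in $L^2(\mathbb T)$ with the Burgers equation with rate $r(\varepsilon)=\mathcal O(\varepsilon)$ along such states.
   Context: The periodization of an integrable function $h$ on $\mathbb R$ is the function $\sum_{n\in\mathbb Z}h(\cdot+n)$ on $\mathbb T$. Since $\int_{\mathbb T}\eta_\varepsilon=0$, one has $\mathbf A_\varepsilon(u)=-D_\varepsilon(F(u))$ with $(D_\varepsilon u)(x)=\int_{\mathbb T}\eta_\varepsilon(x-y)u(y)\,dy$. Functions are real-valued; evolution equations are understood as $L^2(\mathbb T)$-valued equations in time. The constant $C_R$ may depend on $R$ and $\eta$. In the last assertion, ''Lipschitz stable uniformly in $\varepsilon$'' and ''consistent with rate $\mathcal O(\varepsilon)$'' mean estimates of the form (ii) and (i), respectively, with constants independent of $\varepsilon$. *)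

(* Defs.v *)
From HB Require Import structures.
From mathcomp Require Import all_boot all_order all_algebra.
From mathcomp Require Import all_classical all_reals all_analysis.

Set Implicit Arguments.
Unset Strict Implicit.
Unset Printing Implicit Defensive.
Import Order.TTheory GRing.Theory Num.Theory.
Import numFieldNormedType.Exports.

Local Open Scope classical_set_scope.
Local Open Scope ring_scope.

(* Functions on the circle R/Z are 1-periodic functions on R; they are
   integrated over the fundamental domain [0, 1[, that is, with respect to
   Lebesgue measure restricted to it. *)
Lemma fundamental_domain_finite (R : realType) :
  (@lebesgue_measure R `[0%R, 1%R[%classic < +oo)%E.
Proof. by rewrite lebesgue_measure_itv/= lte_fin ltr01 -EFinB ltry. Qed.

Definition torus_measure (R : realType) :
    {finite_measure set (measurableTypeR R) -> \bar R} :=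
  @mfrestr _ (measurableTypeR R) R _ lebesgue_measure
    (measurable_itv `[(0 : R), 1[) (fundamental_domain_finite R).

Section torus_spaces.
Context {R : realType}.
Implicit Types (p : \bar R) (u g phi : R -> R).

(* Representatives of the elements of L^p(T). *)
Definition LpT p u : Prop := periodic u 1 /\ u \in Lfun (torus_measure R) p.

Definition normT p u : \bar R := Lnorm (torus_measure R) p (EFin \o u).

Definition test_function phi : Prop :=
  periodic phi 1 /\ forall n x, derivable (derive1n n phi) x 1.

Definition is_weak_derivative u g : Prop :=
  LpT 2%:E g /\
  forall phi, test_function phi ->
    \int[torus_measure R]_x (u x * derive1 phi x) =
    - \int[torus_measure R]_x (g x * phi x).

Definition weakly_differentiable u : Prop := exists g, is_weak_derivative u g.

(* A representative of the (a.e. unique) weak derivative; the value is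
   meaningful only for weakly differentiable functions. *)
Definition weak_derivative u : R -> R :=
  xget (fun=> 0) [set g | is_weak_derivative u g].

Definition H2T u : Prop :=
  [/\ LpT 2%:E u, weakly_differentiable u &
      weakly_differentiable (weak_derivative u)].

Definition H2norm u : \bar R :=
  ((normT 2%:E u ^+ 2 + normT 2%:E (weak_derivative u) ^+ 2 +
    normT 2%:E (weak_derivative (weak_derivative u)) ^+ 2) `^ 2^-1)%E.

End torus_spaces.
Arguments normT {R} p%_E u%_R.

Section nonlocal_operator.
Context {R : realType}.
Implicit Types (eta h u : R -> R) (eps : R).

Definition burgers_flux (s : R) : R := s ^+ 2 / 2.

(* The sum over n in Z, as the limit of the sums over -N <= n <= N. For an
   integrable h it converges absolutely at almost every x, so the order of
   summation only matters on a null set. *)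
Definition periodization h (x : R) : R :=
  limn (fun N : nat => \sum_(0 <= k < N.*2.+1) h (x + (k%:R - N%:R))).

Definition scaled_kernel eta eps : R -> R :=
  periodization (fun z => eps ^- 2 * eta (z / eps)).

Definition nonlocal eta eps u (x : R) : R :=
  \int[torus_measure R]_y
    (scaled_kernel eta eps (x - y) * (burgers_flux (u x) - burgers_flux (u y))).

Definition second_moment eta : \bar R :=
  (2^-1%:E * \int[@lebesgue_measure R]_z (`|z| ^+ 2 * `|eta z|)%:E)%E.

(* Oddness is required almost everywhere, eta being an element of L^1(R). *)
Definition admissible_kernel eta : Prop :=
  [/\ (@lebesgue_measure R).-integrable setT (EFin \o eta),
      {ae @lebesgue_measure R, forall z, eta (- z) = - eta z},
      \int[@lebesgue_measure R]_z eta z = 0,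
      \int[@lebesgue_measure R]_z (z * eta z) = -1 &
      (second_moment eta < +oo)%E].

Definition consistent_at eta (C eps : R) u : Prop :=
  weakly_differentiable (burgers_flux \o u) /\
  (normT 2%:E (nonlocal eta eps u \+ weak_derivative (burgers_flux \o u))
     <= (C * eps)%:E)%E.

End nonlocal_operator.

(* A time-dependent function u is written as t |-> (x |-> u t x). *)
Section evolution.
Context {R : realType}.
Implicit Types (eta g : R -> R) (u v : R -> R -> R) (eps t C M : R).

(* g is the derivative at t of u : [0, tmax] -> L^2(T), for the norm of
   L^2(T); it is one-sided at the endpoints. *)
Definition is_time_derivative (tmax : R) u t g : Prop :=
  normT 2%:E (fun x => (u s x - u t x) / (s - t) - g x)
    @[s --> within `[0, tmax] t^'] --> 0%E.

Definition nonlocal_solution eta eps (tmax : R) u : Prop :=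
  forall t, t \in `[0, tmax] ->
    LpT 2%:E (u t) /\ is_time_derivative tmax u t (nonlocal eta eps (u t)).

Definition burgers_solution (tmax : R) u : Prop :=
  forall t, t \in `[0, tmax] ->
    [/\ LpT 2%:E (u t),
        weakly_differentiable (burgers_flux \o u t) &
        is_time_derivative tmax u t
          (\- weak_derivative (burgers_flux \o u t))].

Definition H2_bounded (tmax M : R) u : Prop :=
  forall t, t \in `[0, tmax] -> H2T (u t) /\ (H2norm (u t) <= M%:E)%E.

Definition H2_Linfty_bounded (tmax M : R) u : Prop :=
  forall t, t \in `[0, tmax] ->
    [/\ H2T (u t), LpT +oo%E (u t) &
        (H2norm (u t) + normT +oo (u t) <= M%:E)%E].

Definition L2_stable (tmax C : R) u v : Prop :=
  forall t, t \in `[0, tmax] ->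
    (normT 2%:E (u t \- v t) <=
       (expR (C * t))%:E * normT 2%:E (u 0%R \- v 0%R))%E.

End evolution.

(* Main.v *)
Require Import Defs.
From mathcomp Require Import all_boot all_order all_algebra.
From mathcomp Require Import all_classical all_reals all_analysis.
From mathcomp Require Import measurable_realfun ring lra.

(* A function u in H^2(T) has a C^1 representative U whose derivative G has a weak
   derivative k in L^2, with sup norms of U and G controlled by the H^2 norm.
   Unfolding the periodization turns the nonlocal operator into
   - int_R h(z) F(u)(x - z) dz with h(z) = eps^-2 eta(z/eps), where int h = 0,
   int z h = -1, int |z| |h| is independent of eps and int z^2 |h| is of order eps.
   (i) Taylor's formula for F(U) leaves an integral remainder r(x, z) whose L^2
   norm in x is at most const * z^2, and Cauchy-Schwarz in |h(z)| dz bounds the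
   defect by const * int z^2 |h| = O(eps).
   (ii) For two solutions, w = u - v satisfies w' = - int h(z) (a w)(x - z) dz with
   a = (u + v)/2 Lipschitz. As h is odd, 2 <w, w'> only involves
   h(z) (a(x - z) - a(x)) w(x) w(x - z), so that it is at most
   Lip(a) * int |z| |h| * |w|^2, and Gronwall's lemma concludes. *)

(** Elements of L^2 are represented by functions and agree with their smooth representatives only
    almost everywhere, whereas the operator evaluates F(u) at the point x itself. The unfolded
    formula is thus used only at points where u equals U, and the estimates are made for U. Weak
    derivatives are seen only through test integrals. To recover functions from them, indicators of
    arcs are obtained as limits of trigonometric expressions, which are visibly smooth and periodic;
    no bump function or mollifier is built. Since the second derivative k is merely square
    integrable, there is no pointwise Taylor bound of order z^2: the remainder is at most |z| times
    the integral of |k| over a window of half-width |z|, and it reaches order z^2 only after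
    integration in x. In the stability estimate, bounding the convolution directly would cost the
    integral of |h|, which is of order 1/eps. Antisymmetrization trades it for the first absolute
    moment, which the scaling leaves unchanged. *)

Set Implicit Arguments.
Unset Strict Implicit.
Unset Printing Implicit Defensive.
Import Order.TTheory GRing.Theory Num.Theory.
Import numFieldNormedType.Exports.

Local Open Scope classical_set_scope.
Local Open Scope ring_scope.

(** * Lebesgue measure on the circle *)

Section change_of_variables.
Context {R : realType}.
Local Notation mu := (@lebesgue_measure R).
Local Open Scope ereal_scope.
Implicit Types (f : R -> \bar R) (a b x : R).

Lemma measurable_affine a b :
  measurable_fun [set: measurableTypeR R] (fun x => (a * x + b)%R : measurableTypeR R).
Proof. by apply: measurable_funD => //; exact: measurable_funM. Qed.

(** Both sides are measures that agree on half-open intervals, so the uniqueness of Lebesgue measure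
    applies. *)
Lemma lebesgue_measure_affine a b (A : set (measurableTypeR R)) : (0 < a)%R ->
  measurable A ->
  mu A = (a%:E * pushforward mu (fun x => (a * x + b)%R : measurableTypeR R) A).
Proof.
move=> a0 mA.
pose phi := (fun x : measurableTypeR R => (a * x + b)%R : measurableTypeR R).
have mphi : measurable_fun setT phi by exact: measurable_affine.
pose phi' : {measure set (measurableTypeR R) -> \bar R} :=
  measure_function_pushforward__canonical__measure_function_Measure mu mphi.
pose nu : {measure set (measurableTypeR R) -> \bar R} := mscale (NngNum (ltW a0)) phi'.
apply: (lebesgue_measure_unique (mu := nu)) => //.
move=> _ [[c d]] _ <-.
rewrite /nu /= /mscale /phi' /= /pushforward.
rewrite (_ : phi @^-1` `]c, d] = `]((c - b) / a)%R, ((d - b) / a)%R]%classic); last first.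
  apply/seteqP; split => x /=; rewrite /phi !in_itv/= => /andP[h1 h2]; apply/andP; split.
  - by rewrite ltr_pdivrMr// mulrC ltrBlDr.
  - by rewrite ler_pdivlMr// mulrC lerBrDr.
  - by move: h1; rewrite ltr_pdivrMr// mulrC ltrBlDr.
  - by move: h2; rewrite ler_pdivlMr// mulrC lerBrDr.
rewrite !lebesgue_measure_itv/= !lte_fin ltr_pM2r ?invr_gt0// ltrD2r.
case: ifPn => cd; last by rewrite mule0.
rewrite -!EFinD -EFinM; congr EFin; field.
by rewrite gt_eqF.
Qed.

Lemma ge0_integral_affine a b f : (0 < a)%R ->
  measurable_fun setT f -> (forall x, 0 <= f x) ->
  \int[mu]_x f (a * x + b)%R = (a^-1)%:E * \int[mu]_x f x.
Proof.
move=> a0 mf f0.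
pose phi := (fun x : measurableTypeR R => (a * x + b)%R : measurableTypeR R).
have mphi : measurable_fun setT phi by exact: measurable_affine.
pose phi' : {measure set (measurableTypeR R) -> \bar R} :=
  measure_function_pushforward__canonical__measure_function_Measure mu mphi.
pose nu : {measure set (measurableTypeR R) -> \bar R} := mscale (NngNum (ltW a0)) phi'.
rewrite [X in _ * X](eq_measure_integral nu)//; last first.
  by move=> A mA _; exact: (lebesgue_measure_affine b a0).
rewrite (ge0_integral_mscale phi' measurableT)//=.
rewrite muleA -EFinM mulVf ?gt_eqF// mul1e.
by rewrite (@ge0_integral_pushforward _ _ _ _ _ phi mphi)//.
Qed.

Lemma ge0_integral_oppr f : 
  measurable_fun setT f -> (forall x, 0 <= f x) ->
  \int[mu]_x f (- x)%R = \int[mu]_x f x.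
Proof.
move=> mf f0.
have mphi : measurable_fun [set: measurableTypeR R] (-%R : _ -> measurableTypeR R) by [].
pose nu : {measure set (measurableTypeR R) -> \bar R} :=
  measure_function_pushforward__canonical__measure_function_Measure mu mphi.
rewrite [RHS](eq_measure_integral nu).
  by rewrite (@ge0_integral_pushforward _ _ _ _ _ _ mphi).
by move=> A mA _; rewrite -[LHS](lebesgue_measureN mA).
Qed.

(** Passage from nonnegative to integrable functions in a change of variables. Integrability keeps
    the difference of the two parts well defined when the factor [c] is distributed over it. *)
Lemma integral_posneg_comp (g : R -> R) (c : R) f :
  (0 < c)%R ->
  (forall h : R -> \bar R, measurable_fun setT h -> (forall x, 0 <= h x) ->
     \int[mu]_x h (g x) = c%:E * \int[mu]_x h x) ->
  mu.-integrable setT f -> 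
  \int[mu]_x f (g x) = c%:E * \int[mu]_x f x.
Proof.
move=> c0 H intf; have mf := measurable_int _ intf.
have ip := integrable_pos_fin_num measurableT intf.
have im := integrable_neg_fin_num measurableT intf.
have -> : \int[mu]_x f (g x) = \int[mu]_x f^\+ (g x) - \int[mu]_x f^\- (g x).
  by have := integralE mu setT (f \o g); rewrite funepos_comp funeneg_comp.
rewrite [X in _ * X]integralE muleBr//; last exact: fin_num_adde_defr.
rewrite H//; last exact: measurable_funepos.
rewrite H//; exact: measurable_funeneg.
Qed.

End change_of_variables.

(** * Integration over the circle and its translation invariance *)

Section torus_integral.
Context {R : realType}.
Local Notation mu := (@lebesgue_measure R).
Local Notation tau := (torus_measure R).
Local Open Scope ereal_scope.
Implicit Types (f : R -> \bar R) (a b c x : R).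

Lemma torus_measureE (A : set R) : tau A = mu (A `&` `[0%R, 1%R[).
Proof. by []. Qed.

Lemma torus_measureT : tau setT = 1.
Proof.
rewrite torus_measureE setTI.
by rewrite lebesgue_measure_itv/= lte_fin ltr01 sube0.
Qed.

Lemma ge0_integral_torus f : measurable_fun [set: R] f -> (forall x, 0 <= f x) ->
  \int[tau]_x f x = \int[mu]_(x in `[0%R, 1%R[) f x.
Proof.
move=> mf f0.
rewrite (@ge0_negligible_integral _ _ _ tau setT (~` `[0%R, 1%R[))//; last 2 first.
- exact: measurableC.
- by have := torus_measureE (~` `[0%R, 1%R[); rewrite setICl measure0.
rewrite setTD setCK; apply: eq_measure_integral => A mA A01.
by have := torus_measureE A; rewrite setIidl.
Qed.

Lemma integral_torus f : measurable_fun [set: R] f ->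
  \int[tau]_x f x = \int[mu]_(x in `[0%R, 1%R[) f x.
Proof.
move=> mf; rewrite integralE [RHS]integralE; congr (_ - _).
- by rewrite ge0_integral_torus//; exact: measurable_funepos.
- by rewrite ge0_integral_torus//; exact: measurable_funeneg.
Qed.

Lemma ge0_integral_shift f a b c : measurable_fun [set: R] f ->
  (forall x, 0 <= f x) ->
  \int[mu]_(x in `[a, b[) f (x + c)%R = \int[mu]_(x in `[(a + c)%R, (b + c)%R[) f x.
Proof.
move=> mf f0; rewrite integral_mkcond [RHS]integral_mkcond.
rewrite -[RHS]mul1e -[X in X%:E * _](@invr1 R) -(@ge0_integral_affine _ 1 c)//; last first.
- by move=> x; exact: erestrict_ge0.
- apply/(measurable_restrictT _ _).1 => //; exact: measurable_funTS.
apply: eq_integral => x _; rewrite !patchE mul1r.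
by rewrite !mem_setE !in_itv/= lerD2r ltrD2r.
Qed.

Lemma ge0_integral_itv_split f a b c : (a <= b)%R -> (b <= c)%R -> 
  measurable_fun [set: R] f -> (forall x, 0 <= f x) ->
  \int[mu]_(x in `[a, c[) f x = \int[mu]_(x in `[a, b[) f x + \int[mu]_(x in `[b, c[) f x.
Proof.
move=> ab bc mf f0.
rewrite (_ : `[a, c[%classic = `[a, b[%classic `|` `[b, c[%classic); last first.
  by rewrite -itv_bndbnd_setU// bnd_simp.
rewrite ge0_integral_setU//.
- exact: measurable_funTS.
- apply/disj_setPS => x /=; rewrite !in_itv/= => -[] /andP[_ xb] /andP[].
  by rewrite leNgt xb.
Qed.

Section periodic.
Variable f : R -> \bar R.
Hypotheses (mf : measurable_fun [set: R] f) (f0 : forall x, 0 <= f x).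
Hypothesis fp : forall x, f (x + 1)%R = f x.

Lemma periodic_int (z : int) x : f (x + z%:~R)%R = f x.
Proof.
have natp (n : nat) y : f (y + n%:R)%R = f y.
  elim: n => [|n ih]; first by rewrite addr0.
  by rewrite -natr1 addrA fp.
case: z => n; first by rewrite -pmulrn natp.
by rewrite NegzE mulrNz -pmulrn -[RHS](congr1 f (subrK n.+1%:R x)) natp.
Qed.

(** Cut [[a, a + 1[] at the integer [n] just above [a], move the left piece by one period to the
    right end, and obtain [[n, n + 1[], an integer translate of the fundamental domain. *)
Lemma ge0_integral_period a : \int[mu]_(x in `[a, (a + 1)%R[) f x = \int[tau]_x f x.
Proof.
rewrite ge0_integral_torus//.
pose n : R := ((Num.ceil a)%:~R)%R.
have an : (a <= n)%R by exact: Num.Theory.ceil_ge.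
have na : (n <= a + 1)%R.
  have := Num.Theory.ceilB1_lt a; rewrite intrB => h.
  by rewrite -lerBlDr ltW.
rewrite (@ge0_integral_itv_split _ a n)//.
have := @ge0_integral_shift _ a n 1 mf f0.
under eq_integral do rewrite fp.
move=> ->; rewrite addeC -ge0_integral_itv_split//; last by rewrite lerD2r.
have := @ge0_integral_shift _ 0 1 n mf f0.
under eq_integral do rewrite periodic_int.
by move=> ->; rewrite add0r addrC.
Qed.

Lemma ge0_integral_torus_shift c : \int[tau]_x f (x + c)%R = \int[tau]_x f x.
Proof.
rewrite [LHS]ge0_integral_torus//; last first.
  by apply: (measurableT_comp mf) => //; exact: measurable_funD.
by rewrite ge0_integral_shift// add0r addrC ge0_integral_period.
Qed.

End periodic.

Lemma integral_torus_shift f c : measurable_fun [set: R] f -> (forall x, f (x + 1)%R = f x) ->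
  \int[tau]_x f (x + c)%R = \int[tau]_x f x.
Proof.
move=> mf fp.
have := integralE tau setT (f \o (fun x => x + c)%R).
rewrite funepos_comp funeneg_comp => /= ->; rewrite [RHS]integralE.
have fpp x : f^\+ (x + 1)%R = f^\+ x by rewrite !funeposE fp.
have fpn x : f^\- (x + 1)%R = f^\- x by rewrite !funenegE fp.
rewrite (ge0_integral_torus_shift (measurable_funepos mf) _ fpp)//.
by rewrite (ge0_integral_torus_shift (measurable_funeneg mf) _ fpn).
Qed.

End torus_integral.

(** * Cauchy-Schwarz inequality in squared form *)

Section cauchy_schwarz.
Context d (T : measurableType d) (R : realType).
Variable m : {measure set T -> \bar R}.
Local Open Scope ereal_scope.

Lemma poweR_sqr (x : \bar R) : 0 <= x -> x `^ 2 = x ^+ 2.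
Proof.
case: x => [r r0|_|//]; first by rewrite poweR_EFin powR_mulrn// EFin_expe.
by rewrite poweRyr// expe2 mulyy.
Qed.

Lemma integral_Lnorm2 (f : T -> R) :
  \int[m]_x (f x ^+ 2)%:E = (Lnorm m 2%:E (EFin \o f)) ^+ 2.
Proof.
rewrite -poweR_sqr ?Lnorm_ge0// poweR_Lnorm//.
apply: eq_integral => x _ /=.
by rewrite powR_mulrn// real_normK// num_real.
Qed.

(** Hölder with exponents 2 and 2. Squared and stated in the extended reals, it asks only for
    measurability and can be applied before finiteness is known. *)
Lemma cauchy_schwarz (f g : T -> R) :
  measurable_fun setT f -> measurable_fun setT g ->
  (\int[m]_x `|f x * g x|%:E) ^+ 2 <=
  (\int[m]_x (f x ^+ 2)%:E) * (\int[m]_x (g x ^+ 2)%:E).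
Proof.
move=> mf mg; rewrite !integral_Lnorm2.
have := @hoelder _ _ _ m f g 2 2 mf mg.
rewrite Lnorm1 => h.
rewrite !expe2 muleACA -!expe2 lee_sqr//.
- by apply: h => //; field.
- by apply: integral_ge0 => x _; rewrite lee_fin.
- by rewrite mule_ge0// Lnorm_ge0.
Qed.

End cauchy_schwarz.

(** * Periodization *)

Section almost_everywhere.
Context d (T : measurableType d) (R : realType) (m : {measure set T -> \bar R}).
Implicit Types P Q S : T -> Prop.

Lemma ae_imp P Q : (forall x, P x -> Q x) ->
  {ae m, forall x, P x} -> {ae m, forall x, Q x}.
Proof. by move=> PQ; apply: filterS. Qed.

Lemma ae_imp2 P Q S : (forall x, P x -> Q x -> S x) ->
  {ae m, forall x, P x} -> {ae m, forall x, Q x} -> {ae m, forall x, S x}.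
Proof. by move=> PQS; apply: filterS2. Qed.

End almost_everywhere.

(** * Measurability of pointwise limits that may fail to exist *)

Section measurable_limn.
Context d (T : measurableType d) (R : realType).

(** The quantifiers range over natural numbers only, so that the set of convergence becomes a
    countable combination of measurable sets. *)
Lemma cauchy_seqP (u : R ^nat) :
  cvgn u <-> forall k, exists N, forall n, (N <= n)%N -> `|u n - u N| <= k.+1%:R^-1.
Proof.
split=> [cu k|H].
  have k0 : (0 : R) < (k.+1%:R^-1) / 2 by rewrite divr_gt0// invr_gt0.
  have /cvgrPdist_le/(_ _ k0)[N _ HN] := cu.
  exists N => n Nn; rewrite (splitr k.+1%:R^-1).
  rewrite -(subrKA (limn u)) (le_trans (ler_normD _ _))// lerD//.
    by rewrite distrC; exact: HN.
  by apply: HN => /=.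
apply/cauchy_cvgP; apply/cauchyP => e e0.
pose k := Num.truncn e^-1.
have [N HN] := H k; exists (u N); exists N => // n /= Nn.
rewrite /ball/= distrC (le_lt_trans (HN _ Nn))// invf_plt ?posrE//.
exact: Num.Theory.truncnS_gt.
Qed.

(** The periodization is a limit that exists only almost everywhere, and elsewhere [limn] returns
    the default [point]. Replacing the sequence by this constant off the measurable convergence set
    makes it converge everywhere to the same limit. *)
Lemma measurable_limn (h : (T -> R) ^nat) :
  (forall n, measurable_fun setT (h n)) ->
  measurable_fun setT (fun x => limn (h ^~ x)).
Proof.
move=> mh; pose C := [set x | cvgn (h ^~ x)].
have mC : measurable C.
  rewrite (_ : C = \bigcap_k \bigcup_N \bigcap_(n in [set n | (N <= n)%N])
     [set x | `|h n x - h N x| <= k.+1%:R^-1]); last first.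
    apply/seteqP; split => x /=.
      move=> /cauchy_seqP Hx k _; have [N HN] := Hx k.
      by exists N => // n /=; exact: HN.
    by move=> Hx; apply/cauchy_seqP => k; have [N _ HN] := Hx k I; exists N.
  apply: bigcapT_measurable => k; apply: bigcupT_measurable => N.
  apply: bigcap_measurable; first by exists N => /=.
  move=> n _; rewrite -[X in measurable X]setTI.
  have m1 : measurable_fun setT (fun x => `|h n x - h N x|).
    by apply: measurableT_comp => //; exact: measurable_funB.
  rewrite (_ : [set x | _] = (fun x => `|h n x - h N x|) @^-1` `]-oo, k.+1%:R^-1]).
    exact: m1.
  by apply/seteqP; split => x /=; rewrite in_itv.
pose c x := `[< C x >].
have mc : measurable_fun setT c.
  apply: (measurable_fun_bool true); rewrite setTI.
  rewrite (_ : _ @^-1` _ = C)//; apply/seteqP; split => x /=; first by move/asboolP.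
  by move=> Cx; apply/asboolP.
apply: (@measurable_fun_cvg _ _ _ _ (fun n x => if c x then h n x else point)).
  by move=> m; exact: measurable_fun_ifT.
move=> x _; rewrite /c; case: asboolP => Cx; first exact: Cx.
by rewrite dvgP//; exact: cvg_cst.
Qed.

End measurable_limn.

Section line_integral.
Context {R : realType}.
Local Notation mu := (@lebesgue_measure R).
Local Notation tau := (torus_measure R).
Local Open Scope ereal_scope.
Implicit Types (f : R -> \bar R) (a b c x : R).

Lemma integral_shift f a b c : measurable_fun [set: R] f ->
  \int[mu]_(x in `[a, b[) f (x + c)%R = \int[mu]_(x in `[(a + c)%R, (b + c)%R[) f x.
Proof.
move=> mf.
have := integralE mu `[a, b[ (f \o (fun x => x + c)%R).
rewrite funepos_comp funeneg_comp => /= ->; rewrite [RHS]integralE.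
by congr (_ - _); apply: ge0_integral_shift => //;
  [exact: measurable_funepos|exact: measurable_funeneg].
Qed.

Lemma integral_reflect f x : measurable_fun [set: R] f ->
  \int[mu]_z f (x - z)%R = \int[mu]_z f z.
Proof.
have H (g : R -> \bar R) : measurable_fun [set: R] g -> (forall x, 0 <= g x) ->
    \int[mu]_z g (x - z)%R = \int[mu]_z g z.
  move=> mg g0.
  rewrite -[RHS]mul1e -[X in X%:E * _](@invr1 R) -(@ge0_integral_affine _ 1 x)//.
  rewrite -[RHS]ge0_integral_oppr//.
    by apply: eq_integral => z _; rewrite mul1r addrC.
  apply: (measurableT_comp mg) => //; exact: measurable_affine.
move=> mf.
have := integralE mu setT (f \o (fun z => x - z)%R).
rewrite funepos_comp funeneg_comp => /= ->; rewrite [RHS]integralE.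
by congr (_ - _); apply: H => //;
  [exact: measurable_funepos|exact: measurable_funeneg].
Qed.

Lemma integral_itv_split f a b c : (a <= b)%R -> (b <= c)%R ->
  measurable_fun [set: R] f ->
  \int[mu]_(x in `[a, c[) f x = \int[mu]_(x in `[a, b[) f x + \int[mu]_(x in `[b, c[) f x.
Proof.
move=> ab bc mf.
rewrite (_ : `[a, c[%classic = `[a, b[%classic `|` `[b, c[%classic); last first.
  by rewrite -itv_bndbnd_setU// bnd_simp.
rewrite integral_setU//.
- exact: measurable_funTS.
- apply/disj_setPS => x /=; rewrite !in_itv/= => -[] /andP[_ xb] /andP[].
  by rewrite leNgt xb.
Qed.

(** The unit intervals run leftwards from [a], which matches the translations by [N - k] that occur
    in the partial sums of a periodization. *)
Lemma sum_integral_unit_itv f a n : measurable_fun [set: R] f ->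
  \sum_(0 <= k < n) \int[mu]_(x in `[(a - k%:R)%R, (a - k%:R + 1)%R[) f x =
  \int[mu]_(x in `[(a + 1 - n%:R)%R, (a + 1)%R[) f x.
Proof.
move=> mf; elim: n => [|n ih].
  by rewrite big_geq// subr0 set_itvco0 integral_set0.
rewrite big_nat_recr//= ih addeC.
rewrite [in RHS](@integral_itv_split _ _ (a + 1 - n%:R)%R)//.
- have -> : (a + 1 - n.+1%:R = a - n%:R)%R by rewrite -natr1; ring.
  by rewrite (addrAC a).
- by rewrite lerB// ler_nat.
- by rewrite lerBlDr lerDl.
Qed.

End line_integral.

Section periodization.
Context {R : realType}.
Local Notation mu := (@lebesgue_measure R).
Local Notation tau := (torus_measure R).
Implicit Types (h p : R -> R) (x t : R) (N : nat).

Definition psum h N t := \sum_(0 <= k < N.*2.+1) h (t + (k%:R - N%:R)).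

Lemma psumS h N t :
  psum h N.+1 t = psum h N t + (h (t - N.+1%:R) + h (t + N.+1%:R)).
Proof.
rewrite /psum doubleS big_nat_recr//= big_nat_recl//= sub0r addrAC addrC addrA.
rewrite -addrA; congr (_ + (_ + _)).
  by apply: eq_bigr => k _; congr h; rewrite -!natr1; ring.
by congr h; rewrite -!natr1 -addnn natrD; ring.
Qed.

(** Pairing the terms at distance j + 1 on either side turns the symmetric two-sided sum into an
    ordinary series, to which absolute convergence applies. *)
Lemma psumE h N t : psum h N t =
  h t + series (fun j => h (t - j.+1%:R) + h (t + j.+1%:R)) N.
Proof.
elim: N => [|N ih].
  by rewrite /psum /series/= big_nat1 big_geq// addr0 subrr addr0.
by rewrite psumS ih -addrA /series; congr (_ + _); rewrite [RHS]big_nat_recr.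
Qed.

Lemma le_norm_psum h N t : `|psum h N t| <= psum (fun s => `|h s|) N t.
Proof. exact: ler_norm_sum. Qed.

Lemma nondecreasing_psum h t : (forall s, 0 <= h s) ->
  nondecreasing_seq (psum h ^~ t).
Proof.
move=> h0; apply/nondecreasing_seqP => N.
by rewrite psumS lerDl addr_ge0.
Qed.

Lemma is_cvg_psum h t : has_ubound (range (psum (fun s => `|h s|) ^~ t)) ->
  cvgn (psum h ^~ t).
Proof.
move=> [B HB]; pose v j := h (t - j.+1%:R) + h (t + j.+1%:R).
have cv : cvgn (series v).
  apply: normed_cvg; apply: nondecreasing_is_cvgn.
    by apply/nondecreasing_seqP => n; rewrite /series [leRHS]big_nat_recr//= lerDl.
  exists B => _ [n _ <-]; apply: (@le_trans _ _ (psum (fun s => `|h s|) n t)).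
    rewrite psumE /=; apply: (@le_trans _ _ (`|h t| + \sum_(0 <= k < n) `|v k|)).
      by rewrite lerDr.
    by rewrite lerD2l /series/=; apply: ler_sum => k _; exact: ler_normD.
  by apply: HB; exists n.
rewrite (_ : psum h ^~ t = fun n => h t + series v n); last first.
  by apply/funext => n; exact: psumE.
by apply: is_cvgD => //; exact: is_cvg_cst.
Qed.

Lemma measurable_psum h N : measurable_fun [set: R] h ->
  measurable_fun [set: R] (psum h N).
Proof.
move=> mh; apply: measurable_sum => k.
by apply: (measurableT_comp mh) => //; exact: measurable_funD.
Qed.

Lemma measurable_periodization h : measurable_fun [set: R] h ->
  measurable_fun [set: R] (periodization h).
Proof. by move=> mh; apply: measurable_limn => N; exact: measurable_psum. Qed.

Local Open Scope ereal_scope.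

Lemma integrable_torus_shift (q : R -> R) c : mu.-integrable setT (EFin \o q) ->
  tau.-integrable setT (fun y => (q (y + c)%R)%:E).
Proof.
move=> iq; have mq : measurable_fun [set: R] (EFin \o q) := measurable_int _ iq.
have mqc : measurable_fun [set: R] (fun y => (q (y + c)%R)%:E).
  by apply: (measurableT_comp mq) => //; exact: measurable_funD.
apply/integrableP; split => //.
rewrite ge0_integral_torus//; last exact: measurableT_comp.
rewrite (@ge0_integral_shift _ (fun y => `|(q y)%:E|))//; last exact: measurableT_comp.
have /integrableP[_] := iq; apply: le_lt_trans.
by apply: ge0_subset_integral => //; exact: measurableT_comp.
Qed.

Lemma integral_psum (q : R -> R) N : mu.-integrable setT (EFin \o q) ->
  \int[tau]_y (\sum_(0 <= k < N.*2.+1) q (y + (N%:R - k%:R)))%R%:E =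
   \int[mu]_(y in `[(- N%:R)%R, (N%:R + 1)%R[) (q y)%:E.
Proof.
move=> iq; have mq : measurable_fun [set: R] (EFin \o q) := measurable_int _ iq.
under eq_integral do rewrite -sumEFin.
rewrite integral_sum//; last by move=> k; exact: integrable_torus_shift.
have := @sum_integral_unit_itv _ (EFin \o q) N%:R N.*2.+1 mq.
have -> : (N%:R + 1 - N.*2.+1%:R = - N%:R :> R)%R.
  by rewrite -natr1 -addnn natrD; ring.
move=> <-; apply: eq_bigr => k _; rewrite integral_torus; last first.
  by apply: (measurableT_comp mq) => //; exact: measurable_funD.
by rewrite (@integral_shift _ (EFin \o q))// add0r (addrC 1%R).
Qed.

Lemma cvg_integral_itv (q : R -> R) : mu.-integrable setT (EFin \o q) ->
  \int[mu]_(y in `[(- N%:R)%R, (N%:R + 1)%R[) (q y)%:E @[N --> \oo] -->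
  \int[mu]_y (q y)%:E.
Proof.
move=> iq; have mq : measurable_fun [set: R] (EFin \o q) := measurable_int _ iq.
pose I (N : nat) := `[(- N%:R)%R, (N%:R + 1)%R[%classic : set R.
have := @dominated_convergence _ _ _ mu setT measurableT
  (fun N => (EFin \o q) \_ (I N)) (EFin \o q) (abse \o (EFin \o q)).
case => //.
- move=> n; apply/(measurable_restrictT _ _).1; first exact: measurable_itv.
  exact: measurable_funTS.
- apply: aeW => y _; apply: cvg_near_cst.
  near=> N; rewrite patchE mem_set//= /I/= in_itv/=.
  have yN : (`|y| <= N%:R)%R by near: N; exact: nbhs_infty_ger.
  by move: yN; rewrite ler_norml => /andP[-> y2] /=; rewrite (le_lt_trans y2)// ltrDl.
- exact: integrable_abse.
- by apply: aeW => y N _; rewrite patchE; case: ifPn => // _; rewrite abse0 abse_ge0.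
move=> _ _; apply: cvg_trans; apply: near_eq_cvg; apply: nearW => N.
by rewrite /= [RHS]integral_mkcond.
Unshelve. all: by end_near. Qed.

End periodization.

(** * Unfolding an integral against a periodization *)

Section unfolding.
Context {R : realType}.
Local Notation mu := (@lebesgue_measure R).
Local Notation tau := (torus_measure R).
Local Open Scope ereal_scope.
Variables (h p : R -> R) (x M : R).
Hypothesis ih : mu.-integrable setT (EFin \o h).
Hypotheses (mp : measurable_fun [set: R] p) (pp : periodic p 1%R).
Hypothesis pM : forall y, (`|p y| <= M)%R.

Let mh : measurable_fun [set: R] h.
Proof. by have /integrableP[/measurable_EFinP] := ih. Qed.

Let mhx : measurable_fun [set: R] (fun y => h (x - y)).
Proof. by apply: (measurableT_comp mh) => //; exact: measurable_funB. Qed.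

Let ihx : mu.-integrable setT (fun y => (h (x - y))%:E).
Proof.
apply/integrableP; split; first exact/measurable_EFinP.
rewrite (integral_reflect (f := fun y => `|(h y)%:E|)) //.
  by have /integrableP[] := ih.
by apply: measurableT_comp => //; exact/measurable_EFinP.
Qed.

(** The periodization of |h|, taken in the extended reals where the monotone limit always exists;
    [M] times it serves as the dominating function. *)
Let D y := limn (fun N => (psum (fun s => `|h s|)%R N (x - y))%:E).

Let S N y := psum (fun s => `|h s|)%R N (x - y).

Let mS N : measurable_fun [set: R] (EFin \o S N).
Proof.
apply/measurable_EFinP; apply: (measurableT_comp (measurable_psum N _)).
  exact: measurableT_comp.
exact: measurable_funB.
Qed.

Let S0 N y : (0 <= S N y)%R.
Proof. exact: sumr_ge0. Qed.

Let ndS y : nondecreasing_seq (fun N => (S N y)%:E).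
Proof.
by move=> m n mn; rewrite lee_fin; exact: nondecreasing_psum.
Qed.

Let is_cvgS y : cvgn (fun N => (S N y)%:E).
Proof. exact: (ereal_nondecreasing_is_cvgn (@ndS y)). Qed.

Let cvS y : (S N y)%:E @[N --> \oo] --> D y.
Proof. exact: (ereal_nondecreasing_is_cvgn (@ndS y)). Qed.

Let intS N : \int[tau]_y (S N y)%:E <= \int[mu]_z `|(h z)%:E|.
Proof.
have iq : mu.-integrable setT (EFin \o (fun y => `|h (x - y)|%R)).
  exact: (integrable_abse ihx).
have := @integral_psum _ (fun y => `|h (x - y)|%R) N iq.
have E y : (\sum_(0 <= k < N.*2.+1) `|h (x - (y + (N%:R - k%:R)))| = S N y)%R.
  by rewrite /S /psum; apply: eq_bigr => k _; congr (`|h _|)%R; ring.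
under eq_integral do rewrite E.
move=> ->.
rewrite -(integral_reflect (f := fun y => `|(h y)%:E|) x); last first.
  by apply: measurableT_comp => //; exact/measurable_EFinP.
by apply: ge0_subset_integral => //; exact: (measurable_int _ iq).
Qed.

(** Monotone convergence: each partial sum unfolds to the integral of |h| over a bounded interval,
    hence is at most the L^1 norm of h. Finiteness of [D] almost everywhere then gives absolute
    convergence of the periodization. *)
Let iD : tau.-integrable setT D.
Proof.
have mD : measurable_fun [set: R] D.
  apply: (emeasurable_fun_cvg (fun N => EFin \o S N)) => // y _.
  exact: cvS.
apply/integrableP; split => //.
have D0 y : 0 <= D y.
  by apply: lime_ge; [exact: is_cvgS|apply: nearW => N; rewrite lee_fin; exact: S0].
under eq_integral do rewrite gee0_abs//.
rewrite monotone_convergence//; last 2 first.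
- by move=> n y _; rewrite lee_fin; exact: S0.
- by move=> y _; exact: ndS.
apply: (@le_lt_trans _ _ (\int[mu]_z `|(h z)%:E|)); last by have /integrableP[] := ih.
apply: lime_le; last by apply: nearW => N; exact: intS.
apply: ereal_nondecreasing_is_cvgn => m n mn; apply: ge0_le_integral => //.
- by move=> y _; rewrite lee_fin; exact: S0.
- exact: mS.
- exact: mS.
- by move=> y _; exact: ndS.
Qed.

Let SD N y : (S N y)%:E <= D y.
Proof.
apply: lime_ge; first exact: is_cvgS.
by exists N => // n /= Nn; exact: ndS.
Qed.

Let ae_cvg : {ae tau, forall y, cvgn (psum h ^~ (x - y)%R)}.
Proof.
have := integrable_ae measurableT iD; apply: filterS => y /(_ I) Dy.
apply: is_cvg_psum; exists (fine (D y)) => _ [N _ <-].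
by rewrite -lee_fin fineK//; exact: SD.
Qed.

Let q y := (h (x - y) * p y)%R.

Let mq : measurable_fun [set: R] q.
Proof. exact: measurable_funM. Qed.

Let iq : mu.-integrable setT (EFin \o q).
Proof.
apply: (@le_integrable _ _ _ mu setT measurableT _ (fun y => M%:E * (h (x - y))%:E)).
- exact/measurable_EFinP.
- move=> y _; rewrite /q/= lee_fin !normrM mulrC ler_wpM2r//.
  by rewrite (le_trans (pM y))// ler_norm.
- exact: integrableZl.
Qed.

Let p_nat y n : p (y + n%:R)%R = p y.
Proof. exact: periodicn. Qed.

(** Dominated convergence under [M * D]. In a partial sum, periodicity replaces p(y) by its value at
    the translated point, so each term is a translate of [q] and the sum integrates to [q] over [-N,
    N + 1[; the reflection y = x - z finishes. *)
Lemma integrable_periodization :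
  tau.-integrable setT (fun y => (periodization h (x - y) * p y)%R%:E) /\
  \int[tau]_y (periodization h (x - y) * p y)%R%:E =
  \int[mu]_z (h z * p (x - z))%R%:E.
Proof.
have mper : measurable_fun [set: R] (fun y => periodization h (x - y) * p y)%R.
  apply: measurable_funM => //; apply: (measurableT_comp (measurable_periodization mh)).
  exact: measurable_funB.
have [|||||i0 _ lim] := @dominated_convergence _ _ _ tau setT measurableT
  (fun N y => (psum h N (x - y) * p y)%R%:E)
  (fun y => (periodization h (x - y) * p y)%R%:E) (fun y => M%:E * D y).
- move=> N; apply/measurable_EFinP; apply: measurable_funM => //.
  by apply: (measurableT_comp (measurable_psum N mh)); exact: measurable_funB.
- exact/measurable_EFinP.
- apply: (ae_imp _ ae_cvg) => y cy _; apply: cvg_EFin.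
    by apply: nearW.
  exact: cvgMl.
- exact: integrableZl.
- apply: aeW => y N _; rewrite /= normrM mulrC EFinM; apply: lee_pmul => //.
    by rewrite lee_fin.
  by rewrite (le_trans _ (SD N y))// lee_fin le_norm_psum.
split => //.
rewrite -(integral_reflect (f := fun z => (h z * p (x - z))%R%:E) x); last first.
  apply/measurable_EFinP; apply: measurable_funM => //.
  by apply: (measurableT_comp mp); exact: measurable_funB.
have -> : \int[mu]_z (h (x - z) * p (x - (x - z)))%R%:E = \int[mu]_y (q y)%:E.
  by apply: eq_integral => z _; rewrite /q subKr.
move: lim => /cvg_lim <-//; apply/cvg_lim => //.
apply: cvg_trans (cvg_integral_itv iq).
apply: near_eq_cvg; apply: nearW => N; rewrite -integral_psum//=.
apply: eq_integral => y _; congr EFin; rewrite /psum mulr_suml.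
apply: eq_bigr => k _; rewrite /q; congr (h _ * _)%R; first by ring.
by rewrite -[LHS](p_nat _ k) -[RHS](p_nat _ N); congr p; ring.
Qed.

End unfolding.

(** * Primitives of periodic functions *)

Section primitive.
Context {R : realType}.
Local Notation mu := (@lebesgue_measure R).
Local Notation tau := (torus_measure R).
Implicit Types (g : R -> R) (a b c x y : R).

Definition periodic_integrable g :=
  periodic g 1 /\ tau.-integrable setT (EFin \o g).

Definition locally_int g := measurable_fun [set: R] g /\
  forall a b, mu.-integrable `[a, b[ (EFin \o g).

(** A bounded interval is covered by finitely many unit intervals, each contributing the same
    integral of |g| over one period. *)
Lemma periodic_locally_int g : periodic_integrable g -> locally_int g.
Proof.
move=> [gp /integrableP[/measurable_EFinP mg ig]]; split => // a b.
apply/integrableP; split; first exact/measurable_EFinP/measurable_funTS.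
have mng : measurable_fun [set: R] (fun x => `|(g x)%:E|%E).
  by apply: measurableT_comp => //; exact/measurable_EFinP.
pose n := Num.Def.truncn `|b - a|.
have bn : b <= a + n.+1%:R.
  rewrite -lerBlDl (le_trans (ler_norm _))// ltW//.
  exact: Num.Theory.truncnS_gt.
have H : (\int[mu]_(x in `[a, b[) `|(EFin \o g) x| <=
          \int[mu]_(x in `[a, (a + n.+1%:R)%R[) `|(g x)%:E|)%E.
  apply: ge0_subset_integral => //; first exact: measurable_funTS.
  by apply: subset_itvl; rewrite bnd_simp.
apply: (le_lt_trans H).
have := @sum_integral_unit_itv _ _ (a + n%:R) n.+1 mng.
have -> : a + n%:R + 1 - n.+1%:R = a by rewrite -natr1; ring.
rewrite -addrA natr1 => <-.
rewrite (eq_bigr (fun=> \int[tau]_x `|(g x)%:E|)%E); last first.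
  by move=> k _; apply: ge0_integral_period => // x; rewrite gp.
by apply: lte_sum_pinfty.
Qed.

Section locally_int.
Variable g : R -> R.
Hypothesis ig : locally_int g.

Lemma Rintegral_split a b c : a <= b -> b <= c ->
  \int[mu]_(x in `[a, c[) g x =
  \int[mu]_(x in `[a, b[) g x + \int[mu]_(x in `[b, c[) g x.
Proof.
have [mg ig'] := ig.
move=> ab bc; rewrite /Rintegral (integral_itv_split ab bc)//; last first.
  exact/measurable_EFinP.
by rewrite fineD//; apply: integrable_fin_num.
Qed.

(** The sign convention for negative [x] is the one that makes the increment formula [primB] valid
    across 0. *)
Definition prim x : R := if 0 <= x then \int[mu]_(t in `[0, x[) g t
  else - \int[mu]_(t in `[x, 0[) g t.

Lemma prim0 : prim 0 = 0.
Proof. by rewrite /prim lexx set_itvco0 Rintegral_set0. Qed.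

Lemma prim_ge0 x : 0 <= x -> prim x = \int[mu]_(t in `[0, x[) g t.
Proof. by rewrite /prim => ->. Qed.

Lemma primB x y : x <= y -> prim y - prim x = \int[mu]_(t in `[x, y[) g t.
Proof.
move=> xy; rewrite /prim; case: (leP 0 x) => x0.
  by rewrite (le_trans x0 xy) (Rintegral_split x0 xy) addrAC subrr add0r.
case: leP => y0.
  by rewrite (Rintegral_split (ltW x0) y0) opprK addrC.
by rewrite (Rintegral_split xy (ltW y0)) opprK addrC addrK.
Qed.

Lemma integrable_locally_int a b : mu.-integrable `[a, b] (EFin \o g).
Proof.
apply: (integrableS _ _ _ (ig.2 a (b + 1))) => //.
by apply: subset_itvl; rewrite bnd_simp ltrDl.
Qed.

Lemma primB_closed x y : x <= y -> prim y = prim x + \int[mu]_(t in `[x, y]) g t.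
Proof.
move=> xy; rewrite -Rintegral_itv_bndo_bndc; last exact: ig.2.
by rewrite -primB// addrC subrK.
Qed.

(** Near [x], the primitive differs by the constant [prim (x - 1)] from the integral with fixed left
    endpoint [x - 1], for which continuity is known. [derive_prim] moves the base point in the same
    way. *)
Lemma continuous_prim : continuous prim.
Proof.
move=> x; have x11 : x - 1 <= x + 1 by lra.
have := @parameterized_integral_continuous _ (x - 1) (x + 1) g x11 (integrable_locally_int _ _).
move=> /within_continuous_continuous => H.
have xin : x \in `](x - 1), (x + 1)[ by rewrite in_itv/=; apply/andP; split; lra.
have x11' : x - 1 < x + 1 by lra.
have {}H := H _ x11' xin.
have : {for x, continuous (fun y => prim (x - 1) + parameterized_integral mu (x - 1) y g)}.
  by apply: cvgD; [exact: cvg_cst|exact: H].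
rewrite /prop_for /continuous_at => HH.
have e : prim x = prim (x - 1) + parameterized_integral mu (x - 1) x g.
  by apply: primB_closed; lra.
rewrite e; apply: cvg_trans HH; apply: near_eq_cvg.
exists 1 => //= y; rewrite /ball/= ltr_norml => /andP[y1 y2].
by apply/esym/primB_closed; lra.
Qed.

Lemma derive_prim x : {for x, continuous g} -> is_derive x 1 prim (g x).
Proof.
move=> cg; have xx1 : x < x + 1 by lra.
have ax : x - 1 < x by lra.
have [dF DF] := @continuous_FTC1_closed _ g _ x (x + 1) xx1 (integrable_locally_int _ _) ax cg.
pose F y := prim (x - 1) + \int[mu]_(t in `[(x - 1), y]) g t.
have iF : is_derive x 1 F (g x).
  rewrite -[g x]add0r; apply: is_deriveD.
  rewrite -DF derive1E; exact: derivableP.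
apply: near_eq_is_derive iF.
exists 1 => //= y; rewrite /ball/= ltr_norml => /andP[y1 y2].
by apply/esym/primB_closed; lra.
Qed.

End locally_int.

Lemma torus_integrableP (f : R -> \bar R) : measurable_fun [set: R] f ->
  tau.-integrable setT f <-> mu.-integrable `[0, 1[ f.
Proof.
move=> mf; have mf' : measurable_fun [set: R] (fun x => `|f x|%E).
  exact: measurableT_comp.
split=> /integrableP[_ i]; apply/integrableP; split.
- exact: measurable_funTS.
- by rewrite -ge0_integral_torus.
- exact: mf.
- by rewrite ge0_integral_torus.
Qed.

Lemma Rintegral_torus (f : R -> R) : measurable_fun [set: R] f ->
  \int[tau]_x f x = \int[mu]_(x in `[0, 1[) f x.
Proof. by move=> mf; rewrite /Rintegral integral_torus//; exact/measurable_EFinP. Qed.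

Lemma periodic_measurable g : periodic_integrable g -> measurable_fun [set: R] g.
Proof. by move=> /periodic_locally_int[]. Qed.

Lemma Rintegral_period g x : periodic_integrable g ->
  \int[mu]_(t in `[x, (x + 1)[) g t = \int[tau]_t g t.
Proof.
move=> ig; have mg := periodic_measurable ig.
have mEg : measurable_fun [set: R] (EFin \o g) by exact/measurable_EFinP.
rewrite /Rintegral; congr fine.
have := @integral_shift _ (EFin \o g) 0 1 x mEg.
rewrite add0r (addrC 1) => /= <-.
have mgx : measurable_fun [set: R] (fun t => (g (t + x))%:E).
  by apply: (measurableT_comp mEg) => //; exact: measurable_funD.
rewrite -integral_torus//.
apply: (@integral_torus_shift _ (EFin \o g)) => // t.
by rewrite /= ig.1.
Qed.

Lemma prim_period g x : periodic_integrable g ->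
  prim g (x + 1) = prim g x + \int[tau]_t g t.
Proof.
move=> ig; rewrite -(Rintegral_period x ig).
rewrite -(primB (periodic_locally_int ig)) ?lerDl//.
by rewrite subrKC.
Qed.

Lemma periodic_prim g : periodic_integrable g -> \int[tau]_t g t = 0 ->
  periodic (prim g) 1.
Proof. by move=> ig g0 x; rewrite prim_period// g0 addr0. Qed.

Lemma measurable_prim g : locally_int g -> measurable_fun [set: R] (prim g).
Proof. by move=> ig; apply: continuous_measurable_fun; exact: continuous_prim. Qed.

Lemma periodic_integrable_norm g : periodic_integrable g ->
  periodic_integrable (fun x => `|g x|).
Proof.
move=> [gp ig]; split; first by move=> x; rewrite gp.
exact: (integrable_abse ig).
Qed.

Lemma le_primB g x y : periodic_integrable g -> x <= y -> y <= x + 1 ->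
  `|prim g y - prim g x| <= \int[tau]_t `|g t|.
Proof.
move=> ig xy yx1; have lg := periodic_locally_int ig.
have ing := periodic_integrable_norm ig.
have lng := periodic_locally_int ing.
rewrite primB// (le_trans (le_normr_Rintegral _ (lg.2 x y)))//.
rewrite -(Rintegral_period x ing) (Rintegral_split lng xy yx1).
by rewrite lerDl Rintegral_ge0.
Qed.

(** Integration by parts for functions that are merely integrable: integrate p(x) q(y) over the
    triangle y < x of the unit square in both orders. *)
Lemma prim_parts p q : periodic_integrable p -> periodic_integrable q ->
  \int[tau]_x p x = 0 ->
  \int[tau]_x (p x * prim q x) = - \int[tau]_x (q x * prim p x).
Proof.
move=> ip iq p0; have mp := periodic_measurable ip; have mq := periodic_measurable iq.
have lp := periodic_locally_int ip; have lq := periodic_locally_int iq.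
pose F (z : measurableTypeR R * measurableTypeR R) : \bar R :=
  (p z.1 * q z.2 * (if z.2 < z.1 then 1 else 0))%:E.
have mF : measurable_fun setT F.
  apply/measurable_EFinP; apply: measurable_funM.
    by apply: measurable_funM; exact: measurableT_comp.
  apply: measurable_fun_ifT.
  - exact: measurable_fun_ltr.
  - exact: measurable_cst.
  - exact: measurable_cst.
have iF : (tau \x tau)%E.-integrable setT F.
  apply: (integrable12ltyP tau tau mF).2.
  have Iq : (\int[tau]_y `|(q y)%:E| \is a fin_num)%E.
    by rewrite ge0_fin_numE ?integral_ge0//; have /integrableP[] := iq.2.
  have mnq : measurable_fun [set: R] (fun y => `|(q y)%:E|%E).
    by apply: measurableT_comp => //; exact/measurable_EFinP.
  have mnp : measurable_fun [set: R] (fun y => `|(p y)%:E|%E).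
    by apply: measurableT_comp => //; exact/measurable_EFinP.
  have H : (\int[tau]_x \int[tau]_y `|F (x, y)| <=
      \int[tau]_x ((fine (\int[tau]_y `|(q y)%:E|))%:E * `|(p x)%:E|))%E.
    apply: ge0_le_integral => //.
    - by move=> x _; exact: integral_ge0.
    - apply: (measurable_fun_fubini_tonelli_F (fun z => `|F z|%E)) => //.
      exact: measurableT_comp.
    - exact: measurable_funeM.
    - move=> x _; rewrite fineK// muleC -ge0_integralZl//.
      apply: ge0_le_integral => //.
      + apply: measurableT_comp => //; apply: (measurableT_comp mF).
        exact: pair1_measurable.
      + exact: measurable_funeM.
      + move=> y _; rewrite /F /= -EFinM lee_fin -normrM.
        by case: ifPn => _; rewrite ?mulr1// mulr0 normr0.
  apply: (le_lt_trans H); rewrite ge0_integralZl_EFin//; last first.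
    by apply: fine_ge0; exact: integral_ge0.
  apply: lte_mul_pinfty => //; last by have /integrableP[] := ip.2.
  by rewrite lee_fin; apply: fine_ge0; exact: integral_ge0.
have E1 x : x \in `[0, 1[ -> (\int[tau]_y F (x, y) = (p x * prim q x)%:E)%E.
  rewrite in_itv/= => /andP[x0 x1].
  have mFx : measurable_fun [set: R] (fun y => F (x, y)).
    by apply: (measurableT_comp mF); exact: pair1_measurable.
  rewrite integral_torus// prim_ge0// EFinM fineK; last first.
    by apply: integrable_fin_num => //; exact: lq.2.
  rewrite -integralZl//; last exact: lq.2.
  rewrite (_ : `[0, x[%classic = `[0, 1[%classic `&` `[0, x[%classic); last first.
    by apply/esym/setIidPr; apply: subset_itvl; rewrite bnd_simp ltW.
  rewrite integral_mkcondr; apply: eq_integral => y; rewrite inE/= in_itv/= => /andP[y0 y1].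
  by rewrite patchE mem_setE in_itv/= y0 /F/=; case: ifPn => _; rewrite ?mulr1 ?mulr0// EFinM.
have E2 y : y \in `[0, 1[ -> (\int[tau]_x F (x, y) = - (q y * prim p y)%:E)%E.
  rewrite in_itv/= => /andP[y0 y1].
  have mFy : measurable_fun [set: R] (fun x => F (x, y)).
    by apply: (measurableT_comp mF); exact: pair2_measurable.
  have ipy : mu.-integrable `]y, 1[ (EFin \o p).
    by apply: integrableS (lp.2 y 1) => //; apply: subset_itvr; rewrite bnd_simp.
  (* The mean of [p] vanishes, so the integral over the remaining part of the period is minus the
     primitive; this is where the minus sign arises. *)
  have -> : prim p y = - \int[mu]_(x in `]y, 1[) p x.
    rewrite Rintegral_itv_obnd_cbnd//.
    have := prim_period 0 ip; rewrite add0r p0 addr0 prim0 => p1.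
    by rewrite -primB ?(ltW y1)// p1 sub0r opprK.
  rewrite mulrN opprK integral_torus// EFinM fineK; last exact: integrable_fin_num.
  rewrite -integralZl//.
  rewrite (_ : `]y, 1[%classic = `[0, 1[%classic `&` `]y, 1[%classic); last first.
    by apply/esym/setIidPr; apply: subset_itvr; rewrite bnd_simp.
  rewrite integral_mkcondr; apply: eq_integral => x; rewrite inE/= in_itv/= => /andP[x0 x1].
  by rewrite patchE mem_setE in_itv/= x1 andbT /F/=; case: ifPn => _;
    rewrite ?mulr1 ?mulr0// -EFinM mulrC.
have mpq : measurable_fun [set: R] (fun x => p x * prim q x).
  by apply: measurable_funM => //; exact: measurable_prim.
have mqp : measurable_fun [set: R] (fun x => q x * prim p x).
  by apply: measurable_funM => //; exact: measurable_prim.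
have mG1 : measurable_fun [set: R] (fun x => \int[tau]_y F (x, y))%E.
  exact: measurable_fubini_F iF.
have mG2 : measurable_fun [set: R] (fun y => \int[tau]_x F (x, y))%E.
  exact: measurable_fubini_G iF.
have e : (\int[mu]_(x in `[0%R, 1%R[) (p x * prim q x)%:E =
          \int[mu]_(x in `[0%R, 1%R[) (- (q x * prim p x)%:E))%E.
  transitivity (\int[tau]_x \int[tau]_y F (x, y))%E.
    by rewrite integral_torus//; apply: eq_integral => x; rewrite inE/= => /E1 ->.
  rewrite (Fubini iF) integral_torus//.
  by apply: eq_integral => x; rewrite inE/= => /E2 ->.
rewrite !Rintegral_torus// /Rintegral e.
have i0 : mu.-integrable `[0, 1[ (fun x => (q x * prim p x)%:E).
  apply: (@le_integrable _ _ _ mu _ _ _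
    (fun x => (\int[tau]_t `|p t|)%:E * (q x)%:E)%E) => //.
  - by apply: measurable_funTS; exact/measurable_EFinP.
  - move=> x; rewrite /= in_itv/= => /andP[x0 x1].
    rewrite lee_fin !normrM mulrC ler_wpM2r//.
    have := le_primB ip x0; rewrite add0r prim0 subr0 => /(_ (ltW x1)) h.
    exact: (le_trans h (ler_norm _)).
  - by apply: integrableZl => //; exact: lq.2.
by rewrite integralN ?fineN//; exact: integrable_add_def.
Qed.

End primitive.

(** * The fundamental lemma of the calculus of variations *)

Section smooth_functions.
Context {R : realType}.
Local Notation mu := (@lebesgue_measure R).
Local Notation tau := (torus_measure R).
Implicit Types (f g psi : R -> R) (x : R).

(** A class of functions closed under differentiation by its very shape, so that smoothness of the
    approximating test functions follows by induction on the order of the derivative. *)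
Inductive trig_alg : (R -> R) -> Prop :=
| trig_cst (c : R) : trig_alg (fun=> c)
| trig_sin (a b : R) : trig_alg (fun x => sin (a * x + b))
| trig_cos (a b : R) : trig_alg (fun x => cos (a * x + b))
| trig_add f g : trig_alg f -> trig_alg g -> trig_alg (fun x => f x + g x)
| trig_mul f g : trig_alg f -> trig_alg g -> trig_alg (fun x => f x * g x).

Lemma is_derive_affine (a b x : R) : is_derive x 1 (fun x => a * x + b) a.
Proof.
have h1 : is_derive x 1 (a \*: @id R) (a *: 1) by exact: is_deriveZ.
have h2 : is_derive x 1 (cst b) (0 : R) by exact: is_derive_cst.
by have := is_deriveD h1 h2; rewrite addr0 scaler1.
Qed.

Lemma trig_alg_derive f : trig_alg f ->
  exists2 f', trig_alg f' & forall x, is_derive x 1 f (f' x).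
Proof.
elim=> {f} [c|a b|a b|f g tf [f' tf' Df] tg [g' tg' Dg]|f g tf [f' tf' Df] tg [g' tg' Dg]].
- by exists (fun=> 0); [exact: trig_cst|move=> x; exact: is_derive_cst].
- exists (fun x => cos (a * x + b) * a).
    by apply: trig_mul; [exact: trig_cos|exact: trig_cst].
  move=> x; have := @is_derive1_comp _ sin (fun x => a * x + b) x (cos (a * x + b)) a.
  by apply; exact: is_derive_affine.
- exists (fun x => sin (a * x + b) * - a).
    by apply: trig_mul; [exact: trig_sin|exact: trig_cst].
  move=> x; have := @is_derive1_comp _ cos (fun x => a * x + b) x (- sin (a * x + b)) a.
  rewrite mulNr -mulrN; by apply; exact: is_derive_affine.
- exists (fun x => f' x + g' x); first exact: trig_add.
  by move=> x; apply: is_deriveD.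
- exists (fun x => f x * g' x + g x * f' x).
    by apply: trig_add; exact: trig_mul.
  by move=> x; apply: is_deriveM.
Qed.

Lemma trig_alg_derive1 f : trig_alg f -> trig_alg (derive1 f).
Proof.
move=> /trig_alg_derive[f' tf' Df]; rewrite (_ : derive1 f = f')//.
by apply/funext => x; rewrite derive1E derive_val.
Qed.

Lemma trig_alg_smooth f n x : trig_alg f -> derivable (derive1n n f) x 1.
Proof.
move=> tf; have : trig_alg (derive1n n f).
  by elim: n => // n ih; rewrite derive1nS; exact: trig_alg_derive1.
by move=> /trig_alg_derive[f' _ /(_ x)[]].
Qed.

Lemma trig_alg_continuous f : trig_alg f -> continuous f.
Proof.
move=> /trig_alg_derive[f' _ Df] x; apply: differentiable_continuous.
by apply/derivable1_diffP; case: (Df x).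
Qed.

Lemma continuous_periodic_integrable f : continuous f -> periodic f 1 ->
  periodic_integrable f.
Proof.
move=> cf pf; split => //.
have mf : measurable_fun [set: R] f by exact: continuous_measurable_fun.
apply/torus_integrableP; first exact/measurable_EFinP.
have i01 : mu.-integrable `[0, 1] (EFin \o f).
  apply: continuous_compact_integrable; first exact: segment_compact.
  exact: continuous_subspaceT.
by apply: integrableS i01 => //; apply: subset_itvl; rewrite bnd_simp.
Qed.

Lemma trig_alg_pow f n : trig_alg f -> trig_alg (fun x => f x ^+ n).
Proof.
move=> tf; elim: n => [|n ih]; first exact: trig_cst.
rewrite (_ : (fun x => _) = (fun x => f x * f x ^+ n)); first exact: trig_mul.
by apply/funext => x; rewrite exprS.
Qed.

Lemma trig_alg_onem f : trig_alg f -> trig_alg (fun x => 1 - f x).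
Proof.
move=> tf; rewrite (_ : (fun x => _) = (fun x => 1 + (-1) * f x)).
  by apply: trig_add; [exact: trig_cst|apply: trig_mul => //; exact: trig_cst].
by apply/funext => x; rewrite mulN1r.
Qed.

(* Stone's approximation of a step at height 1/2: Bernoulli's inequality bounds
   the distance to the limit by (2s)^n below and by (2s)^(-n) above 1/2. *)
Definition stone (n : nat) (s : R) : R := 1 - (1 - s ^+ n) ^+ (2 ^ n).

Lemma bernoulli_ge (t : R) k : 0 <= t <= 1 -> 1 - k%:R * t <= (1 - t) ^+ k.
Proof.
move=> /andP[t0 t1]; elim: k => [|k ih]; first by rewrite mul0r subr0 expr0.
rewrite exprS; apply: (@le_trans _ _ ((1 - t) * (1 - k%:R * t))).
  rewrite -natr1; have : 0 <= k%:R * t ^+ 2 :> R by rewrite mulr_ge0// sqr_ge0.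
  by lra.
by rewrite ler_wpM2l// subr_ge0.
Qed.

Lemma bernoulli_le (t : R) k : 0 <= t <= 1 -> (1 - t) ^+ k * (1 + k%:R * t) <= 1.
Proof.
move=> /andP[t0 t1]; elim: k => [|k ih]; first by rewrite mul0r addr0 expr0 mul1r.
apply: le_trans ih; rewrite exprSr -mulrA ler_wpM2l ?exprn_ge0 ?subr_ge0//.
rewrite -natr1; have : 0 <= k%:R * t ^+ 2 :> R by rewrite mulr_ge0// sqr_ge0.
by have := sqr_ge0 t; lra.
Qed.

Lemma stone_itv n s : 0 <= s <= 1 -> 0 <= stone n s <= 1.
Proof.
move=> /andP[s0 s1]; rewrite /stone subr_ge0 lerBlDr lerDl.
have sn : s ^+ n <= 1 by rewrite exprn_ile1.
by rewrite exprn_ge0 ?subr_ge0// andbT exprn_ile1 ?subr_ge0// lerBlDr lerDl exprn_ge0.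
Qed.

Lemma cvg_stone_lt s : 0 <= s < 2^-1 -> stone n s @[n --> \oo] --> (0 : R).
Proof.
move=> /andP[s0 s12].
have cv : (2 * s) ^+ n @[n --> \oo] --> (0 : R) by apply: cvg_expr; rewrite ger0_norm; lra.
apply: squeeze_cvgr cv; last exact: cvg_cst.
apply: nearW => n; have s1 : 0 <= s <= 1 by lra.
have /andP[-> _] /= := stone_itv n s1.
have sn : 0 <= s ^+ n <= 1 by rewrite exprn_ge0//= exprn_ile1//; lra.
have := bernoulli_ge (2 ^ n) sn.
by rewrite /stone exprMn natrX; lra.
Qed.

Lemma cvg_stone_gt s : 2^-1 < s <= 1 -> stone n s @[n --> \oo] --> (1 : R).
Proof.
move=> /andP[s12 s1].
have s0 : 0 < s by lra.
have cv : 1 - (2 * s)^-1 ^+ n @[n --> \oo] --> (1 : R).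
  rewrite -[X in _ --> X]subr0; apply: cvgB; first exact: cvg_cst.
  apply: cvg_expr; rewrite ger0_norm ?invr_ge0; last by lra.
  by rewrite invf_lt1; lra.
apply: squeeze_cvgr cv (cvg_cst _).
apply: nearW => n; have s01 : 0 <= s <= 1 by lra.
have /andP[_ ->] := stone_itv n s01; rewrite andbT.
have sn : 0 <= s ^+ n <= 1 by rewrite exprn_ge0//= ?exprn_ile1//; lra.
have := bernoulli_le (2 ^ n) sn.
rewrite /stone lerD2l lerN2 natrX -exprMn exprVn => h.
have p0 : 0 < (2 * s) ^+ n by rewrite exprn_gt0//; lra.
rewrite -[leRHS]mul1r ler_pdivlMr//; apply: le_trans h.
by rewrite ler_wpM2l ?lerDr// exprn_ge0// subr_ge0; case/andP: sn.
Qed.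

(* The function [arc b] exceeds 1/2 on (0,b) and is below 1/2 on (b,1). *)
Definition arc (b x : R) : R := 2^-1 + 2^-1 * (sin (pi * x) * sin (pi * (b - x))).

Lemma trig_alg_arc b : trig_alg (arc b).
Proof.
apply: trig_add; first exact: trig_cst.
apply: trig_mul; first exact: trig_cst.
apply: trig_mul.
  rewrite (_ : (fun x => _) = (fun x => sin (pi * x + 0))); first exact: trig_sin.
  by apply/funext => x; rewrite addr0.
rewrite (_ : (fun x => _) = (fun x => sin ((- pi) * x + pi * b))); first exact: trig_sin.
by apply/funext => x; congr sin; ring.
Qed.

(** Each sine changes sign under x + 1; the product of the two does not, which is why [arc] uses a
    product. *)
Lemma periodic_arc b : periodic (arc b) 1.
Proof.
move=> x; rewrite /arc; congr (_ + _ * _).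
have -> : pi * (x + 1) = pi * x + pi :> R by ring.
have -> : pi * (b - (x + 1)) = pi * (b - x) - pi :> R by ring.
have := @sinDpi R (pi * (b - x) - pi); rewrite subrK => ->.
by rewrite sinDpi mulrN mulNr.
Qed.

Lemma arc_itv b x : 0 <= arc b x <= 1.
Proof.
rewrite /arc; have : `|sin (pi * x) * sin (pi * (b - x))| <= 1.
  by rewrite normrM mulr_ile1// sin_max.
by rewrite ler_norml => /andP[h1 h2]; apply/andP; split; lra.
Qed.

Lemma arc_gt b x : 0 < x < b -> b < 1 -> 2^-1 < arc b x.
Proof.
move=> /andP[x0 xb] b1; rewrite /arc ltrDl mulr_gt0// mulr_gt0//.
  apply: sin_gt0_pi; rewrite mulr_gt0 ?pi_gt0//=.
  by rewrite gtr_pMr ?pi_gt0//; lra.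
apply: sin_gt0_pi; rewrite mulr_gt0 ?pi_gt0//=; last by lra.
by rewrite gtr_pMr ?pi_gt0//; lra.
Qed.

Lemma arc_lt b x : 0 < b -> b < x < 1 -> arc b x < 2^-1.
Proof.
move=> b0 /andP[xb x1]; rewrite /arc gtrDl pmulr_rlt0// pmulr_rlt0.
  rewrite -opprB mulrN sinN oppr_lt0.
  apply: sin_gt0_pi; rewrite mulr_gt0 ?pi_gt0//=; last by lra.
  by rewrite gtr_pMr ?pi_gt0//; lra.
apply: sin_gt0_pi; rewrite mulr_gt0 ?pi_gt0//=; last by lra.
by rewrite gtr_pMr ?pi_gt0//; lra.
Qed.

Lemma trig_alg_test psi : trig_alg psi -> periodic psi 1 -> test_function psi.
Proof. by move=> tp pp; split => // n x; exact: trig_alg_smooth. Qed.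

Lemma trig_alg_stone n b : trig_alg (fun x => stone n (arc b x)).
Proof.
by apply: trig_alg_onem; apply: trig_alg_pow; apply: trig_alg_onem;
  apply: trig_alg_pow; exact: trig_alg_arc.
Qed.

End smooth_functions.

(** * Functions orthogonal to all test functions vanish almost everywhere *)

Section fundamental_lemma.
Context {R : realType}.
Local Notation mu := (@lebesgue_measure R).
Local Notation tau := (torus_measure R).
Implicit Types (u v g psi : R -> R) (x b c : R).

Lemma torus_measure_le (A : set R) : measurable A -> (tau A <= mu A)%E.
Proof.
move=> mA; rewrite torus_measureE; apply: le_measure; rewrite ?inE//.
exact: measurableI.
Qed.

Lemma ae_torus_of_mu (P : R -> Prop) :
  {ae mu, forall x, P x} -> {ae tau, forall x, P x}.
Proof.
move=> [N [mN N0 PN]]; exists N; split => //.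
apply/eqP; rewrite eq_le measure_ge0 andbT.
by have := torus_measure_le mN; rewrite N0.
Qed.

Lemma ae_torus_neq c : {ae tau, forall x, x != c}.
Proof.
apply: ae_torus_of_mu; exists [set c]; split => //.
  exact: lebesgue_measure_set1.
by move=> x /= /negP; rewrite negbK => /eqP.
Qed.

Lemma ae_torus_oo : {ae tau, forall x, 0 < x < 1}.
Proof.
have h1 : {ae tau, forall x, x \in `[0, 1[}.
  exists (~` `[0, 1[%classic); split; first exact: measurableC.
    by have := @torus_measureE R (~` `[0, 1[); rewrite setICl measure0.
  by move=> x /=.
apply: ae_imp2 h1 (ae_torus_neq 0) => x.
by rewrite in_itv/= => /andP[x0 ->] xn0; rewrite lt_neqAle eq_sym xn0 x0.
Qed.

Lemma Rintegral_ae_eq (f g : R -> R) : measurable_fun [set: R] f ->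
  measurable_fun [set: R] g -> {ae tau, forall x, f x = g x} ->
  \int[tau]_x f x = \int[tau]_x g x.
Proof.
move=> mf mg fg; rewrite /Rintegral; congr fine.
apply: ae_eq_integral => //; [exact/measurable_EFinP|exact/measurable_EFinP|].
by apply: ae_imp fg => x -> _.
Qed.

Section orthogonal_to_test_functions.
Variable v : R -> R.
Hypothesis iv : periodic_integrable v.
Hypothesis vpsi : forall psi, test_function psi -> \int[tau]_x (v x * psi x) = 0.

Let mv : measurable_fun [set: R] v. Proof. exact: periodic_measurable iv. Qed.

(** The test functions [stone n (arc b x)] take values in [0, 1] and converge to the indicator of x
    < b except at 0 and [b], where [arc b] equals 1/2. Dominated convergence under |v| passes to the
    limit. *)
Lemma orthogonal_prim0 b : 0 < b < 1 -> prim v b = 0.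
Proof.
move=> /andP[b0 b1].
pose psi n x := stone n (arc b x).
have tpsi n : test_function (psi n).
  apply: trig_alg_test; first exact: trig_alg_stone.
  by move=> x; rewrite /psi periodic_arc.
have mpsi n : measurable_fun [set: R] (psi n).
  by apply: continuous_measurable_fun; apply: trig_alg_continuous; exact: trig_alg_stone.
pose ind x : R := if x < b then 1 else 0.
have mind : measurable_fun [set: R] (fun x => v x * ind x).
  apply: measurable_funM => //; apply: measurable_fun_ifT => //.
  exact: measurable_fun_ltr.
have [||||| _ _ cv] := @dominated_convergence _ _ _ tau setT measurableT
  (fun n x => (v x * psi n x)%:E) (fun x => (v x * ind x)%:E) (fun x => `|(v x)%:E|)%E.
- by move=> n; apply/measurable_EFinP; exact: (measurable_funM mv (mpsi n)).
- exact/measurable_EFinP.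
- apply: ae_imp2 ae_torus_oo (ae_torus_neq b) => x /andP[x0 x1] xb _.
  apply: cvg_EFin; first exact: nearW.
  apply: cvgM; first exact: cvg_cst.
  rewrite /ind; case: ltP => bx.
    by apply: cvg_stone_gt; rewrite arc_gt ?x0//=; have /andP[] := arc_itv b x.
  apply: cvg_stone_lt; have /andP[-> _] /= := arc_itv b x.
  by apply: arc_lt => //; rewrite x1 andbT lt_neqAle eq_sym xb.
- exact: (integrable_abse iv.2).
- apply: aeW => x n _; rewrite /= lee_fin normrM ler_piMr//.
  by have /andP[p0 p1] := stone_itv n (arc_itv b x); rewrite ger0_norm.
(* The hypothesis concerns the real integral, which is 0 also when the extended one is infinite;
   integrability excludes that case. *)
have e n : (\int[tau]_x (v x * psi n x)%:E = 0)%E.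
  have := vpsi (tpsi n); rewrite /Rintegral => h.
  rewrite -[LHS]fineK ?h//; apply: integrable_fin_num => //.
  apply: (@le_integrable _ _ _ tau _ measurableT _ (EFin \o v)) => //.
  - by apply/measurable_EFinP; exact: (measurable_funM mv (mpsi n)).
  - move=> x _; rewrite /= lee_fin normrM ler_piMr//.
    by have /andP[p0 p1] := stone_itv n (arc_itv b x); rewrite ger0_norm.
  - exact: iv.2.
have : (\int[tau]_x (v x * ind x)%:E = 0)%E.
  move/cvg_lim : cv => <- //; apply/cvg_lim => //.
  rewrite (_ : [sequence _]_n = cst 0%E); first exact: cvg_cst.
  by apply/funext => n; exact: e.
rewrite integral_torus; last exact/measurable_EFinP.
rewrite prim_ge0 ?ltW// /Rintegral => e0; rewrite -[RHS]/(fine 0%E) -e0; congr fine.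
rewrite (_ : `[0, b[%classic = `[0, 1[%classic `&` `[0, b[%classic); last first.
  by apply/esym/setIidPr; apply: subset_itvl; rewrite bnd_simp ltW.
rewrite integral_mkcondr; apply: eq_integral => y; rewrite inE/= in_itv/= => /andP[y0 y1].
by rewrite patchE mem_setE in_itv/= y0 /ind/=; case: ifPn => _; rewrite ?mulr1 ?mulr0.
Qed.

(** By Lebesgue differentiation, [v] is almost everywhere the derivative of its primitive, which
    vanishes on (0, 1). *)
Lemma orthogonal_ae0 : {ae tau, forall x, v x = 0}.
Proof.
have lv := periodic_locally_int iv.
(* Cutting off outside one period gives a function integrable on the whole line that has the same
   primitive on (0, 1). *)
pose f := v \_ `[0, 1[.
have if1 : mu.-integrable setT (EFin \o f).
  rewrite /f -restrict_EFin; apply/integrable_restrict => //.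
  by rewrite setTI; exact: lv.2.
have lf : locally_integrable [set: R] f by apply: integrable_locally => //; exact: lv.2.
have if2 y : mu.-integrable `[0, y] (EFin \o f) by exact: integrableS if1.
have := @FTC1 _ f (BLeft 0) if2 lf.
move/ae_torus_of_mu => H; apply: ae_imp2 H ae_torus_oo => x + /andP[x0 x1].
case; first by rewrite lte_fin.
move=> _.
rewrite derive1E.
have -> : f x = v x by rewrite /f patchE mem_setE in_itv/= (ltW x0) x1.
move=> <-.
rewrite (@near_eq_derive _ _ _ _ (cst 0)) ?derive_cst//.
have nx : \forall y \near x, 0 < y < 1.
  by apply: (near_in_itvoo); rewrite in_itv/= x0.
near=> y.
have : 0 < y < 1 by near: y.
move=> /andP[y0 y1].
have y01 : 0 < y < 1 by rewrite y0.
transitivity (prim v y); last exact: orthogonal_prim0.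
rewrite prim_ge0 ?ltW//.
rewrite [RHS]Rintegral_itv_bndo_bndc; last exact: lv.2.
apply: eq_Rintegral => t; rewrite inE/= in_itv/= => /andP[t0 ty].
by rewrite /f patchE mem_setE in_itv/= t0 (le_lt_trans ty).
Unshelve. all: by end_near. Qed.

End orthogonal_to_test_functions.
End fundamental_lemma.

(** * Weak derivatives *)

Section weak_derivatives.
Context {R : realType}.
Local Notation mu := (@lebesgue_measure R).
Local Notation tau := (torus_measure R).
Implicit Types (u v g w psi phi : R -> R) (x b c : R).

Lemma LpT2P u : LpT 2%:E u <-> [/\ periodic u 1, measurable_fun [set: R] u &
  (\int[tau]_x (u x ^+ 2)%:E < +oo)%E].
Proof.
rewrite /LpT; split.
  move=> [pu]; rewrite inE => /andP[]; rewrite !inE/= /finite_norm => mu_ fu.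
  split => //; rewrite integral_Lnorm2 expe2.
  by apply: lte_mul_pinfty => //; [exact: Lnorm_ge0|rewrite ge0_fin_numE// Lnorm_ge0].
move=> [pu mu_ fu]; split => //; rewrite inE; apply/andP; split; rewrite inE//=.
rewrite /finite_norm ltNge leye_eq; apply/negP => /eqP h.
by move: fu; rewrite integral_Lnorm2 h expe2 mulyy ltxx.
Qed.

(** Since |u| <= 1 + u^2 and the circle has finite measure, square integrability implies
    integrability. *)
Lemma L2_periodic_integrable u : LpT 2%:E u -> periodic_integrable u.
Proof.
move=> /LpT2P[pu mu_ fu]; split => //.
have i1 : tau.-integrable setT (fun x => 1%:E + (u x ^+ 2)%:E)%E.
  apply: integrableD => //; first exact: finite_measure_integrable_cst.
  apply/integrableP; split; first exact/measurable_EFinP/measurable_funX.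
  apply: le_lt_trans fu; apply: ge0_le_integral => //.
  - by apply: measurableT_comp => //; exact/measurable_EFinP/measurable_funX.
  - exact/measurable_EFinP/measurable_funX.
  - by move=> x _; rewrite /= lee_fin ger0_norm// sqr_ge0.
apply: le_integrable i1 => //; first exact/measurable_EFinP.
move=> x _ /=; rewrite lee_fin.
have h : `|u x| <= 1 + u x ^+ 2 by rewrite -[u x ^+ 2]real_normK ?num_real//; nra.
by rewrite (le_trans h)// ler_norm.
Qed.

Lemma L2_mul_integrable u v : LpT 2%:E u -> LpT 2%:E v ->
  tau.-integrable setT (fun x => (u x * v x)%:E).
Proof.
by move=> [_ iu] [_ iv]; apply/Lfun1_integrable; exact: Lfun2_mul_Lfun1.
Qed.

Lemma L2_add u v : LpT 2%:E u -> LpT 2%:E v -> LpT 2%:E (fun x => u x + v x).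
Proof.
move=> /LpT2P[pu mu_ fu] /LpT2P[pv mv fv]; apply/LpT2P; split.
- by move=> x; rewrite pu pv.
- exact: measurable_funD.
have mu2 : measurable_fun [set: R] (fun x => (u x ^+ 2)%:E).
  exact/measurable_EFinP/measurable_funX.
have mv2 : measurable_fun [set: R] (fun x => (v x ^+ 2)%:E).
  exact/measurable_EFinP/measurable_funX.
apply: (@le_lt_trans _ _ (\int[tau]_x (2%:E * ((u x ^+ 2)%:E + (v x ^+ 2)%:E)))%E).
  apply: ge0_le_integral => //.
  - by move=> x _; rewrite lee_fin sqr_ge0.
  - exact/measurable_EFinP/measurable_funX/measurable_funD.
  - by apply: measurable_funeM; exact: emeasurable_funD.
  - by move=> x _; rewrite -EFinD -EFinM lee_fin; have := sqr_ge0 (u x - v x); lra.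
rewrite ge0_integralZl_EFin//; last 2 first.
- by move=> x _; rewrite adde_ge0// lee_fin sqr_ge0.
- exact: emeasurable_funD.
rewrite lte_mul_pinfty// ge0_integralD//.
- by rewrite lte_add_pinfty.
- by move=> x _; rewrite lee_fin sqr_ge0.
- by move=> x _; rewrite lee_fin sqr_ge0.
Qed.

Lemma L2_scale u c : LpT 2%:E u -> LpT 2%:E (fun x => c * u x).
Proof.
move=> /LpT2P[pu mu_ fu]; apply/LpT2P; split.
- by move=> x; rewrite pu.
- exact: measurable_funM.
- under eq_integral do rewrite exprMn EFinM.
  rewrite ge0_integralZl_EFin ?sqr_ge0//.
  + by rewrite lte_mul_pinfty// lee_fin sqr_ge0.
  + by move=> x _; rewrite lee_fin sqr_ge0.
  + exact/measurable_EFinP/measurable_funX.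
Qed.

Lemma L2_sub u v : LpT 2%:E u -> LpT 2%:E v -> LpT 2%:E (fun x => u x - v x).
Proof.
move=> iu iv; rewrite (_ : (fun x => _) = (fun x => u x + (-1) * v x)).
  by apply: L2_add => //; exact: L2_scale.
by apply/funext => x; rewrite mulN1r.
Qed.

Lemma bounded_L2 u M : periodic u 1 -> measurable_fun [set: R] u ->
  (forall x, `|u x| <= M) -> LpT 2%:E u.
Proof.
move=> pu mu_ uM; apply/LpT2P; split => //.
apply: (@le_lt_trans _ _ (\int[tau]_x (M ^+ 2)%:E)%E).
  apply: ge0_le_integral => //.
  - by move=> x _; rewrite lee_fin sqr_ge0.
  - exact/measurable_EFinP/measurable_funX.
  - by move=> x _; rewrite lee_fin -[u x ^+ 2]real_normK ?num_real//
      ler_sqr ?nnegrE// (le_trans _ (uM x)).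
by rewrite integral_cst//= torus_measureT mule1 ltry.
Qed.

Lemma continuous_periodic_bounded u : continuous u -> periodic u 1 ->
  exists M, forall x, `|u x| <= M.
Proof.
move=> cu pu.
have cn : {within `[0, 1], continuous (fun x => `|u x|)}.
  apply: continuous_subspaceT => x; apply: continuous_comp; first exact: cu.
  exact: norm_continuous.
have [c _ Hc] := EVT_max (@ler01 R) cn.
exists (`|u c|) => x.
have -> : u x = u (x - (Num.Def.floor x)%:~R).
  have := @periodic_int _ (EFin \o u) (fun x => congr1 EFin (pu x))
    (Num.Def.floor x) (x - (Num.Def.floor x)%:~R).
  by rewrite /= subrK => -[].
apply: Hc; rewrite in_itv/= subr_ge0 Num.Theory.floor_le/=.
by have := Num.Theory.floorD1_gt x; rewrite intrD => h; rewrite lerBlDl ltW.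
Qed.

Lemma continuous_periodic_L2 u : continuous u -> periodic u 1 -> LpT 2%:E u.
Proof.
move=> cu pu; have [M HM] := continuous_periodic_bounded cu pu.
by apply: bounded_L2 HM => //; exact: continuous_measurable_fun.
Qed.

Lemma continuous_test phi : test_function phi -> continuous phi.
Proof.
move=> [_ /(_ 0%N) d] x; apply: differentiable_continuous.
by apply/derivable1_diffP; exact: d.
Qed.

Lemma periodic_derive1 u : periodic u 1 -> periodic (derive1 u) 1.
Proof.
move=> pu x; rewrite /derive1.
have e h : u (h + (x + 1)) = u (h + x) by rewrite addrA pu.
by under eq_fun do rewrite e pu.
Qed.

Lemma continuous_derive1_test phi : test_function phi -> continuous (derive1 phi).
Proof.
move=> [_ /(_ 1%N) d] x; apply: differentiable_continuous.
by apply/derivable1_diffP; exact: d.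
Qed.

Lemma test_cst c : test_function (fun=> c).
Proof. by apply: trig_alg_test => //; exact: trig_cst. Qed.

Lemma test_subc psi c : test_function psi -> test_function (fun x => psi x - c).
Proof.
move=> [pp d]; split; first by move=> x; rewrite pp.
case=> [|n] x.
  apply: derivableB; [exact: (d 0%N)|exact: derivable_cst].
rewrite derive1Sn (_ : derive1 _ = derive1 psi) -?derive1Sn; first exact: d.
apply/funext => y; rewrite /derive1.
have e h : psi (h + y) - c - (psi y - c) = psi (h + y) - psi y by ring.
by under eq_fun do rewrite e.
Qed.

Lemma Rintegral_torus_cst c : \int[tau]_x c = c.
Proof.
rewrite Rintegral_cst// -[RHS]mulr1; congr (_ * _).
exact: (congr1 fine (@torus_measureT R)).
Qed.

Lemma test_L2 phi : test_function phi -> LpT 2%:E phi.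
Proof.
by move=> tp; apply: continuous_periodic_L2; [exact: continuous_test|case: tp].
Qed.

Lemma test_derive1_L2 phi : test_function phi -> LpT 2%:E (derive1 phi).
Proof.
move=> tp; apply: continuous_periodic_L2; first exact: continuous_derive1_test.
by apply: periodic_derive1; case: tp.
Qed.

Lemma derive1_prim w : continuous w -> periodic w 1 -> derive1 (prim w) = w.
Proof.
move=> cw pw; apply/funext => x; rewrite derive1E.
have lw := periodic_locally_int (continuous_periodic_integrable cw pw).
by case: (derive_prim lw (cw x)).
Qed.

Lemma test_prim psi : test_function psi -> \int[tau]_x psi x = 0 ->
  test_function (prim psi).
Proof.
move=> tp p0; have cp := continuous_test tp.
have ip : periodic_integrable psi by apply: continuous_periodic_integrable => //; case: tp.
split; first exact: periodic_prim.
case=> [|n] x.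
  by case: (derive_prim (periodic_locally_int ip) (cp x)).
by rewrite derive1Sn derive1_prim//; [case: tp|case: tp].
Qed.

Lemma weak_derivative_uniq u g1 g2 : is_weak_derivative u g1 ->
  is_weak_derivative u g2 -> {ae tau, forall x, g1 x = g2 x}.
Proof.
move=> [i1 h1] [i2 h2].
have H : {ae tau, forall x, g1 x - g2 x = 0}.
  apply: orthogonal_ae0; first exact/L2_periodic_integrable/L2_sub.
  move=> psi tp; under eq_Rintegral do rewrite mulrBl.
  rewrite RintegralB//; [|exact: L2_mul_integrable (test_L2 tp)..].
  by apply/eqP; rewrite subr_eq0 -eqr_opp -h1// h2.
by apply: ae_imp H => x /eqP; rewrite subr_eq0 => /eqP.
Qed.

Lemma weak_derivativeP u : weakly_differentiable u ->
  is_weak_derivative u (weak_derivative u).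
Proof. by move=> [g ug]; exact: (xgetPex (fun=> 0) (ex_intro _ g ug)). Qed.

Lemma weak_derivative_mean0 u g : is_weak_derivative u g -> \int[tau]_x g x = 0.
Proof.
move=> [ig /(_ _ (test_cst 1))].
under eq_Rintegral do rewrite derive1_cst mulr0.
under [X in _ = - X -> _]eq_Rintegral do rewrite mulr1.
by rewrite Rintegral_cst// mul0r => /eqP; rewrite eq_sym oppr_eq0 => /eqP.
Qed.

(** Du Bois-Reymond's argument: [u - prim g] is orthogonal to every mean-zero test function, because
    such a function has a primitive that can be used to test [u], and [prim_parts] moves that
    primitive onto [g]. Hence the difference is its mean. *)
Lemma weak_derivative_prim u g : LpT 2%:E u -> is_weak_derivative u g ->
  exists c, {ae tau, forall x, u x = c + prim g x}.
Proof.
move=> iu ug; have g0 := weak_derivative_mean0 ug; have [ig H] := ug.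
have pig := L2_periodic_integrable ig; have lg := periodic_locally_int pig.
have iP : LpT 2%:E (prim g).
  by apply: continuous_periodic_L2; [exact: continuous_prim|exact: periodic_prim].
pose v x := u x - prim g x.
have iv : LpT 2%:E v by exact: L2_sub.
pose m := \int[tau]_x v x.
exists m.
have i1 : LpT 2%:E (fun=> 1 : R) by exact: test_L2 (test_cst 1).
have icst (c : R) : LpT 2%:E (fun=> c) by exact: test_L2 (test_cst c).
have ivm : LpT 2%:E (fun x => v x - m) by exact: L2_sub.
have K : {ae tau, forall x, v x - m = 0}.
  apply: orthogonal_ae0; first exact/L2_periodic_integrable.
  move=> psi tp; have ipsi := test_L2 tp.
  pose c := \int[tau]_x psi x.
  (* Only after removing its mean does a test function have a periodic primitive. *)
  pose p x := psi x - c.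
  have tpp : test_function p by exact: test_subc.
  have ip := test_L2 tpp.
  have p0 : \int[tau]_x p x = 0.
    rewrite RintegralB//; [by rewrite Rintegral_torus_cst subrr| |].
    - exact: (L2_periodic_integrable ipsi).2.
    - exact: (L2_periodic_integrable (icst c)).2.
  have := H _ (test_prim tpp p0).
  rewrite derive1_prim; [|exact: continuous_test|by case: tpp].
  have := prim_parts (L2_periodic_integrable ip) pig p0 => <-.
  under [X in _ = X -> _]eq_Rintegral do rewrite mulrC.
  move=> e1.
  have e2 : \int[tau]_x (v x * p x) = 0.
    rewrite /v; under eq_Rintegral do rewrite mulrBl.
    by rewrite RintegralB//; [rewrite e1 subrr|exact: L2_mul_integrable|exact: L2_mul_integrable].
  have e3 : \int[tau]_x (v x * psi x) = c * m.
    move: e2; rewrite /p; under eq_Rintegral do rewrite mulrBr (mulrC _ c).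
    rewrite RintegralB//; last 2 first.
    - exact: L2_mul_integrable.
    - exact: (L2_periodic_integrable (L2_scale c iv)).2.
    rewrite RintegralZl//; last exact: (L2_periodic_integrable iv).2.
    by move=> /eqP; rewrite subr_eq0 => /eqP.
  under eq_Rintegral do rewrite mulrBl.
  rewrite RintegralB//; [|exact: L2_mul_integrable|exact: L2_mul_integrable].
  rewrite e3 RintegralZl//; last exact: (L2_periodic_integrable ipsi).2.
  by rewrite mulrC subrr.
apply: ae_imp K => x /eqP; rewrite subr_eq0 /v => /eqP <-.
by rewrite subrK.
Qed.

End weak_derivatives.

(** * Functions of class H^2 *)

Section H2_representatives.
Context {R : realType}.
Local Notation mu := (@lebesgue_measure R).
Local Notation tau := (torus_measure R).
Implicit Types (u v g k p q phi U G : R -> R) (x y c d r : R).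

(** As an integral over the circle, the primitive becomes insensitive to changes on null sets of
    [torus_measure]. This confines [x] to [0, 1]. *)
Lemma prim_torus g x : locally_int g -> 0 <= x <= 1 ->
  prim g x = \int[tau]_y (g y * (if y < x then 1 else 0)).
Proof.
move=> lg /andP[x0 x1].
rewrite Rintegral_torus; last first.
  apply: measurable_funM; first exact: lg.1.
  by apply: measurable_fun_ifT => //; exact: measurable_fun_ltr.
rewrite prim_ge0//.
rewrite (_ : `[0, x[%classic = `[0, 1[%classic `&` `[0, x[%classic); last first.
  by apply/esym/setIidPr; apply: subset_itvl; rewrite bnd_simp.
rewrite Rintegral_mkcondr; apply: eq_Rintegral => y.
rewrite inE/= in_itv/= => /andP[y0 y1].
by rewrite patchE mem_setE in_itv/= y0 /=; case: ifPn => _; rewrite ?mulr1 ?mulr0.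
Qed.

Lemma eq_prim_ae g k x : locally_int g -> locally_int k ->
  {ae tau, forall y, g y = k y} -> 0 <= x <= 1 -> prim g x = prim k x.
Proof.
move=> lg lk gk x01; rewrite !prim_torus//.
have mi : measurable_fun [set: R] (fun y : R => if y < x then 1 else 0 : R).
  by apply: measurable_fun_ifT => //; exact: measurable_fun_ltr.
apply: Rintegral_ae_eq.
- by apply: measurable_funM => //; exact: lg.1.
- by apply: measurable_funM => //; exact: lk.1.
- by apply: ae_imp gk => y ->.
Qed.

(* U is a C^1 function with derivative G, whose derivative in the sense of
   absolutely continuous functions is k. *)
Record H2rep U G k : Prop := {
  H2rep_k : LpT 2%:E k;
  H2rep_G : continuous G;
  H2rep_U : continuous U;
  H2rep_pG : periodic G 1;
  H2rep_pU : periodic U 1;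
  H2rep_BG : forall x y, x <= y -> G y - G x = \int[mu]_(t in `[x, y[) k t;
  H2rep_BU : forall x y, x <= y -> U y - U x = \int[mu]_(t in `[x, y[) G t;
  H2rep_derive : forall x, is_derive x 1 U (G x) }.

(** Integrate twice: [G] is a constant plus the primitive of the second weak derivative, [U] a
    constant plus the primitive of [G]. [G] inherits mean 0 from the weak derivative it represents,
    which makes [U] periodic. *)
Lemma H2T_rep u : H2T u -> exists U G,
  [/\ H2rep U G (weak_derivative (weak_derivative u)),
      {ae tau, forall x, u x = U x} &
      {ae tau, forall x, weak_derivative u x = G x}].
Proof.
move=> [iu /weak_derivativeP ug /weak_derivativeP gk].
set g := weak_derivative u in ug gk *; set k := weak_derivative g in gk *.
have [ig _] := ug; have [ik _] := gk.
have k0 := weak_derivative_mean0 gk; have g0 := weak_derivative_mean0 ug.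
have pig := L2_periodic_integrable ig; have pik := L2_periodic_integrable ik.
have lg := periodic_locally_int pig; have lk := periodic_locally_int pik.
have [d gG] := weak_derivative_prim ig gk.
have [c uU] := weak_derivative_prim iu ug.
pose G x := d + prim k x.
have cG : continuous G by move=> x; apply: cvgD; [exact: cvg_cst|exact: continuous_prim].
have pG : periodic G 1 by move=> x; rewrite /G periodic_prim.
have piG := continuous_periodic_integrable cG pG.
have lG := periodic_locally_int piG.
have G0 : \int[tau]_x G x = 0.
  by rewrite -g0; apply: Rintegral_ae_eq; [exact: lG.1|exact: lg.1|apply: ae_imp gG => x ->].
exists (fun x => c + prim G x), G; split.
- split => //.
  + by move=> x; apply: cvgD; [exact: cvg_cst|exact: continuous_prim].
  + by move=> x; rewrite periodic_prim.
  + by move=> x y xy; rewrite /G -primB// opprD addrACA subrr add0r.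
  + by move=> x y xy; rewrite -primB// opprD addrACA subrr add0r.
  + move=> x; have h := derive_prim lG (cG x).
    have h2 : is_derive x 1 (cst c) (0 : R) by exact: is_derive_cst.
    by have := is_deriveD h2 h; rewrite add0r.
- apply: ae_imp2 uU ae_torus_oo => x -> /andP[x0 x1].
  by congr (_ + _); apply: eq_prim_ae => //; rewrite (ltW x0) ltW.
- exact: gG.
Qed.

(** One-dimensional Sobolev embedding: a value exceeds the average over the period starting at [x]
    by no more than the oscillation [Q]. *)
Lemma sup_bound p Q x : continuous p -> periodic p 1 ->
  (forall a b, a <= b -> b <= a + 1 -> `|p b - p a| <= Q) ->
  `|p x| <= \int[tau]_y `|p y| + Q.
Proof.
move=> cp pp HQ; have ip := continuous_periodic_integrable cp pp.
have ing := periodic_integrable_norm ip.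
rewrite -(Rintegral_period x ing).
have -> : `|p x| = \int[mu]_(y in `[x, (x + 1)[) `|p x|.
  rewrite Rintegral_cst//= lebesgue_measure_itv/= lte_fin ltrDl ltr01.
  by rewrite -EFinB /= (addrC x) addrK mulr1.
have -> : Q = \int[mu]_(y in `[x, (x + 1)[) Q.
  rewrite Rintegral_cst//= lebesgue_measure_itv/= lte_fin ltrDl ltr01.
  by rewrite -EFinB /= (addrC x) addrK mulr1.
have icst (a : R) : mu.-integrable `[x, (x + 1)[ (EFin \o cst a).
  apply: measurable_bounded_integrable => //.
    by rewrite /= lebesgue_measure_itv/= lte_fin ltrDl ltr01 -EFinB ltry.
  by exists `|a|; split; [exact: num_real|move=> y /ltW ay z _; exact: ay].
have il : mu.-integrable `[x, (x + 1)[ (EFin \o (fun y => `|p y|)).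
  exact: (periodic_locally_int ing).2.
rewrite -(RintegralD _ il (icst Q))//.
apply: (@le_Rintegral _ _ _ mu _ (cst `|p x|) (fun y => `|p y| + Q)) => //.
  exact: (integrableD _ il (icst Q)).
move=> y /=; rewrite in_itv/= => /andP[xy yx].
rewrite -lerBlDl (le_trans (lerB_dist _ _))// distrC.
by apply: HQ => //; exact: ltW.
Qed.

(** The crude bound |p| <= 1 + p^2 gives a constant polynomial in [r]. *)
Lemma L1_le_L2 p r : LpT 2%:E p -> (\int[tau]_x (p x ^+ 2)%:E <= (r ^+ 2)%:E)%E ->
  \int[tau]_x `|p x| <= 1 + r ^+ 2.
Proof.
move=> ip pr.
have i1 : tau.-integrable setT (EFin \o (fun x => `|p x|)).
  exact: (periodic_integrable_norm (L2_periodic_integrable ip)).2.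
have i2 : tau.-integrable setT (EFin \o (fun x => p x ^+ 2)).
  by have := L2_mul_integrable ip ip.
have i3 : tau.-integrable setT (EFin \o cst 1) by exact: finite_measure_integrable_cst.
apply: (@le_trans _ _ (\int[tau]_x (1 + p x ^+ 2))).
  apply: le_Rintegral => //; first exact: (integrableD _ i3 i2).
  by move=> x _; rewrite -[p x ^+ 2]real_normK ?num_real//; nra.
rewrite RintegralD// Rintegral_torus_cst lerD2l /Rintegral.
rewrite -lee_fin fineK//; exact: integrable_fin_num.
Qed.

Lemma H2norm_le u r : 0 <= r -> (H2norm u <= r%:E)%E ->
  [/\ (\int[tau]_x (u x ^+ 2)%:E <= (r ^+ 2)%:E)%E,
      (\int[tau]_x (weak_derivative u x ^+ 2)%:E <= (r ^+ 2)%:E)%E &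
      (\int[tau]_x (weak_derivative (weak_derivative u) x ^+ 2)%:E <= (r ^+ 2)%:E)%E].
Proof.
move=> r0; rewrite /H2norm /normT !integral_Lnorm2.
set A := (X in (X ^+ 2 + _ + _)%E); set B := (X in (_ + X ^+ 2 + _)%E).
set C := (X in (_ + _ + X ^+ 2)%E) => h.
have A0 : (0 <= A ^+ 2)%E by rewrite expe_ge0// Lnorm_ge0.
have B0 : (0 <= B ^+ 2)%E by rewrite expe_ge0// Lnorm_ge0.
have C0 : (0 <= C ^+ 2)%E by rewrite expe_ge0// Lnorm_ge0.
have S0 : (0 <= A ^+ 2 + B ^+ 2 + C ^+ 2)%E by rewrite !adde_ge0.
have S : (A ^+ 2 + B ^+ 2 + C ^+ 2 <= (r ^+ 2)%:E)%E.
  rewrite -[leLHS](@poweRe1 _ _ S0) -[X in poweR _ X](@mulVf _ 2)// poweRrM poweR_sqr ?poweR_ge0//.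
  by rewrite EFin_expe lee_sqr// poweR_ge0.
split; apply: le_trans S.
- by rewrite -addeA; apply: leeDl; exact: adde_ge0.
- by rewrite addeAC; apply: leeDr; exact: adde_ge0.
- by apply: leeDr; exact: adde_ge0.
Qed.

Section representative_properties.
Variables U G k : R -> R.
Hypothesis rep : H2rep U G k.

Let lG := periodic_locally_int
  (continuous_periodic_integrable (H2rep_G rep) (H2rep_pG rep)).
Let lk := periodic_locally_int (L2_periodic_integrable (H2rep_k rep)).

(** Each sup norm is at most the L^1 norm of the function plus that of its derivative, and each of
    these is at most 1 + r^2; hence the factor 2. *)
Lemma H2rep_sup r :
  (\int[tau]_x (U x ^+ 2)%:E <= (r ^+ 2)%:E)%E ->
  (\int[tau]_x (G x ^+ 2)%:E <= (r ^+ 2)%:E)%E ->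
  (\int[tau]_x (k x ^+ 2)%:E <= (r ^+ 2)%:E)%E ->
  forall x, `|U x| <= 2 * (1 + r ^+ 2) /\ `|G x| <= 2 * (1 + r ^+ 2).
Proof.
move=> Ur Gr kr x.
have iU := continuous_periodic_L2 (H2rep_U rep) (H2rep_pU rep).
have iG := continuous_periodic_L2 (H2rep_G rep) (H2rep_pG rep).
have b1 := L1_le_L2 iU Ur; have b2 := L1_le_L2 iG Gr.
have b3 := L1_le_L2 (H2rep_k rep) kr.
split.
- apply: (le_trans (sup_bound x (H2rep_U rep) (H2rep_pU rep) (Q := \int[tau]_x `|G x|) _)).
    move=> a b ab ba; rewrite (H2rep_BU rep)// -primB//.
    by apply: le_primB => //; exact: L2_periodic_integrable.
  by rewrite mulrDl mul1r in b1 b2 *; lra.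
- apply: (le_trans (sup_bound x (H2rep_G rep) (H2rep_pG rep) (Q := \int[tau]_x `|k x|) _)).
    move=> a b ab ba; rewrite (H2rep_BG rep)// -primB//.
    by apply: le_primB => //; exact/L2_periodic_integrable/(H2rep_k rep).
  by lra.
Qed.

Lemma H2rep_lipschitz L : (forall x, `|G x| <= L) ->
  forall x y, `|U x - U y| <= L * `|x - y|.
Proof.
move=> GL.
have H x y : x <= y -> `|U y - U x| <= L * (y - x).
  move=> xy; rewrite (H2rep_BU rep)//.
  rewrite (le_trans (le_normr_Rintegral _ (lG.2 x y)))//.
  have -> : L * (y - x) = \int[mu]_(t in `[x, y[) (cst L t).
    rewrite Rintegral_cst//= lebesgue_measure_itv/= lte_fin.
    case: ltP => [xy'|yx]; first by rewrite -EFinB.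
    have yx' : y = x by apply/eqP; rewrite eq_le yx.
    by rewrite yx' subrr !mulr0.
  apply: le_Rintegral => //.
  - exact: (integrable_norm (lG.2 x y)).
  - apply: measurable_bounded_integrable => //.
      by rewrite /= lebesgue_measure_itv/=; case: ifP => _; rewrite ?ltry// -EFinB ltry.
    by exists `|L|; split; [exact: num_real|move=> z /ltW az t _; exact: az].
move=> x y; case: (leP x y) => [xy|/ltW yx].
  by rewrite distrC (le_trans (H _ _ xy))// [`|x - y|]distrC ger0_norm ?subr_ge0.
by rewrite (le_trans (H _ _ yx))// ger0_norm ?subr_ge0.
Qed.

(** Chain rule F(U)' = U G: the two sides differ by a function of zero derivative, and they agree at
    0. *)
Lemma H2rep_flux_prim x :
  burgers_flux (U x) = burgers_flux (U 0) + prim (fun y => U y * G y) x.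
Proof.
have cUG : continuous (fun y => U y * G y).
  by move=> y; apply: cvgM; [exact: (H2rep_U rep)|exact: (H2rep_G rep)].
have pUG : periodic (fun y => U y * G y) 1.
  by move=> y; rewrite (H2rep_pU rep) (H2rep_pG rep).
have lUG := periodic_locally_int (continuous_periodic_integrable cUG pUG).
have H := @is_derive_0_is_cst _
  (fun x => burgers_flux (U x) - prim (fun y => U y * G y) x) x 0.
have : burgers_flux (U x) - prim (fun y => U y * G y) x =
    burgers_flux (U 0) - prim (fun y => U y * G y) 0.
  apply: H => {}x; have dU := H2rep_derive rep x.
  have dF : is_derive x 1 (fun x => burgers_flux (U x)) (U x * G x).
    have h1 := is_deriveM dU dU.
    have := is_deriveZ (2^-1) h1.
    rewrite (_ : (2^-1 \*: (U * U)) = fun x => burgers_flux (U x)); last first.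
      by apply/funext => y; rewrite /burgers_flux /= /GRing.scale/= mulrC -expr2.
    rewrite (_ : 2^-1 *: _ = U x * G x)//.
    by rewrite /GRing.scale/=; field.
  by have := is_deriveB dF (derive_prim lUG (cUG x)); rewrite subrr.
by rewrite prim0 subr0 => <-; rewrite subrK.
Qed.

Lemma prim_derive1_test phi x : test_function phi ->
  prim (derive1 phi) x = phi x - phi 0.
Proof.
move=> tp; have cd := continuous_derive1_test tp.
have ld := periodic_locally_int (L2_periodic_integrable (test_derive1_L2 tp)).
have : phi x - prim (derive1 phi) x = phi 0 - prim (derive1 phi) 0.
  apply: (@is_derive_0_is_cst _ (fun x => phi x - prim (derive1 phi) x)) => {}x.
  have dp : is_derive x 1 phi (derive1 phi x).
    by rewrite derive1E; apply: derivableP; case: tp => _ /(_ 0%N).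
  by have := is_deriveB dp (derive_prim ld (cd x)); rewrite subrr.
by rewrite prim0 subr0 => <-; rewrite opprB addrC subrK.
Qed.

(** Write F(u) as a constant plus the primitive of U G and integrate by parts. The constant
    disappears against phi', which has mean 0, and phi(0) disappears against U G for the same
    reason. *)
Lemma H2rep_flux_weak_derivative u : measurable_fun [set: R] u ->
  {ae tau, forall x, u x = U x} ->
  is_weak_derivative (burgers_flux \o u) (fun x => U x * G x).
Proof.
move=> mu_ uU.
have cUG : continuous (fun y => U y * G y).
  by move=> y; apply: cvgM; [exact: (H2rep_U rep)|exact: (H2rep_G rep)].
have pUG : periodic (fun y => U y * G y) 1.
  by move=> y; rewrite (H2rep_pU rep) (H2rep_pG rep).
have iUG := continuous_periodic_L2 cUG pUG.
have piUG := L2_periodic_integrable iUG.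
have mU : measurable_fun [set: R] U by apply: continuous_measurable_fun; exact: (H2rep_U rep).
split => // phi tp.
have id := test_derive1_L2 tp; have pid := L2_periodic_integrable id.
(* The mean of U G is the increment of F(U) over one period. *)
have UG0 : \int[tau]_x (U x * G x) = 0.
  have := prim_period 0 piUG; rewrite prim0 !add0r => <-.
  by apply: (addrI (burgers_flux (U 0))); 
    rewrite -H2rep_flux_prim -[in LHS](add0r 1) (H2rep_pU rep) addr0.
have d0 : \int[tau]_x (derive1 phi x) = 0.
  have := prim_period 0 pid; rewrite prim0 !add0r => <-.
  by rewrite prim_derive1_test// -[in LHS](add0r 1) tp.1 subrr.
have mbf (f : R -> R) : measurable_fun [set: R] f -> measurable_fun [set: R] (burgers_flux \o f).
  by move=> mf; apply: measurable_funM => //; exact: measurable_funX.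
have cP := continuous_prim (periodic_locally_int piUG).
have iP : LpT 2%:E (prim (fun y => U y * G y)).
  by apply: continuous_periodic_L2 => //; exact: periodic_prim.
have md : measurable_fun [set: R] (derive1 phi) by case/LpT2P: id.
transitivity (\int[tau]_x (burgers_flux (U 0) * derive1 phi x +
                           derive1 phi x * prim (fun y => U y * G y) x)).
  apply: Rintegral_ae_eq.
  - by apply: measurable_funM => //; exact: mbf.
  - apply: measurable_funD; first exact: measurable_funM.
    by apply: measurable_funM => //; exact: continuous_measurable_fun.
  - by apply: ae_imp uU => x /= ->; rewrite H2rep_flux_prim; ring.
rewrite RintegralD//; last 2 first.
- exact: (L2_periodic_integrable (L2_scale _ id)).2.
- exact: L2_mul_integrable.
rewrite RintegralZl//; last exact: pid.2.
rewrite d0 mulr0 add0r prim_parts//; congr (- _).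
under eq_Rintegral do rewrite prim_derive1_test// mulrBr.
rewrite RintegralB//; last 2 first.
- exact: (L2_mul_integrable iUG (test_L2 tp)).
- by under eq_fun do rewrite mulrC; exact: (L2_periodic_integrable (L2_scale _ iUG)).2.
under [X in _ - X]eq_Rintegral do rewrite mulrC.
by rewrite RintegralZl ?UG0 ?mulr0 ?subr0//; exact: piUG.2.
Qed.

End representative_properties.
End H2_representatives.

(** * The nonlocal operator *)

Section measurable_Rintegral.
Context d1 d2 (T1 : measurableType d1) (T2 : measurableType d2) (R : realType).
Variable m2 : {sigma_finite_measure set T2 -> \bar R}.

(** Positive and negative parts are measurable in the parameter by Tonelli, and extended subtraction
    and [fine] preserve measurability, so no integrability of the sections has to be checked. *)
Lemma measurable_Rintegral (F : T1 * T2 -> R) : measurable_fun setT F ->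
  measurable_fun setT (fun x => \int[m2]_y F (x, y)).
Proof.
move=> mF; have mEF : measurable_fun setT (EFin \o F) by exact/measurable_EFinP.
apply: measurableT_comp => //.
rewrite (_ : (fun x => _) = (fun x => \int[m2]_y ((EFin \o F)^\+ (x, y)) -
   \int[m2]_y ((EFin \o F)^\- (x, y)))%E); last first.
  apply/funext => x; have := integralE m2 setT ((EFin \o F) \o pair x).
  by rewrite funepos_comp funeneg_comp.
apply: emeasurable_funB.
- apply: (measurable_fun_fubini_tonelli_F (EFin \o F)^\+%E) => //.
  exact: measurable_funepos.
- apply: (measurable_fun_fubini_tonelli_F (EFin \o F)^\-%E) => //.
  exact: measurable_funeneg.
Qed.

End measurable_Rintegral.

Section kernel.
Context {R : realType}.
Local Notation mu := (@lebesgue_measure R).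
Local Notation tau := (torus_measure R).
Implicit Types (h u v U G p k eta : R -> R) (x y z M L eps : R).

(* The properties of z |-> eps^-2 eta(z/eps) that matter; [m1] bounds its first
   absolute moment uniformly in eps, [m2] its second one. *)
Record regular_kernel h (m1 m2 : R) : Prop := {
  rk_integrable : mu.-integrable setT (EFin \o h);
  rk_odd : {ae mu, forall z, h (- z) = - h z};
  rk_mass : \int[mu]_z h z = 0;
  rk_integrable1 : mu.-integrable setT (fun z => (z * h z)%:E);
  rk_moment : \int[mu]_z (z * h z) = -1;
  rk_m1 : (\int[mu]_z (`|z| * `|h z|)%:E <= m1%:E)%E;
  rk_m2 : (\int[mu]_z (`|z| ^+ 2 * `|h z|)%:E <= m2%:E)%E }.

Section scaling.
Variables (eta : R -> R) (eps : R).
Hypotheses (eps0 : 0 < eps) (heta : admissible_kernel eta).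
Local Notation h := (fun z => eps ^- 2 * eta (z / eps)).

Let ieta : mu.-integrable setT (EFin \o eta). Proof. by case: heta. Qed.

Let meta : measurable_fun [set: R] eta.
Proof. by have /integrableP[/measurable_EFinP] := ieta. Qed.

Lemma ge0_integral_dilate (f : R -> \bar R) : measurable_fun [set: R] f ->
  (forall x, (0 <= f x)%E) ->
  (\int[mu]_z f (z / eps)%R = eps%:E * \int[mu]_z f z)%E.
Proof.
move=> mf f0; have e0 : 0 < eps^-1 by rewrite invr_gt0.
have := ge0_integral_affine 0 e0 mf f0; rewrite invrK => <-.
by apply: eq_integral => z _; rewrite addr0 mulrC.
Qed.

Lemma integral_dilate (f : R -> \bar R) : mu.-integrable setT f ->
  (\int[mu]_z f (z / eps)%R = eps%:E * \int[mu]_z f z)%E.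
Proof.
move=> intf; apply: (integral_posneg_comp (g := fun z => z / eps)) => // g mg g0.
exact: ge0_integral_dilate.
Qed.

Let mdil (f : R -> \bar R) : measurable_fun [set: R] f ->
  measurable_fun [set: R] (fun z => f (z / eps)).
Proof. by move=> mf; apply: (measurableT_comp mf); exact: measurable_funM. Qed.

Lemma integrable_dilate (f : R -> \bar R) : mu.-integrable setT f ->
  mu.-integrable setT (fun z => f (z / eps)).
Proof.
move=> /integrableP[mf fy]; apply/integrableP; split; first exact: mdil.
rewrite (ge0_integral_dilate (f := fun z => `|f z|%E))//; last exact: measurableT_comp.
by rewrite lte_mul_pinfty// lee_fin ltW.
Qed.

Let m2_fin : (\int[mu]_z (`|z| ^+ 2 * `|eta z|)%:E < +oo)%E.
Proof.
have [_ _ _ _] := heta; rewrite /second_moment.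
have : (0 <= \int[mu]_z (`|z| ^+ 2 * `|eta z|)%:E)%E.
  by apply: integral_ge0 => z _; rewrite lee_fin mulr_ge0// exprn_ge0.
case: (\int[mu]_z _)%E => [a _ _|_|//]; first exact: ltry.
by rewrite gt0_muley// lte_fin invr_gt0.
Qed.

Lemma measurable_moment n : measurable_fun [set: R] (fun z => (`|z| ^+ n * `|eta z|)%:E).
Proof.
apply/measurable_EFinP; apply: measurable_funM.
  by apply: measurable_funX; exact: normr_measurable.
exact: measurableT_comp.
Qed.

Lemma integrable_moment1 : mu.-integrable setT (fun z => (`|z| * `|eta z|)%:E).
Proof.
have i2 : mu.-integrable setT (fun z => (`|z| ^+ 2 * `|eta z|)%:E).
  apply/integrableP; split; first exact: measurable_moment.
  by under eq_integral do rewrite gee0_abs ?lee_fin ?mulr_ge0 ?exprn_ge0//.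
apply: (le_integrable _ _ _ (integrableD _ (integrable_abse ieta) i2)) => //.
  exact: (measurable_moment 1).
move=> z _ /=; rewrite lee_fin normrM !normr_id.
have h0 : 0 <= `|eta z| + `|z| ^+ 2 * `|eta z| by rewrite addr_ge0// mulr_ge0// exprn_ge0.
rewrite (ger0_norm h0) -[X in _ <= X + _]mul1r -mulrDl ler_wpM2r//.
by have := normr_ge0 z; nra.
Qed.

(** Substituting z = eps t, the factor eps^-2 is offset by eps from dz and one eps from each power
    of z: the first moments do not depend on eps and the second one carries a factor eps. *)
Lemma scaled_regular_kernel : regular_kernel h
  (fine (\int[mu]_z (`|z| * `|eta z|)%:E))
  (eps * fine (\int[mu]_z (`|z| ^+ 2 * `|eta z|)%:E)).
Proof.
have [_ odd mass mom _] := heta.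
have en0 : eps != 0 by rewrite gt_eqF.
have i1 : mu.-integrable setT (fun z => (z * eta z)%:E).
  apply: (le_integrable _ _ _ integrable_moment1) => //.
    by apply/measurable_EFinP; exact: measurable_funM.
  by move=> z _; rewrite /= lee_fin !normrM !normr_id.
have E1 z : z * (eps ^- 2 * eta (z / eps)) = eps^-1 * ((z / eps) * eta (z / eps)).
  by field.
split.
- exact: (integrableZl _ _ (integrable_dilate ieta)).
(* Oddness almost everywhere survives the dilation because the preimage of a null set under an
   affine map is null. *)
- case: odd => N [mN N0 HN].
  exists ((fun z => eps^-1 * z + 0) @^-1` N); split.
  + rewrite -[X in measurable X]setTI; apply: (measurable_affine eps^-1 0) => //.
  + have e0 : 0 < eps^-1 by rewrite invr_gt0.
    have := lebesgue_measure_affine 0 e0 mN; rewrite N0 => /esym/eqP.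
    rewrite mule_eq0 => /orP[|/eqP//].
    by rewrite eqe invr_eq0 (negbTE en0).
  + move=> z Hz; apply: HN => /= H2; apply: Hz => /=.
    rewrite mulNr; move: H2; rewrite addr0 (mulrC _ z) => ->; ring.
- rewrite RintegralZl//; last exact: (integrable_dilate ieta).
  rewrite /Rintegral (integral_dilate ieta).
  have -> : (\int[mu]_z (EFin \o eta) z = 0)%E.
    by rewrite -[LHS]fineK ?[fine _]mass//; exact: integrable_fin_num.
  by rewrite mule0 mulr0.
- under eq_fun do rewrite E1 EFinM.
  exact: (integrableZl _ _ (integrable_dilate i1)).
- under eq_Rintegral do rewrite E1.
  rewrite RintegralZl//; last exact: (integrable_dilate i1).
  rewrite /Rintegral (integral_dilate i1) fineM//; last exact: integrable_fin_num.
  by rewrite [fine (\int[mu]_z _)]mom /=; field.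
- rewrite fineK; last exact: integrable_fin_num integrable_moment1.
  have E2 z : (`|z| * `|eps ^- 2 * eta (z / eps)|)%:E =
      ((eps^-1)%:E * (`|z / eps| * `|eta (z / eps)|)%:E)%E.
    rewrite -EFinM; congr EFin.
    rewrite !normrM normfV normrX (gtr0_norm eps0) normfV (gtr0_norm eps0).
    by field.
  under eq_integral do rewrite E2.
  rewrite ge0_integralZl_EFin ?invr_ge0 ?(ltW eps0)//; last first.
    exact: (mdil (measurable_moment 1)).
  rewrite (ge0_integral_dilate (measurable_moment 1)); last by move=> z; rewrite lee_fin mulr_ge0.
  by rewrite muleA -EFinM mulVf// mul1e.
- rewrite EFinM fineK; last first.
    by rewrite ge0_fin_numE// integral_ge0// => z _; rewrite lee_fin mulr_ge0// exprn_ge0.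
  have E2 z : (`|z| ^+ 2 * `|eps ^- 2 * eta (z / eps)|) = (`|z / eps| ^+ 2 * `|eta (z / eps)|).
    rewrite !normrM normfV normrX (gtr0_norm eps0) normfV (gtr0_norm eps0).
    by field.
  under eq_integral do rewrite E2.
  by rewrite (ge0_integral_dilate (measurable_moment 2)).
Qed.

End scaling.

(** For [h] the scaled kernel this is convertible to [nonlocal eta eps u]; a general [h] makes the
    estimates depend on the scaling only through the moments of [h]. *)
Definition nonlocal_kernel h u x : R := \int[tau]_y
  (periodization h (x - y) * (burgers_flux (u x) - burgers_flux (u y))).

Lemma measurable_burgers_flux u : measurable_fun [set: R] u ->
  measurable_fun [set: R] (fun x => burgers_flux (u x)).
Proof. by move=> mu_; apply: measurable_funM => //; exact: measurable_funX. Qed.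

Lemma continuous_burgers_flux u : continuous u ->
  continuous (fun x => burgers_flux (u x)).
Proof.
move=> cu x; apply: cvgM; last exact: cvg_cst.
by apply: cvgM; exact: cu.
Qed.

Lemma measurable_nonlocal_kernel h u : measurable_fun [set: R] h ->
  measurable_fun [set: R] u -> measurable_fun [set: R] (nonlocal_kernel h u).
Proof.
move=> mh mu_.
apply: (@measurable_Rintegral _ _ _ _ _ tau (fun z : measurableTypeR R * measurableTypeR R =>
  periodization h (z.1 - z.2) * (burgers_flux (u z.1) - burgers_flux (u z.2)))).
apply: measurable_funM.
  by apply: (measurableT_comp (measurable_periodization mh)); exact: measurable_funB.
by apply: measurable_funB; apply: (measurableT_comp (measurable_burgers_flux mu_)).
Qed.

(** Under the integral sign u and U may be exchanged almost everywhere, but F(u x) enters as a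
    value, hence the condition at the point [x] itself. *)
Lemma nonlocal_kernel_line h u U x : mu.-integrable setT (EFin \o h) ->
  measurable_fun [set: R] u -> continuous U -> periodic U 1 ->
  {ae tau, forall y, u y = U y} -> u x = U x ->
  nonlocal_kernel h u x =
  \int[mu]_z (h z * (burgers_flux (U x) - burgers_flux (U (x - z)))).
Proof.
move=> ih mu_ cU pU uU uUx.
have mh : measurable_fun [set: R] h by have /integrableP[/measurable_EFinP] := ih.
have mU : measurable_fun [set: R] U by exact: continuous_measurable_fun.
pose p y := burgers_flux (U x) - burgers_flux (U y).
have cp : continuous p.
  by move=> y; apply: cvgB; [exact: cvg_cst|exact: continuous_burgers_flux].
have pp : periodic p 1 by move=> y; rewrite /p pU.
have mp : measurable_fun [set: R] p by exact: continuous_measurable_fun.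
have [M pM] := continuous_periodic_bounded cp pp.
have [_ e] := integrable_periodization x ih mp pp pM.
transitivity (\int[tau]_y (periodization h (x - y) * p y)); last by rewrite /Rintegral e.
have mper : measurable_fun [set: R] (fun y => periodization h (x - y)).
  by apply: (measurableT_comp (measurable_periodization mh)); exact: measurable_funB.
apply: Rintegral_ae_eq.
- apply: measurable_funM => //; apply: measurable_funB => //.
  exact: measurable_burgers_flux.
- exact: measurable_funM.
- by apply: ae_imp uU => y uUy; rewrite /p uUx uUy.
Qed.

Lemma integrable_kernel_mul h p x : mu.-integrable setT (EFin \o h) ->
  continuous p -> periodic p 1 ->
  mu.-integrable setT (fun z => (h z * p (x - z))%:E).
Proof.
move=> ih cp pp; have [M pM] := continuous_periodic_bounded cp pp.
have mh : measurable_fun [set: R] h by have /integrableP[/measurable_EFinP] := ih.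
have mp : measurable_fun [set: R] p by exact: continuous_measurable_fun.
apply: (@le_integrable _ _ _ mu _ measurableT _ (fun z => M%:E * (h z)%:E)%E) => //.
- apply/measurable_EFinP; apply: measurable_funM => //.
  by apply: (measurableT_comp mp); exact: measurable_funB.
- move=> z _; rewrite /= lee_fin !normrM mulrC ler_wpM2r//.
  exact: (le_trans (pM _) (ler_norm _)).
- exact: integrableZl.
Qed.

End kernel.

(** * Consistency *)

Section taylor.
Context {R : realType}.
Local Notation mu := (@lebesgue_measure R).
Local Notation tau := (torus_measure R).
Implicit Types (f g k : R -> R) (a b c x z J : R).

Lemma lebesgue_itv_co a b : a <= b -> mu `[a, b[ = (b - a)%:E.
Proof.
move=> ab; rewrite lebesgue_measure_itv/= lte_fin.
case: ltP => [_|ba]; first by rewrite EFinB.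
have -> : b = a by apply/eqP; rewrite eq_le ba.
by rewrite subrr.
Qed.

Lemma Rintegral_itv_cst a b c : a <= b -> \int[mu]_(t in `[a, b[) c = c * (b - a).
Proof. by move=> ab; rewrite Rintegral_cst//= lebesgue_itv_co. Qed.

Lemma integrable_itv_cst a b c : a <= b -> mu.-integrable `[a, b[ (EFin \o cst c).
Proof.
move=> ab; apply: measurable_bounded_integrable => //.
  by rewrite [X in (X < _)%E](lebesgue_itv_co ab) ltry.
by exists `|c|; split; [exact: num_real|move=> z /ltW az t _; exact: az].
Qed.

Lemma Rintegral_sub_cst f a b c J : locally_int f -> a <= b ->
  (forall s, a <= s <= b -> `|f s - c| <= J) ->
  `|\int[mu]_(t in `[a, b[) f t - c * (b - a)| <= J * (b - a).
Proof.
move=> lf ab fJ.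
rewrite -!Rintegral_itv_cst// -RintegralB//; [|exact: lf.2|exact: integrable_itv_cst].
have i1 : mu.-integrable `[a, b[ (EFin \o (fun t => f t - c)).
  exact: (integrableB _ (lf.2 a b) (integrable_itv_cst c ab)).
rewrite (le_trans (le_normr_Rintegral _ i1))//.
apply: (@le_Rintegral _ _ _ mu _ (fun t => `|f t - c|) (cst J)) => //.
- exact: (integrable_norm i1).
- exact: integrable_itv_cst.
- by move=> t; rewrite /= in_itv/= => /andP[at_ tb]; apply: fJ; rewrite at_ ltW.
Qed.

(** Cauchy-Schwarz on the line for the indicator of the interval and the restriction of [f] to
    it. *)
Lemma cauchy_schwarz_itv f a b : locally_int f -> a <= b ->
  ((\int[mu]_(t in `[a, b[) `|f t|%:E) ^+ 2 <=
   (b - a)%:E * \int[mu]_(t in `[a, b[) (f t ^+ 2)%:E)%E.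
Proof.
move=> [mf _] ab.
pose I : set R := `[a, b[%classic.
have mI : measurable I by exact: measurable_itv.
have m1 : measurable_fun [set: R] (\1_I : R -> R) by exact: measurable_indic.
have mg : measurable_fun [set: R] (fun t => f t * \1_I t) by exact: measurable_funM.
have := cauchy_schwarz mu m1 mg.
have e1 : (\int[mu]_x `|\1_I x * (f x * \1_I x)|%:E = \int[mu]_(t in I) `|f t|%:E)%E.
  rewrite [RHS]integral_mkcond; apply: eq_integral => x _.
  rewrite patchE indicE; case: ifPn => _; first by rewrite mul1r mulr1.
  by rewrite mul0r normr0.
have e2 : (\int[mu]_x (\1_I x ^+ 2)%:E = (b - a)%:E)%E.
  transitivity (\int[mu]_x (\1_I x)%:E)%E.
    by apply: eq_integral => x _; rewrite indicE; case: (_ \in _); rewrite ?expr1n ?expr0n.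
  by rewrite integral_indic// setIT; exact: lebesgue_itv_co.
have e3 : (\int[mu]_x ((f x * \1_I x) ^+ 2)%:E = \int[mu]_(t in I) (f t ^+ 2)%:E)%E.
  rewrite [RHS]integral_mkcond; apply: eq_integral => x _.
  by rewrite patchE indicE; case: ifPn => _; rewrite ?mulr1// mulr0 expr0n.
by rewrite e1 e2 e3.
Qed.

Section representative.
Variables (U G k : R -> R).
Hypothesis rep : H2rep U G k.

Let lG := periodic_locally_int
  (continuous_periodic_integrable (H2rep_G rep) (H2rep_pG rep)).
Let pk := L2_periodic_integrable (H2rep_k rep).
Let lk := periodic_locally_int pk.
Let lnk := periodic_locally_int (periodic_integrable_norm pk).

Lemma H2rep_G_modulus a b s t : a <= s <= b -> a <= t <= b ->
  `|G s - G t| <= \int[mu]_(y in `[a, b[) `|k y|.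
Proof.
wlog st : s t / s <= t.
  move=> H sab tab; case: (leP s t) => [st|/ltW ts]; first exact: H.
  by rewrite distrC; apply: H.
move=> /andP[as_ sb] /andP[at_ tb].
rewrite distrC (H2rep_BG rep)// (le_trans (le_normr_Rintegral _ (lk.2 s t)))//.
rewrite (Rintegral_split lnk (le_trans as_ st) tb) (Rintegral_split lnk as_ st).
by rewrite -addrA addrCA lerDl addr_ge0// Rintegral_ge0.
Qed.

Definition taylor_rest x z := U (x - z) - U x + z * G x.

(** The remainder is the integral of G - G(x) between x - z and x, up to sign. The symmetric window
    contains that interval for either sign of [z]. *)
Lemma le_taylor_rest x z : `|taylor_rest x z| <=
  `|z| * \int[mu]_(y in `[(x - `|z|), (x + `|z|)[) `|k y|.
Proof.
set J := Rintegral _ _ _; rewrite /taylor_rest (mulrC `|z|).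
have z0 := normr_ge0 z.
have GJ s : x - `|z| <= s <= x + `|z| -> `|G s - G x| <= J.
  by move=> hs; apply: H2rep_G_modulus => //; apply/andP; split; lra.
have [zge|zlt] := leP 0 z.
  have h := @Rintegral_sub_cst G (x - z) x (G x) J lG.
  have e : U (x - z) - U x + z * G x =
      - (\int[mu]_(t in `[(x - z), x[) G t - G x * (x - (x - z))).
    by rewrite -(H2rep_BU rep); [ring|lra].
  rewrite e normrN (ger0_norm zge).
  have -> : J * z = J * (x - (x - z)) by ring.
  apply: h; first by lra.
  by move=> s hs; apply: GJ; rewrite (ger0_norm zge); lra.
have h := @Rintegral_sub_cst G x (x - z) (G x) J lG.
have e : U (x - z) - U x + z * G x =
    \int[mu]_(t in `[x, (x - z)[) G t - G x * (x - z - x).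
  by rewrite -(H2rep_BU rep); [ring|lra].
rewrite e (ltr0_norm zlt).
have -> : J * - z = J * (x - z - x) by ring.
apply: h; first by lra.
by move=> s hs; apply: GJ; rewrite (ltr0_norm zlt); lra.
Qed.

(** With r = |z|, Cauchy-Schwarz bounds the squared remainder by r^2 times 2r times the integral of
    k^2 over the window. Centred at x, that window is a fixed interval in t = y - x, so Tonelli and
    translation invariance produce a further factor 2r, whence 4 K r^4. *)
Lemma L2_taylor_rest z (K : R) :
  (\int[tau]_x (k x ^+ 2)%:E <= K%:E)%E ->
  (\int[tau]_x (taylor_rest x z ^+ 2)%:E <= (4 * K * z ^+ 4)%:E)%E.
Proof.
move=> kK; pose r : R := `|z|.
have r0 : 0 <= r by exact: normr_ge0.
have mk : measurable_fun [set: R] k := lk.1.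
have mk2 : measurable_fun [set: R] (fun x => (k x ^+ 2)%:E).
  exact/measurable_EFinP/measurable_funX.
pose I : set R := `[(- r), r[%classic.
have mI : measurable I by exact: measurable_itv.
have m1 : measurable_fun [set: R] (\1_I : R -> R) by exact: measurable_indic.
pose F (w : measurableTypeR R * measurableTypeR R) : \bar R :=
  (k (w.1 + w.2) ^+ 2 * \1_I w.2)%:E.
have F0 w : (0 <= F w)%E by rewrite lee_fin mulr_ge0// sqr_ge0.
have mF : measurable_fun setT F.
  apply/measurable_EFinP; apply: measurable_funM.
    by apply: measurable_funX; apply: (measurableT_comp mk); exact: measurable_funD.
  exact: (measurableT_comp m1).
have mF1 : measurable_fun [set: R] (fun x => \int[mu]_t F (x, t))%E.
  exact: (measurable_fun_fubini_tonelli_F F mF F0).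
have H x : ((taylor_rest x z ^+ 2)%:E <= (2 * r ^+ 3)%:E * \int[mu]_t F (x, t))%E.
  have e : (\int[mu]_t F (x, t) = \int[mu]_(t in `[(x - r)%R, (x + r)%R[) (k t ^+ 2)%:E)%E.
    have := ge0_integral_shift (- r) r x mk2 (fun x => _).
    rewrite (addrC _ x) (addrC r) => <-; last by move=> ?; rewrite lee_fin sqr_ge0.
    rewrite [RHS]integral_mkcond; apply: eq_integral => t _.
    by rewrite patchE /F/= indicE (addrC x); case: ifPn => _; rewrite ?mulr1 ?mulr0.
  rewrite e.
  have xr : x - r <= x + r by lra.
  have := cauchy_schwarz_itv lk xr.
  have -> : x + r - (x - r) = 2 * r by ring.
  move=> cs.
  have inJ : ((\int[mu]_(t in `[(x - r)%R, (x + r)%R[) `|k t|)%:E =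
    \int[mu]_(t in `[(x - r)%R, (x + r)%R[) `|k t|%:E)%E.
    by rewrite /Rintegral fineK//; apply: integrable_fin_num => //; exact: lnk.2.
  rewrite -inJ in cs.
  apply: (@le_trans _ _ ((r ^+ 2)%:E * (\int[mu]_(t in `[(x - r)%R, (x + r)%R[) `|k t|)%:E ^+ 2)%E).
    rewrite -EFin_expe -EFinM lee_fin -exprMn -[X in X <= _]real_normK ?num_real//.
    rewrite ler_sqr ?nnegrE ?mulr_ge0 ?Rintegral_ge0//.
    exact: le_taylor_rest.
  have -> : 2 * r ^+ 3 = r ^+ 2 * (2 * r) by ring.
  rewrite (EFinM (r ^+ 2)) -muleA; apply: lee_pmul => //.
  - by rewrite lee_fin sqr_ge0.
  - by rewrite -EFin_expe lee_fin sqr_ge0.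
apply: (@le_trans _ _ (\int[tau]_x ((2 * r ^+ 3)%:E * \int[mu]_t F (x, t)))%E).
  apply: ge0_le_integral => //.
  - by move=> x _; rewrite lee_fin sqr_ge0.
  - apply/measurable_EFinP; apply: measurable_funX; apply: continuous_measurable_fun.
    move=> x; apply: cvgD; last by apply: cvgM; [exact: cvg_cst|exact: (H2rep_G rep)].
    apply: cvgB; last exact: (H2rep_U rep).
    apply: (@continuous_comp _ _ _ (fun y => y - z) U); last exact: (H2rep_U rep).
    by apply: cvgB; [exact: cvg_id|exact: cvg_cst].
  - exact: measurable_funeM.
rewrite ge0_integralZl_EFin//; last 2 first.
- by move=> x _; exact: integral_ge0.
- by rewrite mulr_ge0// exprn_ge0.
rewrite (fubini_tonelli F mF F0).
have e t : (\int[tau]_x F (x, t) = (\1_I t)%:E * \int[tau]_x (k x ^+ 2)%:E)%E.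
  have k0 x : (0 <= (k x ^+ 2)%:E)%E by rewrite lee_fin sqr_ge0.
  rewrite -(ge0_integral_torus_shift mk2 k0 _ t); last by move=> x; rewrite (H2rep_k rep).1.
  rewrite -ge0_integralZl_EFin//.
  - by apply: eq_integral => x _; rewrite -EFinM mulrC.
  - apply: (measurableT_comp mk2); exact: measurable_funD.
under eq_integral do rewrite e.
rewrite ge0_integralZr//; last 2 first.
- exact/measurable_EFinP.
- by apply: integral_ge0 => x _; rewrite lee_fin sqr_ge0.
rewrite integral_indic// setIT [X in (_ * (X * _))%E](lebesgue_itv_co _); last by lra.
have K0 : (0 <= \int[tau]_x (k x ^+ 2)%:E)%E.
  by apply: integral_ge0 => x _; rewrite lee_fin sqr_ge0.
rewrite muleA -EFinM.
have -> : 2 * r ^+ 3 * (r - - r) = 4 * z ^+ 4.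
  have -> : z ^+ 4 = r ^+ 4 by rewrite /r (exprM z 2 2) (exprM `|z| 2 2) real_normK// num_real.
  by ring.
rewrite (_ : 4 * K * z ^+ 4 = 4 * z ^+ 4 * K); last by ring.
rewrite [leRHS]EFinM; apply: lee_pmul => //.
by rewrite lee_fin mulr_ge0// exprn_even_ge0.
Qed.

End representative.
End taylor.

(** The inverse is rewritten through a real power of z^2; at 0 both expressions take the value 0. *)
Lemma measurable_invr (R : realType) : measurable_fun [set: R] (fun z : R => z^-1).
Proof.
rewrite (_ : (fun z => _) = fun z : R => z * (z ^+ 2) `^ (-1)).
  apply: measurable_funM => //.
  have m2 : measurable_fun [set: R] (fun x : R => x ^+ 2) by exact: measurable_funX.
  have mp : measurable_fun [set: R] (fun a : R => a `^ (-1)) by exact: measurable_powR.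
  exact: (measurableT_comp mp m2).
apply/funext => z; rewrite powR_inv1 ?sqr_ge0//.
by have [->|z0] := eqVneq z 0; [rewrite invr0 mul0r|field].
Qed.

Section consistency.
Context {R : realType}.
Local Notation mu := (@lebesgue_measure R).
Local Notation tau := (torus_measure R).
Variables (h : R -> R) (m1 m2 : R).
Hypothesis rk : regular_kernel h m1 m2.
Variables (U G k : R -> R) (L K : R).
Hypothesis rep : H2rep U G k.
Hypotheses (UL : forall x, `|U x| <= L) (GL : forall x, `|G x| <= L).
Hypothesis kK : (\int[tau]_x (k x ^+ 2)%:E <= K%:E)%E.

Let L0 : 0 <= L. Proof. exact: le_trans (UL 0). Qed.

Let mh : measurable_fun [set: R] h.
Proof. by have /integrableP[/measurable_EFinP] := rk_integrable rk. Qed.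

Let mU : measurable_fun [set: R] U.
Proof. by apply: continuous_measurable_fun; exact: (H2rep_U rep). Qed.

Let mG : measurable_fun [set: R] G.
Proof. by apply: continuous_measurable_fun; exact: (H2rep_G rep). Qed.

Definition flux_rest x z :=
  burgers_flux (U (x - z)) - burgers_flux (U x) + z * (U x * G x).

(** F is quadratic, so its expansion around U(x) stops at second order and the identity is exact. *)
Lemma flux_restE x z : flux_rest x z =
  U x * taylor_rest U G x z + (U (x - z) - U x) ^+ 2 / 2.
Proof. by rewrite /flux_rest /burgers_flux /taylor_rest; field. Qed.

Lemma measurable_flux_rest : measurable_fun setT
  (fun w : measurableTypeR R * measurableTypeR R => flux_rest w.1 w.2).
Proof.
apply: measurable_funD; last first.
  apply: measurable_funM => //; apply: measurable_funM.
    exact: (measurableT_comp mU).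
  exact: (measurableT_comp mG).
apply: measurable_funB.
  apply: (measurableT_comp (measurable_burgers_flux mU)).
  exact: measurable_funB.
exact: (measurableT_comp (measurable_burgers_flux mU)).
Qed.

(** From (s + t)^2 <= 2 s^2 + 2 t^2 applied to [flux_restE]: the Taylor term contributes 2 L^2 times
    4 K, and the square of the increment contributes 2 (L^2 z^2 / 2)^2. *)
Definition flux_const : R := 8 * L ^+ 2 * K + L ^+ 4 / 2.

Lemma L2_flux_rest z :
  (\int[tau]_x (flux_rest x z ^+ 2)%:E <= (flux_const * z ^+ 4)%:E)%E.
Proof.
have mt : measurable_fun [set: R] (fun x => (taylor_rest U G x z ^+ 2)%:E).
  apply/measurable_EFinP; apply: measurable_funX; apply: measurable_funD.
    apply: measurable_funB => //; apply: (measurableT_comp mU).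
    exact: measurable_funB.
  exact: measurable_funM.
have mf : measurable_fun [set: R] (fun x => flux_rest x z).
  exact: (measurableT_comp measurable_flux_rest (pair2_measurable z)).
apply: (@le_trans _ _ (\int[tau]_x
  ((2 * L ^+ 2)%:E * (taylor_rest U G x z ^+ 2)%:E + (L ^+ 4 * z ^+ 4 / 2)%:E))%E).
  apply: ge0_le_integral => //.
  - by move=> x _; rewrite lee_fin sqr_ge0.
  - exact/measurable_EFinP/measurable_funX.
  - by apply: emeasurable_funD => //; exact: measurable_funeM.
  - move=> x _; rewrite -EFinM -EFinD lee_fin flux_restE.
    have h1 : U x ^+ 2 <= L ^+ 2.
      by rewrite -[U x ^+ 2]real_normK ?num_real// ler_sqr ?nnegrE.
    have h2 : (U (x - z) - U x) ^+ 2 <= L ^+ 2 * z ^+ 2.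
      have := H2rep_lipschitz rep GL (x - z) x.
      rewrite (_ : x - z - x = - z); last by ring.
      rewrite normrN => hl.
      rewrite -[X in X <= _]real_normK ?num_real// -[z ^+ 2]real_normK ?num_real//.
      by rewrite -exprMn ler_sqr ?nnegrE// mulr_ge0.
    have h3 : (U (x - z) - U x) ^+ 2 ^+ 2 <= (L ^+ 2 * z ^+ 2) ^+ 2.
      by rewrite ler_sqr ?nnegrE ?sqr_ge0// mulr_ge0 ?sqr_ge0.
    have h4 : U x ^+ 2 * taylor_rest U G x z ^+ 2 <= L ^+ 2 * taylor_rest U G x z ^+ 2.
      by rewrite ler_wpM2r ?sqr_ge0.
    have := sqr_ge0 (U x * taylor_rest U G x z - (U (x - z) - U x) ^+ 2 / 2).
    rewrite (_ : L ^+ 4 * z ^+ 4 = (L ^+ 2 * z ^+ 2) ^+ 2); last by ring.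
    move: h3 h4; move: (taylor_rest _ _ _ _) ((_ * _) ^+ 2) ((_ - _) ^+ 2) => t D s.
    by lra.
rewrite ge0_integralD//; last 3 first.
- by move=> x _; rewrite mule_ge0// lee_fin ?sqr_ge0// mulr_ge0// sqr_ge0.
- exact: measurable_funeM.
- by move=> x _; rewrite lee_fin divr_ge0// mulr_ge0// exprn_even_ge0.
rewrite ge0_integralZl_EFin//; last 2 first.
- by move=> x _; rewrite lee_fin sqr_ge0.
- by rewrite mulr_ge0// sqr_ge0.
have -> : (\int[tau]__ (L ^+ 4 * z ^+ 4 / 2)%:E = (L ^+ 4 * z ^+ 4 / 2)%:E)%E.
  by rewrite integral_cst//= torus_measureT mule1.
have -> : flux_const * z ^+ 4 = (2 * L ^+ 2) * (4 * K * z ^+ 4) + L ^+ 4 * z ^+ 4 / 2.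
  by rewrite /flux_const; field.
rewrite EFinD (EFinM (2 * L ^+ 2)) leeD2r//; apply: lee_wpmul2l.
  by rewrite lee_fin mulr_ge0// sqr_ge0.
exact: (L2_taylor_rest rep).
Qed.

(** The consistency defect of the representative; [consistency] shows that the defect of [u] agrees
    with it almost everywhere. *)
Definition line_defect x :=
  \int[mu]_z (h z * (burgers_flux (U x) - burgers_flux (U (x - z)))) + U x * G x.

Lemma integrable_flux_rest x : mu.-integrable setT (fun z => (h z * flux_rest x z)%:E).
Proof.
pose p y := burgers_flux (U y) - burgers_flux (U x).
have cp : continuous p.
  move=> y; apply: cvgB; last exact: cvg_cst.
  by apply: continuous_burgers_flux; exact: (H2rep_U rep).
have pp : periodic p 1 by move=> y; rewrite /p (H2rep_pU rep).
have i1 := integrable_kernel_mul x (rk_integrable rk) cp pp.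
have i2 := integrableZl measurableT (U x * G x) (rk_integrable1 rk).
have := integrableD measurableT i1 i2.
apply: eq_integrable => // z _ /=; rewrite -EFinM -EFinD; congr EFin.
by rewrite /p /flux_rest; ring.
Qed.

(** The first moment -1 lets U G be written as an integral against z h(z), which cancels the linear
    term of the flux increment. *)
Lemma line_defectE x : line_defect x = - \int[mu]_z (h z * flux_rest x z).
Proof.
rewrite /line_defect.
have i2 := integrableZl measurableT (U x * G x) (rk_integrable1 rk).
have -> : U x * G x = - \int[mu]_z (U x * G x * (z * h z)).
  by rewrite RintegralZl ?(rk_moment rk) ?mulrN1 ?opprK//; exact: (rk_integrable1 rk).
have e z : h z * (burgers_flux (U x) - burgers_flux (U (x - z))) =
   U x * G x * (z * h z) - h z * flux_rest x z by rewrite /flux_rest; ring.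
under eq_Rintegral do rewrite e.
rewrite RintegralB//; first by rewrite addrAC subrr add0r.
exact: integrable_flux_rest.
Qed.

Let W x z := `|h z| * (flux_rest x z ^+ 2 / z ^+ 2).

Let W0 x z : 0 <= W x z.
Proof. by rewrite mulr_ge0// divr_ge0// sqr_ge0. Qed.

Let mW : measurable_fun setT
  (fun w : measurableTypeR R * measurableTypeR R => (W w.1 w.2)%:E).
Proof.
apply/measurable_EFinP; apply: measurable_funM.
  by apply: (measurableT_comp (measurableT_comp (@normr_measurable R setT) mh)).
apply: measurable_funM.
  by apply: measurable_funX; exact: measurable_flux_rest.
apply: (measurableT_comp (@measurable_invr R)) => //.
by apply: measurable_funX.
Qed.

(* Cauchy-Schwarz with respect to |h z| dz, splitting the remainder as
   |z| * (flux_rest x z / z). *)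
Lemma sqr_line_defect x :
  ((line_defect x ^+ 2)%:E <= m2%:E * \int[mu]_z (W x z)%:E)%E.
Proof.
have mfx : measurable_fun [set: R] (flux_rest x).
  exact: (measurableT_comp measurable_flux_rest (pair1_measurable x)).
have msq : measurable_fun [set: R] (fun z => Num.sqrt `|h z|).
  apply: measurableT_comp; last exact: measurableT_comp.
  by apply: continuous_measurable_fun; exact: sqrt_continuous.
have mf : measurable_fun [set: R] (fun z => Num.sqrt `|h z| * `|z|).
  by apply: measurable_funM => //; exact: normr_measurable.
have mg : measurable_fun [set: R] (fun z => Num.sqrt `|h z| * (flux_rest x z / z)).
  by apply: measurable_funM => //; apply: measurable_funM => //; exact: measurable_invr.
have := cauchy_schwarz mu mf mg.
have e1 : (\int[mu]_z `|Num.sqrt `|h z| * `|z| * (Num.sqrt `|h z| * (flux_rest x z / z))|%:E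
   = \int[mu]_z `|h z * flux_rest x z|%:E)%E.
  apply: eq_integral => z _; congr EFin.
  (* Division by 0 gives 0 here, and [flux_rest x 0] vanishes too, so the splitting is also correct
     at z = 0. *)
  have [->|z0] := eqVneq z 0.
    by rewrite normr0 mulr0 mul0r /flux_rest subr0 mul0r addr0 subrr mulr0 normr0.
  rewrite mulrACA -expr2 sqr_sqrtr// !normrM normr_id; congr (_ * _).
  by rewrite normr_id normfV mulrCA divff ?mulr1// normr_eq0.
have e2 : (\int[mu]_z ((Num.sqrt `|h z| * `|z|) ^+ 2)%:E = \int[mu]_z (`|z| ^+ 2 * `|h z|)%:E)%E.
  by apply: eq_integral => z _; congr EFin; rewrite exprMn sqr_sqrtr// mulrC.
have e3 : (\int[mu]_z ((Num.sqrt `|h z| * (flux_rest x z / z)) ^+ 2)%:E = \int[mu]_z (W x z)%:E)%E.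
  by apply: eq_integral => z _; congr EFin; rewrite /W exprMn sqr_sqrtr// expr_div_n.
rewrite e1 e2 e3 => cs.
have i := integrable_flux_rest x.
apply: (@le_trans _ _ ((\int[mu]_z `|h z * flux_rest x z|%:E) ^+ 2)%E).
  rewrite line_defectE sqrrN -[X in X%:E]real_normK ?num_real// EFin_expe.
  rewrite lee_sqr//; last by apply: integral_ge0.
  by rewrite EFin_normr_Rintegral//; exact: (le_abse_integral _ measurableT (measurable_int _ i)).
apply: (le_trans cs); apply: lee_pmul => //.
- by apply: integral_ge0 => z _; rewrite lee_fin mulr_ge0// sqr_ge0.
- by apply: integral_ge0 => z _; rewrite lee_fin.
- exact: (rk_m2 rk).
Qed.

Let m2_ge0 : 0 <= m2.
Proof.
rewrite -lee_fin (le_trans _ (rk_m2 rk))//.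
by apply: integral_ge0 => z _; rewrite lee_fin mulr_ge0// sqr_ge0.
Qed.

Let flux_const_ge0 : 0 <= flux_const.
Proof.
rewrite addr_ge0 ?divr_ge0 ?exprn_even_ge0// !mulr_ge0 ?sqr_ge0//.
by rewrite -lee_fin (le_trans _ kK)//; apply: integral_ge0 => z _; rewrite lee_fin sqr_ge0.
Qed.

Lemma measurable_line_defect : measurable_fun [set: R] line_defect.
Proof.
apply: measurable_funD; last exact: measurable_funM.
apply: (@measurable_Rintegral _ _ _ _ _ mu (fun w : measurableTypeR R * measurableTypeR R =>
  h w.2 * (burgers_flux (U w.1) - burgers_flux (U (w.1 - w.2))))).
apply: measurable_funM; first exact: (measurableT_comp mh).
apply: measurable_funB; first exact: (measurableT_comp (measurable_burgers_flux mU)).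
apply: (measurableT_comp (measurable_burgers_flux mU)); exact: measurable_funB.
Qed.

Let mh2 : measurable_fun [set: R] (fun z => (`|z| ^+ 2 * `|h z|)%:E).
Proof.
apply/measurable_EFinP; apply: measurable_funM; last exact: measurableT_comp.
by apply: measurable_funX; exact: normr_measurable.
Qed.

(** Integrating [W] in x first turns z^4 / z^2 into z^2, so a second factor m2 appears. As m2 is
    proportional to eps, the squared norm is of order eps^2. *)
Lemma L2_line_defect :
  (\int[tau]_x (line_defect x ^+ 2)%:E <= (flux_const * m2 ^+ 2)%:E)%E.
Proof.
have W0' (w : measurableTypeR R * measurableTypeR R) : (0 <= (W w.1 w.2)%:E)%E.
  by rewrite lee_fin.
have mWF := measurable_fun_fubini_tonelli_F (m2 := mu) _ mW W0'.
have mWG := measurable_fun_fubini_tonelli_G (m1 := tau) _ mW W0'.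
apply: (@le_trans _ _ (\int[tau]_x (m2%:E * \int[mu]_z (W x z)%:E))%E).
  apply: ge0_le_integral => //.
  - by move=> x _; rewrite lee_fin sqr_ge0.
  - have mld := measurable_line_defect.
    exact/measurable_EFinP/measurable_funX.
  - apply: measurable_funeM.
    exact: mWF.
  - by move=> x _; exact: sqr_line_defect.
rewrite ge0_integralZl_EFin//; last first.
  by move=> x _; apply: integral_ge0 => z _; rewrite lee_fin.
have -> : flux_const * m2 ^+ 2 = m2 * (flux_const * m2) by ring.
rewrite (EFinM m2); apply: lee_wpmul2l; first by rewrite lee_fin.
rewrite (fubini_tonelli _ mW W0') /=.
apply: (@le_trans _ _ (\int[mu]_z (flux_const%:E * (`|z| ^+ 2 * `|h z|)%:E))%E).
  apply: ge0_le_integral => //.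
  - by move=> z _; apply: integral_ge0 => x _; rewrite lee_fin.
  - exact: measurable_funeM.
  - move=> z _.
    have e x : W x z = (`|h z| / z ^+ 2) * flux_rest x z ^+ 2 by rewrite /W; ring.
    under eq_integral do rewrite e EFinM.
    rewrite ge0_integralZl_EFin//; last 3 first.
    + by move=> x _; rewrite lee_fin sqr_ge0.
    + have mf : measurable_fun [set: R] (fun x => flux_rest x z).
        exact: (measurableT_comp measurable_flux_rest (pair2_measurable z)).
      exact/measurable_EFinP/measurable_funX.
    + by rewrite divr_ge0// sqr_ge0.
    have hz0 : 0 <= `|h z| / z ^+ 2 by rewrite divr_ge0// sqr_ge0.
    apply: (@le_trans _ _ ((`|h z| / z ^+ 2)%:E * (flux_const * z ^+ 4)%:E)%E).
      by apply: lee_wpmul2l; [rewrite lee_fin|exact: L2_flux_rest].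
    rewrite -!EFinM lee_fin real_normK ?num_real//.
    have [->|z0] := eqVneq z 0; first by rewrite !expr0n/= !(mulr0, mul0r).
    by rewrite le_eqVlt; apply/orP; left; apply/eqP; field.
rewrite ge0_integralZl_EFin//.
by rewrite EFinM; apply: lee_wpmul2l; [rewrite lee_fin|exact: (rk_m2 rk)].
Qed.

(** Taking square roots in [L2_line_defect] gives the factor [Num.sqrt flux_const], which is bounded
    by 1 + flux_const. *)
Lemma consistency u :
  LpT 2%:E u -> {ae tau, forall x, u x = U x} ->
  weakly_differentiable (burgers_flux \o u) /\
  (normT 2%:E (nonlocal_kernel h u \+ weak_derivative (burgers_flux \o u))
     <= ((1 + flux_const) * m2)%:E)%E.
Proof.
move=> /LpT2P[_ mu_ _] uU.
have wd := H2rep_flux_weak_derivative rep mu_ uU.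
have wdf : weakly_differentiable (burgers_flux \o u) by eexists; exact: wd.
split=> //.
have wdP := weak_derivativeP wdf.
have mw : measurable_fun [set: R] (weak_derivative (burgers_flux \o u)).
  by have [/LpT2P[]] := wdP.
have E := weak_derivative_uniq wdP wd.
have mn := measurable_nonlocal_kernel mh mu_.
have mld := measurable_line_defect.
set D := (X in normT _ X).
have DE : {ae tau, forall x, D x = line_defect x}.
  apply: (ae_imp2 _ E uU) => x Ex uUx; rewrite /D /= Ex /line_defect.
  by rewrite (nonlocal_kernel_line (rk_integrable rk) mu_ (H2rep_U rep) (H2rep_pU rep) uU uUx).
have mD : measurable_fun [set: R] D by exact: measurable_funD.
have S : (normT 2%:E D ^+ 2 <= (flux_const * m2 ^+ 2)%:E)%E.
  rewrite /normT -integral_Lnorm2//; apply: le_trans L2_line_defect.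
  rewrite le_eqVlt; apply/orP; left; apply/eqP.
  apply: ge0_ae_eq_integral => //.
  - exact/measurable_EFinP/measurable_funX.
  - exact/measurable_EFinP/measurable_funX.
  - by move=> x _; rewrite lee_fin sqr_ge0.
  - by move=> x _; rewrite lee_fin sqr_ge0.
  - by apply: ae_imp DE => x -> _.
rewrite -lee_sqr ?Lnorm_ge0//; last first.
  by rewrite lee_fin mulr_ge0// addr_ge0.
apply: (le_trans S); rewrite -EFin_expe lee_fin exprMn ler_wpM2r ?sqr_ge0//.
by move: flux_const_ge0; nra.
Qed.

End consistency.

(** * Stability *)

Section symmetry.
Context {R : realType}.
Local Notation mu := (@lebesgue_measure R).
Local Notation tau := (torus_measure R).
Implicit Types (h p q f : R -> R).

Lemma Rintegral_reflect f : measurable_fun [set: R] f ->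
  \int[mu]_z f (- z) = \int[mu]_z f z.
Proof.
move=> mf; rewrite /Rintegral -(integral_reflect (f := EFin \o f) 0)//.
  by congr fine; apply: eq_integral => z _ /=; rewrite sub0r.
exact/measurable_EFinP.
Qed.

Lemma Rintegral_torus_shift f c : measurable_fun [set: R] f -> periodic f 1 ->
  \int[tau]_x f (x + c) = \int[tau]_x f x.
Proof.
move=> mf pf; rewrite /Rintegral (@integral_torus_shift _ (EFin \o f) c)//.
  exact/measurable_EFinP.
by move=> x /=; rewrite pf.
Qed.

Section fubini.
Variables (h p q : R -> R).
Hypotheses (ih : mu.-integrable setT (EFin \o h)).
Hypotheses (cp : continuous p) (pp : periodic p 1).
Hypotheses (cq : continuous q) (pq : periodic q 1).

Let mh : measurable_fun [set: R] h.
Proof. by have /integrableP[/measurable_EFinP] := ih. Qed.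

Let F (w : measurableTypeR R * measurableTypeR R) :=
  (p w.1 * (h w.2 * q (w.1 - w.2)))%:E.

Let mF : measurable_fun setT F.
Proof.
have mp : measurable_fun [set: R] p by exact: continuous_measurable_fun.
have mq : measurable_fun [set: R] q by exact: continuous_measurable_fun.
apply/measurable_EFinP; apply: measurable_funM; first exact: (measurableT_comp mp).
apply: measurable_funM; first exact: (measurableT_comp mh).
apply: (measurableT_comp mq); exact: measurable_funB.
Qed.

Let iF : (tau \x mu)%E.-integrable setT F.
Proof.
have [P HP] := continuous_periodic_bounded cp pp.
have [Q HQ] := continuous_periodic_bounded cq pq.
apply/(integrable12ltyP tau mu mF).
have PQ : 0 <= P * Q by rewrite mulr_ge0 ?(le_trans _ (HP 0)) ?(le_trans _ (HQ 0)).
have mah : measurable_fun [set: R] (fun z => `|h z|%:E).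
  by apply/measurable_EFinP; exact: measurableT_comp.
have mFa : measurable_fun setT (fun w => `|F w|)%E by exact: measurableT_comp.
have mFF := measurable_fun_fubini_tonelli_F (m2 := mu) _ mFa (fun w => abse_ge0 (F w)).
have hy : (\int[mu]_z `|h z|%:E < +oo)%E by have /integrableP[_] := ih.
apply: (@le_lt_trans _ _ (\int[tau]_x ((P * Q)%:E * \int[mu]_z `|h z|%:E))%E).
  apply: ge0_le_integral => //.
  - by move=> x _; apply: integral_ge0.
  - move=> x _; rewrite -ge0_integralZl_EFin//.
    apply: ge0_le_integral => //.
    + exact: (measurableT_comp mFa (pair1_measurable x)).
    + exact: measurable_funeM.
    + move=> z _; rewrite -EFinM lee_fin !normrM mulrCA mulrC /=.
      by rewrite ler_wpM2r// ler_pM.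
rewrite integral_cst//= torus_measureT mule1.
by apply: lte_mul_pinfty => //; rewrite lee_fin.
Qed.

(** Lets the pairing of a function with a convolution be read as [h] tested against a correlation
    function. *)
Lemma kernel_fubini : \int[tau]_x (p x * \int[mu]_z (h z * q (x - z))) =
  \int[mu]_z (h z * \int[tau]_x (p x * q (x - z))).
Proof.
have := Fubini iF.
have ihq x := integrable_kernel_mul x ih cq pq.
have ipq z : tau.-integrable setT (fun x => (p x * q (x - z))%:E).
  have c : continuous (fun x => p x * q (x - z)).
    move=> x; apply: cvgM; first exact: cp.
    apply: (continuous_comp (f := fun x => x - z)); last exact: cq.
    by apply: cvgB; [exact: cvg_id|exact: cvg_cst].
  have pe : periodic (fun x => p x * q (x - z)) 1.
    by move=> x; rewrite pp addrAC pq.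
  exact: (continuous_periodic_integrable c pe).2.
have e1 x : (\int[mu]_z F (x, z))%E = (p x * \int[mu]_z (h z * q (x - z)))%:E.
  rewrite /F /=; under eq_integral do rewrite EFinM.
  by rewrite integralZl// EFinM /Rintegral fineK//; exact: integrable_fin_num.
have e2 z : (\int[tau]_x F (x, z))%E = (h z * \int[tau]_x (p x * q (x - z)))%:E.
  rewrite /F /=.
  have e x : (p x * (h z * q (x - z)))%:E = ((h z)%:E * (p x * q (x - z))%:E)%E.
    by rewrite -EFinM; congr EFin; ring.
  under eq_integral do rewrite e.
  by rewrite integralZl// EFinM /Rintegral fineK//; exact: integrable_fin_num.
under eq_integral do rewrite e1.
under [X in _ = X -> _]eq_integral do rewrite e2.
by rewrite /Rintegral => ->.
Qed.

End fubini.
End symmetry.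

(** * Energy estimate for the difference of two states *)

Section energy.
Context {R : realType}.
Local Notation mu := (@lebesgue_measure R).
Local Notation tau := (torus_measure R).
Variables (h : R -> R) (m1 m2 : R).
Hypothesis rk : regular_kernel h m1 m2.
Variables (U G k V G' k' : R -> R) (L : R).
Hypotheses (repU : H2rep U G k) (repV : H2rep V G' k').
Hypotheses (GL : forall x, `|G x| <= L) (GL' : forall x, `|G' x| <= L).

Let ih := rk_integrable rk.

Let mh : measurable_fun [set: R] h.
Proof. by have /integrableP[/measurable_EFinP] := ih. Qed.

Let W x := U x - V x.
Let a x := (U x + V x) / 2.
Let b x := burgers_flux (U x) - burgers_flux (V x).

(** F(U) - F(V) = (U - V)(U + V)/2; the commutator argument rests on this factorization. *)
Let bE x : b x = W x * a x.
Proof. by rewrite /b /W /a /burgers_flux; field. Qed.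

Let cU := H2rep_U repU.
Let cV := H2rep_U repV.

Let cW : continuous W.
Proof. by move=> x; apply: cvgB; [exact: cU|exact: cV]. Qed.

Let pW : periodic W 1.
Proof. by move=> x; rewrite /W (H2rep_pU repU) (H2rep_pU repV). Qed.

Let cb : continuous b.
Proof. by move=> x; apply: cvgB; exact: continuous_burgers_flux. Qed.

Let pb : periodic b 1.
Proof. by move=> x; rewrite /b (H2rep_pU repU) (H2rep_pU repV). Qed.

Let aL x y : `|a x - a y| <= L * `|x - y|.
Proof.
rewrite (_ : _ - _ = ((U x - U y) + (V x - V y)) / 2); last by rewrite /a; field.
rewrite normrM normfV (ger0_norm (@ler0n R 2)) ler_pdivrMr ?ltr0n//.
rewrite (le_trans (ler_normD _ _))// mulr_natr mulr2n.
by apply: lerD; [exact: (H2rep_lipschitz repU GL)|exact: (H2rep_lipschitz repV GL')].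
Qed.

Definition flux_convolution x := - \int[mu]_z (h z * b (x - z)).
Local Notation B := flux_convolution.

Let continuous_shift f z : continuous f -> continuous (fun x : R => f (x - z) : R).
Proof.
move=> cf x; apply: (continuous_comp (f := fun x => x - z)); last exact: cf.
by apply: cvgB; [exact: cvg_id|exact: cvg_cst].
Qed.

Lemma L2_flux_convolution : LpT 2%:E B.
Proof.
have [M HM] := continuous_periodic_bounded cb pb.
have ihb x := integrable_kernel_mul x ih cb pb.
have iM : mu.-integrable setT (EFin \o (fun z => M * `|h z|)).
  exact: (integrableZl _ M (integrable_norm ih)).
apply: (@bounded_L2 _ B (\int[mu]_z (M * `|h z|))).
- move=> x; congr (- _); apply: eq_Rintegral => z _.
  by rewrite (_ : x + 1 - z = x - z + 1) ?pb// addrAC.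
- apply: measurableT_comp => //.
  apply: (@measurable_Rintegral _ _ _ _ _ mu (fun w : measurableTypeR R * measurableTypeR R =>
    h w.2 * b (w.1 - w.2))).
  apply: measurable_funM; first exact: (measurableT_comp mh).
  have mb : measurable_fun [set: R] b by exact: continuous_measurable_fun.
  by apply: (measurableT_comp mb); exact: measurable_funB.
- move=> x; rewrite normrN (le_trans (le_normr_Rintegral _ (ihb x)))//.
  apply: le_Rintegral => //.
    exact: (integrable_norm (ihb x)).
  by move=> z _; rewrite normrM mulrC ler_wpM2r.
Qed.

(** The terms with the flux taken at x are multiples of the mass of [h], which is 0; only the
    convolution with [b] is left. *)
Lemma nonlocal_kernelB u v :
  measurable_fun [set: R] u -> measurable_fun [set: R] v ->
  {ae tau, forall x, u x = U x} -> {ae tau, forall x, v x = V x} ->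
  {ae tau, forall x, nonlocal_kernel h u x - nonlocal_kernel h v x = B x}.
Proof.
move=> mu_ mv uU vV.
apply: (ae_imp2 _ uU vV) => x ux vx.
have pFb (X : R -> R) : continuous X -> periodic X 1 ->
    mu.-integrable setT (fun z => (h z * (burgers_flux (X x) - burgers_flux (X (x - z))))%:E).
  move=> cX pX; apply: (@integrable_kernel_mul _ h
    (fun y => burgers_flux (X x) - burgers_flux (X y)) x ih).
    by move=> y; apply: cvgB; [exact: cvg_cst|exact: continuous_burgers_flux].
  by move=> y; rewrite pX.
rewrite (nonlocal_kernel_line ih mu_ cU (H2rep_pU repU) uU ux).
rewrite (nonlocal_kernel_line ih mv cV (H2rep_pU repV) vV vx).
rewrite -RintegralB//; [|exact: (pFb _ cU (H2rep_pU repU))|exact: (pFb _ cV (H2rep_pU repV))].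
have e z : h z * (burgers_flux (U x) - burgers_flux (U (x - z))) -
    h z * (burgers_flux (V x) - burgers_flux (V (x - z))) = b x * h z - h z * b (x - z).
  by rewrite /b; ring.
under eq_Rintegral do rewrite e.
rewrite RintegralB//; [|exact: (integrableZl _ (b x) ih)|exact: integrable_kernel_mul].
by rewrite RintegralZl// (rk_mass rk) mulr0 sub0r.
Qed.

(** The correlation of W and b. By translation invariance, changing the sign of z exchanges their
    roles, which is [q_opp]. *)
Let q z := \int[tau]_x (W x * b (x - z)).

Let i_shift z : tau.-integrable setT (fun x => (W x * b (x - z))%:E).
Proof.
apply: (continuous_periodic_integrable _ _).2 => x; last by rewrite /= pW addrAC pb.
by apply: cvgM; [exact: cW|exact: continuous_shift].
Qed.

Let q_opp z : q (- z) = \int[tau]_x (b x * W (x - z)).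
Proof.
have c1 : continuous (fun x => W x * b (x + z)).
  move=> x; apply: cvgM; first exact: cW.
  have := @continuous_shift b (- z) cb x.
  by under eq_fun do rewrite opprK.
have p1 : periodic (fun x => W x * b (x + z)) 1 by move=> x; rewrite pW addrAC pb.
rewrite /q.
under eq_Rintegral do rewrite opprK.
rewrite -(@Rintegral_torus_shift _ (fun x => W x * b (x + z)) (- z))//.
  by apply: eq_Rintegral => x _; rewrite subrK mulrC.
exact: continuous_measurable_fun.
Qed.

Let mq : measurable_fun [set: R] q.
Proof.
have mW : measurable_fun [set: R] W by exact: continuous_measurable_fun.
have mb : measurable_fun [set: R] b by exact: continuous_measurable_fun.
apply: (@measurable_Rintegral _ _ _ _ _ tau (fun w : measurableTypeR R * measurableTypeR R =>
  W w.2 * b (w.2 - w.1))).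
apply: measurable_funM; first exact: (measurableT_comp mW).
by apply: (measurableT_comp mb); exact: measurable_funB.
Qed.

Let ihq (f : R -> R) : measurable_fun [set: R] f ->
  mu.-integrable setT (fun z => (h z * q (f z))%:E).
Proof.
move=> mf.
have [M HM] := continuous_periodic_bounded cb pb.
have [P HP] := continuous_periodic_bounded cW pW.
have qM z : `|q z| <= P * M.
  rewrite (le_trans (le_normr_Rintegral _ (i_shift z)))// -(Rintegral_torus_cst (P * M)).
  apply: le_Rintegral => //.
  - exact: (integrable_norm (i_shift z)).
  - exact: finite_measure_integrable_cst.
  - by move=> x _; rewrite normrM ler_pM.
apply: (@le_integrable _ _ _ mu _ measurableT _ (fun z => (P * M)%:E * (h z)%:E)%E) => //.
- by apply/measurable_EFinP; apply: measurable_funM => //; exact: (measurableT_comp mq mf).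
- move=> z _; rewrite /= lee_fin !normrM mulrC ler_wpM2r//.
  by rewrite (le_trans (qM _))// -normrM ler_norm.
- exact: integrableZl.
Qed.

Let iW2 : tau.-integrable setT (fun x => (W x ^+ 2)%:E).
Proof.
have iW := continuous_periodic_L2 cW pW.
by have := L2_mul_integrable iW iW.
Qed.

(** As b = W a, the integrand is (a(x) - a(x - z)) W(x) W(x - z). The Lipschitz bound on [a] yields
    L |z|, and the product of the two W is at most half the sum of their squares, which have equal
    integrals. *)
Let q_commutator z : `|q (- z) - q z| <= L * `|z| * \int[tau]_x (W x ^+ 2).
Proof.
have L0 : 0 <= L by exact: le_trans (GL 0).
have ibW : tau.-integrable setT (fun x => (b x * W (x - z))%:E).
  apply: (continuous_periodic_integrable _ _).2 => x; last by rewrite /= pb addrAC pW.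
  by apply: cvgM; [exact: cb|exact: continuous_shift].
have cWz : continuous (fun x => W (x - z)) by exact: continuous_shift.
have pWz : periodic (fun x => W (x - z)) 1 by move=> x; rewrite addrAC pW.
have iWz := continuous_periodic_L2 cWz pWz.
have iWz2 : tau.-integrable setT (fun x => (W (x - z) ^+ 2)%:E).
  by have := L2_mul_integrable iWz iWz.
have i2 : tau.-integrable setT (fun x => (W x ^+ 2 + W (x - z) ^+ 2)%:E).
  exact: (integrableD _ iW2 iWz2).
have iD : tau.-integrable setT (fun x => (b x * W (x - z) - W x * b (x - z))%:E).
  exact: (integrableB _ ibW (i_shift z)).
have -> : q (- z) - q z = \int[tau]_x (b x * W (x - z) - W x * b (x - z)).
  by rewrite q_opp /q; apply: esym; exact: (RintegralB _ ibW (i_shift z)).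
rewrite (le_trans (le_normr_Rintegral _ iD))//.
apply: (@le_trans _ _ (\int[tau]_x (L * `|z| / 2 * (W x ^+ 2 + W (x - z) ^+ 2)))).
  apply: le_Rintegral => //.
  - exact: (integrable_norm iD).
  - exact: (integrableZl _ (L * `|z| / 2) i2).
  - move=> x _; rewrite !bE.
    rewrite (_ : _ - _ = (a x - a (x - z)) * (W x * W (x - z))); last by ring.
    rewrite normrM -mulrA; apply: ler_pM => //.
      by have := aL x (x - z); rewrite subKr.
    rewrite normrM -[W x ^+ 2]real_normK ?num_real// -[W (x - z) ^+ 2]real_normK ?num_real//.
    by have := sqr_ge0 (`|W x| - `|W (x - z)|); nra.
rewrite RintegralZl// RintegralD//.
rewrite (@Rintegral_torus_shift _ (fun x => W x ^+ 2) (- z)).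
- by rewrite le_eqVlt; apply/orP; left; apply/eqP; field.
- by apply: measurable_funX; exact: continuous_measurable_fun.
- by move=> x; rewrite pW.
Qed.

(* Twice the energy production tests h against the odd part of q, in which the
   Lipschitz factor a only enters through its increments. *)
Lemma energy_estimate :
  2 * \int[tau]_x (W x * B x) <= L * m1 * \int[tau]_x (W x ^+ 2).
Proof.
have L0 : 0 <= L by exact: le_trans (GL 0).
pose E := \int[tau]_x (W x ^+ 2).
have E0 : 0 <= E by apply: Rintegral_ge0 => x _; exact: sqr_ge0.
have mN : measurable_fun [set: R] (fun z : R => - z).
  by apply: continuous_measurable_fun; exact: opp_continuous.
have iWB : tau.-integrable setT (fun x => (W x * B x)%:E).
  by apply: L2_mul_integrable; [exact: continuous_periodic_L2|exact: L2_flux_convolution].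
have ihqT := ihq (@measurable_id _ _ setT).
have ihqN := ihq mN.
have -> : \int[tau]_x (W x * B x) = - \int[mu]_z (h z * q z).
  rewrite -(kernel_fubini ih cW pW cb pb).
  apply: (canRL opprK); rewrite -mulN1r -(RintegralZl _ measurableT iWB).
  by apply: eq_Rintegral => x _; rewrite mulN1r mulrN opprK.
(* Reflecting z and using oddness of h shows that only the odd part of [q] is seen by the
   integral. *)
have odd_q : \int[mu]_z (h z * q z) = - \int[mu]_z (h z * q (- z)).
  rewrite -Rintegral_reflect; last by have /integrableP[/measurable_EFinP] := ihqT.
  rewrite -[RHS]mulN1r -RintegralZl// /Rintegral; congr fine.
  apply: ae_eq_integral => //.
  - apply/measurable_EFinP; apply: measurable_funM.
      exact: (measurableT_comp mh mN).
    exact: (measurableT_comp mq mN).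
  - by have /integrableP[] := integrableZl measurableT (-1) ihqN.
  - by apply: ae_imp (rk_odd rk) => z hz _; rewrite hz mulN1r mulNr.
have -> : 2 * - (\int[mu]_z (h z * q z)) = \int[mu]_z (h z * (q (- z) - q z)) :> R.
  have e z : h z * (q (- z) - q z) = h z * q (- z) - h z * q z by ring.
  under [RHS]eq_Rintegral do rewrite e.
  by rewrite RintegralB// odd_q; ring.
have iC : mu.-integrable setT (fun z => (h z * (q (- z) - q z))%:E).
  have := integrableB measurableT ihqN ihqT.
  by apply: eq_integrable => // z _; rewrite /= -EFinB mulrBr.
have i1 : mu.-integrable setT (fun z => (`|z| * `|h z|)%:E).
  have := integrable_norm (rk_integrable1 rk).
  by apply: eq_integrable => // z _; rewrite /= normrM.
rewrite (le_trans (ler_norm _))// (le_trans (le_normr_Rintegral _ iC))//.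
apply: (@le_trans _ _ (\int[mu]_z (L * E * (`|z| * `|h z|)))).
  apply: le_Rintegral => //.
  - exact: (integrable_norm iC).
  - exact: (integrableZl _ (L * E) i1).
  - move=> z _; rewrite normrM mulrC.
    rewrite (_ : L * E * _ = L * `|z| * E * `|h z|); last by ring.
    by rewrite ler_wpM2r.
rewrite (RintegralZl (L * E) measurableT i1) -/E [L * m1 * E]mulrAC ler_wpM2l ?mulr_ge0//.
rewrite -lee_fin /Rintegral fineK; first exact: (rk_m1 rk).
exact: integrable_fin_num.
Qed.

End energy.

Section L2_norm.
Context {R : realType}.
Local Notation tau := (torus_measure R).
Implicit Types (f g : R -> R).

Definition Rnorm2 f : R := fine (normT 2 f).

Lemma Rnorm2_ge0 f : 0 <= Rnorm2 f.
Proof. exact/fine_ge0/Lnorm_ge0. Qed.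

Lemma L2_sqr_integrable f : LpT 2%:E f -> tau.-integrable setT (fun x => (f x ^+ 2)%:E).
Proof. by move=> i; have := L2_mul_integrable i i. Qed.

Lemma normT2_fin f : LpT 2%:E f -> normT 2 f = (Rnorm2 f)%:E.
Proof.
move=> [_ /mem_set]; rewrite inE => /andP[_]; rewrite inE/= /finite_norm => fy.
by rewrite /Rnorm2 fineK// ge0_fin_numE// Lnorm_ge0.
Qed.

Lemma integral_Rnorm2 f : LpT 2%:E f ->
  (\int[tau]_x (f x ^+ 2)%:E)%E = (Rnorm2 f ^+ 2)%:E.
Proof. by move=> i; rewrite integral_Lnorm2 EFin_expe -normT2_fin. Qed.

Lemma Rintegral_Rnorm2 f : LpT 2%:E f -> \int[tau]_x (f x ^+ 2) = Rnorm2 f ^+ 2.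
Proof. by move=> i; rewrite /Rintegral integral_Rnorm2. Qed.

Lemma L2_measurable f : LpT 2%:E f -> measurable_fun [set: R] f.
Proof. by move=> /LpT2P[]. Qed.

Lemma Rintegral_cauchy_schwarz f g : LpT 2%:E f -> LpT 2%:E g ->
  `|\int[tau]_x (f x * g x)| <= Rnorm2 f * Rnorm2 g.
Proof.
move=> lf lg; have i := L2_mul_integrable lf lg.
rewrite (le_trans (le_normr_Rintegral _ i))//.
rewrite -ler_sqr ?nnegrE ?mulr_ge0 ?Rnorm2_ge0//; last exact: Rintegral_ge0.
have := cauchy_schwarz tau (L2_measurable lf) (L2_measurable lg).
rewrite !integral_Rnorm2// -EFinM exprMn -lee_fin; apply: le_trans.
by rewrite EFin_expe /Rintegral fineK//; exact: integrable_fin_num (integrable_norm i).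
Qed.

Lemma ae_eq_integral_sqr f g : measurable_fun [set: R] f ->
  measurable_fun [set: R] g -> {ae tau, forall x, f x = g x} ->
  (\int[tau]_x (f x ^+ 2)%:E = \int[tau]_x (g x ^+ 2)%:E)%E.
Proof.
move=> mf mg fg; apply: ge0_ae_eq_integral => //.
- exact/measurable_EFinP/measurable_funX.
- exact/measurable_EFinP/measurable_funX.
- by move=> x _; rewrite lee_fin sqr_ge0.
- by move=> x _; rewrite lee_fin sqr_ge0.
- by apply: ae_imp fg => x -> _.
Qed.

Lemma normT2_ae_eq f g : measurable_fun [set: R] f -> measurable_fun [set: R] g ->
  {ae tau, forall x, f x = g x} -> normT 2 f = normT 2 g.
Proof.
move=> mf mg fg.
have : (normT 2 f ^+ 2 = normT 2 g ^+ 2)%E.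
  by rewrite /normT -!integral_Lnorm2; exact: ae_eq_integral_sqr.
by move/eqP; rewrite eq_le !lee_sqr ?Lnorm_ge0// -eq_le => /eqP.
Qed.

End L2_norm.

(** * Difference quotients, two-sided and relative to a set *)

Section difference_quotients.
Context {R : realType}.

Lemma is_derive_quotient (f : R -> R) (t d : R) :
  (f s - f t) / (s - t) @[s --> t^'] --> d -> is_derive t 1 f d.
Proof.
move=> H.
have shift : (fun h => h + t) @ (0 : R)^' --> t^'.
  move=> P /nbhs_ballP[e e0 eP]; apply/nbhs_ballP; exists e => // h he h0.
  apply: eP; last by rewrite -subr_eq0 addrK.
  by move: he; rewrite /ball/= sub0r normrN opprD addrCA subrr addr0 normrN.
have L : h^-1 *: (f (h *: 1 + t) - f t) @[h --> (0 : R)^'] --> d.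
  have := cvg_comp _ _ shift H.
  apply: cvg_trans; apply: near_eq_cvg; apply: nearW => h /=.
  by rewrite addrK /GRing.scale/= mulr1 mulrC.
by apply: DeriveDef; [apply/cvg_ex; exists d|exact/cvg_lim].
Qed.

(** Differentiability relative to [A] gives continuity relative to [A], which includes the endpoints
    of the time interval where only one-sided quotients exist. *)
Lemma continuous_quotient (A : set R) (f : R -> R) (t d : R) :
  (f s - f t) / (s - t) @[s --> within A t^'] --> d ->
  f s @[s --> within A (nbhs t)] --> f t.
Proof.
move=> H.
have Hs : s - t @[s --> within A t^'] --> (0 : R).
  rewrite -(subrr t); apply: cvgB; last exact: cvg_cst.
  by apply: cvg_trans (@cvg_within _ _ _ A) _; exact: cvg_within.
have H2 : (f s - f t) / (s - t) * (s - t) + f t @[s --> within A t^'] --> f t.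
  rewrite -[X in _ --> X]add0r -(mulr0 d).
  by apply: cvgD; [exact: cvgM|exact: cvg_cst].
move=> P nP; have HP := H2 P nP; move: HP; rewrite /= !nbhs_simpl /= => HP.
have : \forall s \near t, s != t -> A s -> P ((f s - f t) / (s - t) * (s - t) + f t) by exact: HP.
rewrite /within/=; apply: filterS => s Hs1 As.
have [->|st] := eqVneq s t; first exact: nbhs_singleton.
by have := Hs1 st As; rewrite divfK ?subr_eq0// subrK.
Qed.

End difference_quotients.

(** * Gronwall's lemma for the squared L^2 norm *)

Section gronwall.
Context {R : realType}.
Local Notation tau := (torus_measure R).
Variables (tmax C : R) (w g : R -> R -> R).
Hypothesis lw : forall t, t \in `[0, tmax] -> LpT 2%:E (w t).
Hypothesis lg : forall t, t \in `[0, tmax] -> LpT 2%:E (g t).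
Hypothesis dw : forall t, t \in `[0, tmax] -> is_time_derivative tmax w t (g t).
Hypothesis wg : forall t, t \in `[0, tmax] ->
  2 * \int[tau]_x (w t x * g t x) <= C * \int[tau]_x (w t x ^+ 2).

Let phi t := \int[tau]_x (w t x ^+ 2).

(** Differentiation of the squared norm along a curve differentiable in L^2. With [q] the error of
    the difference quotient, w(s) = w(t) + (s - t)(q + g), and expanding the square leaves 2 <q, w>
    + (s - t) |q + g|^2 as the error to be controlled. *)
Let cvg_quotient t : t \in `[0, tmax] ->
  (phi s - phi t) / (s - t) @[s --> within `[0, tmax] t^']
    --> 2 * \int[tau]_x (w t x * g t x).
Proof.
move=> tI; pose q s x := (w s x - w t x) / (s - t) - g t x.
have nearI : \forall s \near within `[0, tmax] t^', s \in `[0, tmax] /\ s != t.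
  apply: filterI.
    by apply: withinT.
  exact: (cvg_within _ (nbhs_dnbhs_neq t)).
have c0 : Rnorm2 (q s) @[s --> within `[0, tmax] t^'] --> 0 by exact: (fine_cvg (dw tI)).
have cst : s - t @[s --> within `[0, tmax] t^'] --> (0 : R).
  rewrite -(subrr t); apply: cvgB; last exact: cvg_cst.
  by apply: cvg_trans (@cvg_within _ _ _ _) _; exact: cvg_within.
apply/subr_cvg0; apply: norm_cvg0.
(* The first term bounds the cross term by Cauchy-Schwarz, the second bounds |q + g|^2 by 2 |q|^2 +
   2 |g|^2; both tend to 0 with the norm of [q s] and with s - t. *)
pose bnd s := 2 * (Rnorm2 (q s) * Rnorm2 (w t)) +
  `|s - t| * (2 * Rnorm2 (q s) ^+ 2 + 2 * Rnorm2 (g t) ^+ 2).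
apply: (@squeeze_cvgr _ _ _ _ (fun=> 0) bnd).
- near=> s; rewrite normr_ge0 /=.
  have [sI st] : s \in `[0, tmax] /\ s != t by near: s.
  have lt := lw tI; have ls := lw sI; have lgt := lg tI.
  have lq : LpT 2%:E (q s).
    rewrite /q; apply: L2_sub => //.
    by under eq_fun do rewrite mulrC; exact: L2_scale (L2_sub ls lt).
  have lr := L2_add lq lgt.
  have st0 : s - t != 0 by rewrite subr_eq0.
  have wE x : w s x ^+ 2 = w t x ^+ 2 + (s - t) * (2 * (q s x * w t x) + 2 * (w t x * g t x)
     + (s - t) * ((q s x + g t x) ^+ 2)).
    by rewrite /q; field.
  have i1 := L2_mul_integrable lq lt.
  have i2 := L2_mul_integrable lt lgt.
  have i3 := L2_sqr_integrable lr.
  have j1 : tau.-integrable setT (fun x => (2 * (q s x * w t x))%:E).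
    exact: (integrableZl measurableT 2 i1).
  have j2 : tau.-integrable setT (fun x => (2 * (w t x * g t x))%:E).
    exact: (integrableZl measurableT 2 i2).
  have j3 : tau.-integrable setT (fun x => ((s - t) * (q s x + g t x) ^+ 2)%:E).
    exact: (integrableZl measurableT (s - t) i3).
  have j12 := integrableD measurableT j1 j2.
  have j123 := integrableD measurableT j12 j3.
  have phiE : phi s = phi t + (s - t) * (2 * \int[tau]_x (q s x * w t x)
      + 2 * \int[tau]_x (w t x * g t x) + (s - t) * \int[tau]_x ((q s x + g t x) ^+ 2)).
    rewrite /phi -(RintegralZl _ _ i1)// -(RintegralZl _ _ i2)// -(RintegralZl _ _ i3)//.
    rewrite -(RintegralD _ j1 j2)// -(RintegralD _ j12 j3)// -(RintegralZl _ _ j123)//.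
    rewrite -(RintegralD _ (L2_sqr_integrable lt) (integrableZl measurableT (s - t) j123))//.
    by apply: eq_Rintegral => x _; rewrite wE.
  have r2 : \int[tau]_x ((q s x + g t x) ^+ 2) <= 2 * Rnorm2 (q s) ^+ 2 + 2 * Rnorm2 (g t) ^+ 2.
    have k1 := L2_sqr_integrable lq; have k2 := L2_sqr_integrable lgt.
    have z1 := integrableZl measurableT 2 k1; have z2 := integrableZl measurableT 2 k2.
    rewrite -!Rintegral_Rnorm2// -(RintegralZl _ _ k1)// -(RintegralZl _ _ k2)//.
    rewrite -(RintegralD _ z1 z2)//; apply: le_Rintegral => //.
      exact: (integrableD _ z1 z2).
    by move=> x _; have := sqr_ge0 (q s x - g t x); nra.
  rewrite phiE (_ : (_ + _ - _) / _ - _ = 2 * \int[tau]_x (q s x * w t x) +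
    (s - t) * \int[tau]_x ((q s x + g t x) ^+ 2)); last by field.
  rewrite (le_trans (ler_normD _ _))// !normrM; apply: lerD.
    by rewrite ger0_norm// ler_wpM2l//; exact: Rintegral_cauchy_schwarz.
  apply: ler_wpM2l => //; rewrite ger0_norm//.
  by apply: Rintegral_ge0 => x _; exact: sqr_ge0.
- exact: cvg_cst.
- have H : bnd s @[s --> within `[0, tmax] t^'] -->
      2 * (0 * Rnorm2 (w t)) + `|0 : R| * (2 * (0 * 0) + 2 * Rnorm2 (g t) ^+ 2).
    apply: cvgD.
      by apply: cvgM; [exact: cvg_cst|apply: cvgM => //; exact: cvg_cst].
    apply: cvgM; first exact: cvg_norm.
    apply: cvgD; last exact: cvg_cst.
    by apply: cvgM; [exact: cvg_cst|under eq_fun do rewrite expr2; exact: cvgM].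
  by move: H; rewrite normr0 !mul0r mulr0 addr0.
Unshelve. all: by end_near.
Qed.

Let derive_phi t : t \in `]0, tmax[ -> is_derive t 1 phi (2 * \int[tau]_x (w t x * g t x)).
Proof.
move=> tI; have tI' : t \in `[0, tmax] by exact: subset_itv_oo_cc.
apply: is_derive_quotient => P /(cvg_quotient tI'); rewrite /= !nbhs_simpl/= => H.
have : \forall s \near t^', `[0, tmax]%classic s -> P ((phi s - phi t) / (s - t)) by exact: H.
have : \forall s \near t^', `[0, tmax]%classic s.
  apply: cvg_within; have := near_in_itvoo tI.
  by apply: filterS => s; exact: subset_itv_oo_cc.
by apply: filterS2 => s sI; apply.
Qed.

(** The function exp(-Cs) phi(s) has nonpositive derivative inside the interval and is continuous up
    to its endpoints, so it is nonincreasing. *)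
Lemma gronwall t : t \in `[0, tmax] -> phi t <= expR (C * t) * phi 0.
Proof.
move=> tI.
pose psi s := expR (- (C * s)) * phi s.
have dpsi s : s \in `]0, tmax[ -> is_derive s 1 psi
   (expR (- (C * s)) * (2 * \int[tau]_x (w s x * g s x) - C * phi s)).
  move=> sI; have dp := derive_phi sI.
  have de : is_derive s 1 (fun s => expR (- (C * s))) (- C * expR (- (C * s))).
    have d1 : is_derive s 1 (fun s => - (C * s)) (- C).
      have := is_deriveN (is_deriveZ C (is_derive_id s (1 : R))).
      by rewrite /GRing.scale/= mulr1.
    have := @is_derive1_comp _ expR (fun s => - (C * s)) s _ _ (is_derive_expR (- (C * s))) d1.
    by rewrite mulrC.
  have := is_deriveM de dp.
  rewrite (_ : _ + _ = expR (- (C * s)) * (2 * \int[tau]_x (w s x * g s x) - C * phi s))//.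
  by rewrite /GRing.scale/=; ring.
have : psi t <= psi 0.
  have t0 : 0 <= t by move: tI; rewrite in_itv/= => /andP[].
  have tm : t <= tmax by move: tI; rewrite in_itv/= => /andP[].
  apply: (ler0_derive1_nincr (a := 0) (b := tmax)) => //.
  - by move=> s /dpsi[].
  - move=> s sI; rewrite derive1E; have [_ ->] := dpsi _ sI.
    rewrite pmulr_rle0 ?expR_gt0// subr_le0; apply: wg.
    exact: subset_itv_oo_cc.
  - apply/subspace_continuousP => s sI; apply: cvgM.
      apply: cvg_within_filter.
      have : continuous (fun s => expR (- (C * s))).
        move=> y; apply: continuous_comp; last exact: continuous_expR.
        by apply: cvgN; apply: cvgM; [exact: cvg_cst|exact: cvg_id].
      exact.
    exact: (continuous_quotient (cvg_quotient sI)).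
rewrite /psi mulr0 oppr0 expR0 mul1r expRN => h.
by rewrite -ler_pdivrMl ?expR_gt0.
Qed.

End gronwall.

(** * Uniform estimates *)

Section main_estimates.
Context {R : realType}.
Local Notation mu := (@lebesgue_measure R).
Local Notation tau := (torus_measure R).
Variables (eta : R -> R) (r : R).
Hypotheses (heta : admissible_kernel eta) (r0 : 0 < r).

Let L := 2 * (1 + r ^+ 2).
Let M1 := fine (\int[mu]_z (`|z| * `|eta z|)%:E).
Let M2 := fine (\int[mu]_z (`|z| ^+ 2 * `|eta z|)%:E).

(** A sum in place of a maximum: L M1 is the energy rate, the last term is the consistency constant
    divided by eps, and 1 makes the total positive. *)
Definition uniform_const : R := 1 + L * M1 + (1 + flux_const L (r ^+ 2)) * M2.
Local Notation C := uniform_const.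

Let L0 : 0 <= L. Proof. by rewrite mulr_ge0// addr_ge0// sqr_ge0. Qed.

Let M1_ge0 : 0 <= M1.
Proof. by apply/fine_ge0/integral_ge0 => z _; rewrite lee_fin mulr_ge0. Qed.

Let M2_ge0 : 0 <= M2.
Proof. by apply/fine_ge0/integral_ge0 => z _; rewrite lee_fin mulr_ge0// exprn_ge0. Qed.

Let fc_ge0 : 0 <= flux_const L (r ^+ 2).
Proof.
apply: addr_ge0; last by rewrite divr_ge0// exprn_even_ge0.
by rewrite mulr_ge0 ?sqr_ge0// mulr_ge0// sqr_ge0.
Qed.

Lemma uniform_const_gt0 : 0 < C.
Proof. by rewrite /uniform_const -addrA ltr_pwDl// addr_ge0// mulr_ge0// addr_ge0. Qed.

Lemma H2T_bounded_rep u : H2T u -> (H2norm u <= r%:E)%E ->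
  exists U G, [/\ H2rep U G (weak_derivative (weak_derivative u)),
    {ae tau, forall x, u x = U x},
    forall x, `|U x| <= L, forall x, `|G x| <= L &
    (\int[tau]_x (weak_derivative (weak_derivative u) x ^+ 2)%:E <= (r ^+ 2)%:E)%E].
Proof.
move=> Hu Hr; have [U [G [rep uU gG]]] := H2T_rep Hu.
have [bu bg bk] := H2norm_le (ltW r0) Hr.
have [lu /weak_derivativeP[lg _] _] := Hu.
have mU : measurable_fun [set: R] U.
  by apply: continuous_measurable_fun; exact: (H2rep_U rep).
have mG : measurable_fun [set: R] G.
  by apply: continuous_measurable_fun; exact: (H2rep_G rep).
rewrite (ae_eq_integral_sqr (L2_measurable lu) mU uU) in bu.
rewrite (ae_eq_integral_sqr (L2_measurable lg) mG gG) in bg.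
have b := H2rep_sup rep bu bg bk.
by exists U, G; split => // x; have [] := b x.
Qed.

Lemma H2_consistent eps u : 0 < eps -> H2T u -> (H2norm u <= r%:E)%E ->
  consistent_at eta C eps u.
Proof.
move=> e0 Hu Hr; have [U [G [rep uU UL GL bk]]] := H2T_bounded_rep Hu Hr.
have [lu _ _] := Hu.
have [wd nle] := consistency (scaled_regular_kernel e0 heta) rep UL GL bk lu uU.
split => //; apply: (le_trans nle); rewrite lee_fin mulrCA mulrC ler_wpM2r ?(ltW e0)//.
by rewrite lerDr addr_ge0// mulr_ge0.
Qed.

(** The difference of the operators is replaced by an almost everywhere equal convolution, which is
    known to be periodic and square integrable. *)
Lemma H2_energy eps u v : 0 < eps -> H2T u -> H2T v ->
  (H2norm u <= r%:E)%E -> (H2norm v <= r%:E)%E ->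
  exists g, [/\ LpT 2%:E g,
    {ae tau, forall x, nonlocal eta eps u x - nonlocal eta eps v x = g x} &
    2 * \int[tau]_x ((u x - v x) * g x) <= C * \int[tau]_x ((u x - v x) ^+ 2)].
Proof.
move=> e0 Hu Hv Hur Hvr.
have [U [G [rep uU UL GL bk]]] := H2T_bounded_rep Hu Hur.
have [V [G' [rep' vV VL GL' bk']]] := H2T_bounded_rep Hv Hvr.
have [lu _ _] := Hu; have [lv _ _] := Hv.
have rk := scaled_regular_kernel e0 heta.
set h := fun z => _ in rk.
have lg := L2_flux_convolution rk rep rep'.
exists (flux_convolution h U V); split => //.
  exact: (nonlocal_kernelB rk rep rep' (L2_measurable lu) (L2_measurable lv) uU vV).
have mg := L2_measurable lg.
have mw := L2_measurable (L2_sub lu lv).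
have mU : measurable_fun [set: R] U.
  by apply: continuous_measurable_fun; exact: (H2rep_U rep).
have mV : measurable_fun [set: R] V.
  by apply: continuous_measurable_fun; exact: (H2rep_U rep').
have mW : measurable_fun [set: R] (fun x => U x - V x) by exact: measurable_funB.
have wW : {ae tau, forall x, u x - v x = U x - V x}.
  by apply: (ae_imp2 _ uU vV) => x -> ->.
have -> : \int[tau]_x ((u x - v x) * flux_convolution h U V x) =
    \int[tau]_x ((U x - V x) * flux_convolution h U V x).
  by apply: Rintegral_ae_eq; [exact: measurable_funM..|apply: ae_imp wW => x ->].
have -> : \int[tau]_x ((u x - v x) ^+ 2) = \int[tau]_x ((U x - V x) ^+ 2).
  by apply: Rintegral_ae_eq; [exact: measurable_funX..|apply: ae_imp wW => x ->].
apply: (le_trans (energy_estimate rk rep rep' GL GL')).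
apply: ler_wpM2r; first by apply: Rintegral_ge0 => x _; exact: sqr_ge0.
rewrite /uniform_const addrAC lerDr addr_ge0// mulr_ge0//.
by rewrite addr_ge0.
Qed.

(** Time derivatives are limits of L^2 norms, so Minkowski's inequality gives the difference rule
    and an almost everywhere equal derivative [k] may be substituted. *)
Lemma is_time_derivativeB tmax (u v : R -> R -> R) (f g k : R -> R) t :
  t \in `[0, tmax] ->
  (forall s, s \in `[0, tmax] -> measurable_fun [set: R] (u s)) ->
  (forall s, s \in `[0, tmax] -> measurable_fun [set: R] (v s)) ->
  measurable_fun [set: R] f -> measurable_fun [set: R] g ->
  measurable_fun [set: R] k -> {ae tau, forall x, f x - g x = k x} ->
  is_time_derivative tmax u t f -> is_time_derivative tmax v t g ->
  is_time_derivative tmax (fun s => u s \- v s) t k.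
Proof.
move=> tI mu_ mv mf mg mk fgk du dv; rewrite /is_time_derivative.
have FF : Filter (within `[0, tmax] t^') by exact: within_filter.
have H := @cvgeD _ _ FF _ _ _ 0%E 0%E isT du dv; rewrite adde0 in H.
apply: (@squeeze_cvge _ _ FF _ (fun=> 0%E) _ _ _ 0%E _ H); last exact: cvg_cst.
near=> s; rewrite Lnorm_ge0 /=.
have sI : s \in `[0, tmax] by near: s; exact: withinT.
have mq (w : R -> R -> R) (a : R -> R) :
    (forall s, s \in `[0, tmax] -> measurable_fun [set: R] (w s)) ->
    measurable_fun [set: R] a -> measurable_fun [set: R] (fun x => (w s x - w t x) / (s - t) - a x).
  move=> mw ma; apply: measurable_funB => //; apply: measurable_funM => //.
  by apply: measurable_funB; exact: mw.
have mA := mq _ _ mu_ mf; have mB := mq _ _ mv mg.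
have mN := measurableT_comp (@oppr_measurable R setT) mB.
have mw s' : s' \in `[0, tmax] -> measurable_fun [set: R] (u s' \- v s').
  by move=> /[dup] /mu_ ? /mv ?; exact: measurable_funB.
rewrite (@normT2_ae_eq _ _ _ (mq _ _ mw mk) (measurable_funD mA mN)); last first.
  by apply: ae_imp fgk => x <- /=; ring.
have h2 : 1 <= 2 :> R by rewrite ler1n.
apply: (le_trans (minkowski_EFin tau mA mN h2)).
apply: leeD2l; rewrite le_eqVlt; apply/orP; left; apply/eqP.
exact: (oppe_Lnorm tau (EFin \o (fun x => (v s x - v t x) / (s - t) - g x))).
Unshelve. all: by end_near.
Qed.

Lemma nonlocal_stable eps tmax u v : 0 < eps -> 0 < tmax ->
  nonlocal_solution eta eps tmax u -> nonlocal_solution eta eps tmax v ->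
  H2_bounded tmax r u -> H2_bounded tmax r v -> L2_stable tmax C u v.
Proof.
move=> e0 T0 su sv bu bv t tI.
(* The existential is stated for every time so that [choice] yields a function of [s]; outside the
   interval the value 0 is a placeholder. *)
have E s : exists g, s \in `[0, tmax] -> [/\ LpT 2%:E g,
    {ae tau, forall x, nonlocal eta eps (u s) x - nonlocal eta eps (v s) x = g x} &
    2 * \int[tau]_x ((u s x - v s x) * g x) <= C * \int[tau]_x ((u s x - v s x) ^+ 2)].
  have [sI|] := boolP (s \in `[0, tmax]); last by exists 0.
  have [Hu Hur] := bu _ sI; have [Hv Hvr] := bv _ sI.
  by have [g Hg] := H2_energy e0 Hu Hv Hur Hvr; exists g.
have [g Hg] := choice E.
have mh := integrableP _ _ _ (rk_integrable (scaled_regular_kernel e0 heta)).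
have lu s : s \in `[0, tmax] -> LpT 2%:E (u s) by move=> /su[].
have lv s : s \in `[0, tmax] -> LpT 2%:E (v s) by move=> /sv[].
have lw s : s \in `[0, tmax] -> LpT 2%:E (u s \- v s).
  by move=> sI; exact: L2_sub (lu _ sI) (lv _ sI).
have lg s : s \in `[0, tmax] -> LpT 2%:E (g s) by move=> /Hg[].
have meas s : s \in `[0, tmax] -> measurable_fun [set: R] (nonlocal eta eps (u s)) /\
    measurable_fun [set: R] (nonlocal eta eps (v s)).
  move=> sI; have [/measurable_EFinP mh' _] := mh.
  split; apply: (measurable_nonlocal_kernel mh').
    exact: L2_measurable (lu _ sI).
  exact: L2_measurable (lv _ sI).
have dw s : s \in `[0, tmax] -> is_time_derivative tmax (fun s => u s \- v s) s (g s).
  move=> sI; have [mnu mnv] := meas _ sI; have [lgs fgk _] := Hg _ sI.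
  have [_ du] := su _ sI; have [_ dv] := sv _ sI.
  apply: (is_time_derivativeB sI _ _ mnu mnv (L2_measurable lgs) fgk du dv).
    by move=> s' /lu; exact: L2_measurable.
  by move=> s' /lv; exact: L2_measurable.
have wg s : s \in `[0, tmax] -> 2 * \int[tau]_x ((u s \- v s) x * g s x) <=
    C * \int[tau]_x ((u s \- v s) x ^+ 2) by move=> /Hg[].
have := gronwall lw lg dw wg tI.
have zI : 0 \in `[0, tmax] by rewrite in_itv/= lexx ltW.
rewrite (Rintegral_Rnorm2 (lw _ tI)) (Rintegral_Rnorm2 (lw _ zI)) => h.
rewrite (normT2_fin (lw _ tI)) (normT2_fin (lw _ zI)) -EFinM lee_fin.
(* Gronwall bounds the squared norm with the factor exp(Ct). This factor is at least 1, hence at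
   most its own square, so the norm itself obeys the bound with the same [C]. *)
have e1 : 1 <= expR (C * t).
  rewrite -expR0 ler_expR mulr_ge0 ?(ltW uniform_const_gt0)//.
  by move: tI; rewrite in_itv/= => /andP[].
have exp0 : 0 <= expR (C * t) by exact: expR_ge0.
rewrite -ler_sqr ?nnegrE ?mulr_ge0 ?Rnorm2_ge0// exprMn (le_trans h)//.
by rewrite ler_wpM2r ?sqr_ge0// expr2 ler_peMl.
Qed.

End main_estimates.

Theorem lemma6p2 (R : realType) (eta : R -> R) (heta : admissible_kernel eta) :
  (forall r : R, 0 < r ->
     exists2 C : R, 0 < C &
       forall eps : R, 0 < eps ->
         (forall u : R -> R, H2T u -> LpT +oo%E u ->
            (H2norm u + normT +oo u <= r%:E)%E ->
            consistent_at eta C eps u)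
         /\
         (forall (tmax : R) (u v : R -> R -> R), 0 < tmax ->
            nonlocal_solution eta eps tmax u ->
            nonlocal_solution eta eps tmax v ->
            H2_bounded tmax r u -> H2_bounded tmax r v ->
            L2_stable tmax C u v))
  /\
  (forall (tmax M : R) (B : set (R -> R -> R)) (S : R -> set (R -> R -> R)),
     0 < tmax ->
     (forall u, B u -> burgers_solution tmax u /\ H2_Linfty_bounded tmax M u) ->
     (forall (eps : R) u, 0 < eps -> S eps u ->
        nonlocal_solution eta eps tmax u /\ H2_Linfty_bounded tmax M u) ->
     exists2 C : R, 0 < C &
       forall eps : R, 0 < eps ->
         (forall u v, S eps u -> S eps v -> L2_stable tmax C u v)
         /\
         (forall u (t : R), B u \/ S eps u -> t \in `[0, tmax] ->
            consistent_at eta C eps (u t))).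
Proof.
have H2le (u : R -> R) (r : R) :
    (H2norm u + normT +oo u <= r%:E)%E -> (H2norm u <= r%:E)%E.
  by apply: le_trans; apply: leeDl; exact: Lnorm_ge0.
split=> [r r0|tmax M B S tmax0 HB HS].
  exists (uniform_const eta r); first exact: uniform_const_gt0.
  move=> eps e0; split=> [u Hu _ /H2le ur|tmax u v T0 su sv bu bv].
    exact: H2_consistent.
  exact: (nonlocal_stable heta r0 e0).
(* [M] may have any sign, while the uniform estimates require a positive radius. *)
have r0 : 0 < `|M| + 1 by rewrite ltr_wpDl.
have H2r (u : R -> R -> R) : H2_Linfty_bounded tmax M u -> H2_bounded tmax (`|M| + 1) u.
  move=> bu t /bu[Hu _ /H2le uM]; split => //; apply: (le_trans uM).
  by rewrite lee_fin (le_trans (ler_norm M))// lerDl.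
exists (uniform_const eta (`|M| + 1)); first exact: uniform_const_gt0.
move=> eps e0; split=> [u v /(HS _ _ e0)[su /H2r bu] /(HS _ _ e0)[sv /H2r bv]|u t uBS tI].
  exact: (nonlocal_stable heta r0 e0).
have /H2r bu : H2_Linfty_bounded tmax M u by case: uBS => [/HB[]|/(HS _ _ e0)[]].
by have [] := bu _ tI; exact: H2_consistent.
Qed.
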